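(* Let $B=B^{r_k,s_k}\otimes\cdots\otimes B^{r_1,s_1}$ and let $L$ be the multiplicity array of $B$. Let $\mathcal{P}(B)=\bigcup_\lambda\mathcal{P}(B,\lambda)$, $\mathrm{RC}(L)=\bigcup_\lambda\mathrm{RC}(L,\lambda)$, and let $\Phi:\mathcal{P}(B)\to\mathrm{RC}(L)$ be the algorithmically defined bijection. Then for every $1\le a<n$ the crystal operators $f_a,e_a$ on $\mathcal{P}(B)$ and the operators $\tilde f_a,\tilde e_a$ on $\mathrm{RC}(L)$ satisfy $$\Phi\circ f_a=\tilde f_a\circ\Phi\qquad\text{and}\qquad \Phi\circ e_a=\tilde e_a\circ\Phi$$ on $\mathcal{P}(B)$ (where ''undefined'' is written $0$ and $\Phi(0)=0$; in particular one side is defined if and only if the other is).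
   Context: Fix an integer $n\ge 2$, $I=\{1,\ldots,n-1\}$, $\mathcal{H}=I\times\mathbb{Z}_{>0}$. $\lambda$ always denotes an $n$-tuple of nonnegative integers, and $\epsilon_1,\dots,\epsilon_n$ is the standard basis of $\mathbb{Z}^n$. **Paths.** For $r\in I$, $s\ge1$, $B^{r,s}$ is the set of column-strict Young tableaux of shape $(s^r)$ ($r$ rows, $s$ columns; rows weakly increasing, columns strictly increasing downward) with entries in $\{1,\ldots,n\}$. $B=B^{r_k,s_k}\otimes\cdots\otimes B^{r_1,s_1}$ is the Cartesian product; $\mathrm{wt}(b)=(w_1,\ldots,w_n)$ with $w_i$ the number of letters $i$ in $b$; $\mathcal{P}(B,\lambda)=\{b\in B\mid\mathrm{wt}(b)=\lambda\}$. **Crystal operators on paths.** The word of a tableau is $w_r\cdots w_2w_1$, where $w_k$ is its $k$-th row read left to right. For $b\in B^{r,s}$ consider the subword of letters $i,i+1$ of its word; view each $i+1$ as an opening and each $i$ as a closing bracket and successively remove adjacent matched pairs, leaving $i^p(i+1)^q$. If $p>0$, $f_i(b)$ is obtained by replacing the unmatched subword by $i^{p-1}(i+1)^{q+1}$, otherwise $f_i(b)=0$; if $q>0$, $e_i(b)$ is obtained by replacing it by $i^{p+1}(i+1)^{q-1}$, otherwise $e_i(b)=0$. Put $\varepsilon_i(b)=\max\{k\mid e_i^k(b)\ne0\}$, $\varphi_i(b)=\max\{k\mid f_i^k(b)\neq0\}$. On tensor products, $e_i(b\otimes b')=e_ib\otimes b'$ if $\varepsilon_i(b)>\varphi_i(b')$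 and $b\otimes e_ib'$ otherwise; $f_i(b\otimes b')=f_ib\otimes b'$ if $\varepsilon_i(b)\ge\varphi_i(b')$ and $b\otimes f_ib'$ otherwise. (Equivalently, apply the bracketing rule to the concatenated word $\mathrm{word}(b)\mathrm{word}(b')$.) **Unrestricted rigged configurations.** The multiplicity array of $B$ is $L=(L_i^{(a)})_{(a,i)\in\mathcal{H}}$, with $L_i^{(a)}$ the number of factors $B^{a,i}$ in $B$. Let $\alpha_a=\epsilon_a-\epsilon_{a+1}$, $\Lambda_a=\epsilon_1+\cdots+\epsilon_a$, $(\alpha_a|\alpha_b)$ the Cartan matrix of type $A_{n-1}$. $\mathrm{C}(L,\lambda)$ is the set of sequences of partitions $\nu=(\nu^{(a)})_{a\in I}$ with $\sum_{(a,i)}i\,m_i^{(a)}\alpha_a=\sum_{(a,i)}i\,L_i^{(a)}\Lambda_a-\lambda$, where $m_i^{(a)}=m_i^{(a)}(\nu)$ is the number of parts $i$ in $\nu^{(a)}$. Vacancy numbers: $p_i^{(a)}=p_i^{(a)}(\nu)=\sum_{j\ge1}\min(i,j)L_j^{(a)}-\sum_{(b,j)\in\mathcal{H}}(\alpha_a|\alpha_b)\min(i,j)m_j^{(b)}$. Put $c_k=\lambda_{k+1}+\cdots+\lambda_n$ ($k\ge1$), $c_0=c_1$; let $\lambda'$ be the partition with $k$-th column of height $c_k$, $1\le k\le n-1$. $\mathcal{A}(\lambda')$ is the set of fillings $t=(t_{j,k})$ ($j$ row, $k$ column) of shape $\lambda'$ with entries of column $k$ in $\{1,\ldots,c_{k-1}\}$,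 strictly decreasing down columns. $M_i^{(a)}(t)=-\sum_{j=1}^{c_a}\chi(i\ge t_{j,a})+\sum_{j=1}^{c_{a+1}}\chi(i\ge t_{j,a+1})$, with $\chi$ the truth indicator. An $(M,p,m)$-quasipartition is a tuple of integers with $M\le\mu_m\le\cdots\le\mu_1\le p$ (for $m=0$ the empty tuple, no condition). $\mathrm{RC}(L,\lambda)$ is the set of $(\nu,J)$, $\nu\in\mathrm{C}(L,\lambda)$, $J=(J^{(a,i)})_{(a,i)\in\mathcal{H}}$, such that for some $t\in\mathcal{A}(\lambda')$ every $J^{(a,i)}$ is an $(M_i^{(a)}(t),p_i^{(a)},m_i^{(a)})$-quasipartition. $(\nu,J)$ is viewed as the partitions $\nu^{(a)}$ with the parts of size $i$ labeled by the parts of $J^{(a,i)}$: a pair $(i,x)$, $i$ a part of $\nu^{(a)}$ with label (rigging) $x$ from $J^{(a,i)}$, is a string of $(\nu,J)^{(a)}$; its colabel is $p_i^{(a)}-x$; it is singular if $x=p_i^{(a)}$. $J^{(a,i)}$ is singular if it has a part equal to $p_i^{(a)}$. **Operators on rigged configurations.** $\tilde e_a(\nu,J)$: among the strings of $(\nu,J)^{(a)}$ with the smallest negative rigging take one of smallest length $k$, remove a box from it, increase its label by one (so $(k,x)$ becomes $(k-1,x+1)$), and keep all colabels of all other strings (in all $(\nu,J)^{(b)}$) fixed. If there is no negative rigging, $\tilde e_a(\nu,J)$ is undefined. $\tilde f_a(\nu,J)$: among the strings of $(\nu,J)^{(a)}$ with the smallest nonpositive rigging take one of largest length $k$, add a box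 to it, decrease its label by one (so $(k,x)$ becomes $(k+1,x-1)$), and keep all colabels of all other strings fixed; if there is no nonpositive rigging in $(\nu,J)^{(a)}$, add a new string of length one and label $-1$ (again keeping all other colabels fixed). If the result is not a valid unrestricted rigged configuration, $\tilde f_a(\nu,J)$ is undefined. **Splitting maps.** (1) If $B=B^{1,1}\otimes B'$: $\mathrm{lh}(B)=B'$, $\mathrm{lh}(c\otimes b')=b'$. (2) If $B=B^{r,s}\otimes B'$, $s\ge2$: $\mathrm{ls}(B)=B^{r,1}\otimes B^{r,s-1}\otimes B'$, $\mathrm{ls}(c\otimes b')=c_1\otimes c_2\cdots c_s\otimes b'$, where $c_i$ is the $i$-th column of $c$. (3) If $B=B^{r,1}\otimes B'$, $r\ge2$: $\mathrm{lb}(B)=B^{1,1}\otimes B^{r-1,1}\otimes B'$, and a column with entries $b_1<\cdots<b_r$ tensored with $b'$ is sent to (box $b_r$) $\otimes$ (column $b_1<\cdots<b_{r-1}$) $\otimes\, b'$. $\mathrm{lh}(L),\mathrm{ls}(L),\mathrm{lb}(L)$ denote the multiplicity arrays of $\mathrm{lh}(B),\mathrm{ls}(B),\mathrm{lb}(B)$. **Maps on rigged configurations.** For $L_1^{(1)}>0$, $\delta(\nu,J)$ is: set $\ell^{(0)}=1$; for $a=1,\ldots,n-1$ find the smallest $i\ge\ell^{(a-1)}$ with $J^{(a,i)}$ singular; if none exists set $\mathrm{rk}(\nu,J)=a$ and stop, else $\ell^{(a)}=i$ (if never stopped, $\mathrm{rk}(\nu,J)=n$). Remove a box from the selected singular string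 of length $\ell^{(a)}$ in each $(\nu,J)^{(a)}$ for which $\ell^{(a)}$ is defined, make each shortened string singular with respect to the new vacancy numbers (computed with $\mathrm{lh}(L)$), leave other strings and labels unchanged. Then $\delta$ maps $\mathrm{RC}(L,\lambda)$ to $\bigcup_{\mu\in\lambda^-}\mathrm{RC}(\mathrm{lh}(L),\mu)$, where $\lambda^-$ is the set of nonnegative tuples $\mu$ with $\lambda-\mu=\epsilon_r$ for some $r$. The map $\mathrm{ls}_{rc}:\mathrm{RC}(L,\lambda)\to\mathrm{RC}(\mathrm{ls}(L),\lambda)$ is $(\nu,J)\mapsto(\nu,J)$. The map $\mathrm{lb}_{rc}:\mathrm{RC}(L,\lambda)\to\mathrm{RC}(\mathrm{lb}(L),\lambda)$ (for $B=B^{r,1}\otimes B'$, $r\geq 2$) adds a singular string of length $1$ to $(\nu,J)^{(a)}$ for each $1\le a<r$. **The bijection $\Phi$.** $\Phi:\mathcal{P}(B,\lambda)\to\mathrm{RC}(L,\lambda)$ is the (unique, bijective) family of maps, for all $B$ and $\lambda$, sending the empty path to the empty rigged configuration and satisfying: $\delta\circ\Phi=\Phi\circ\mathrm{lh}$ if $B=B^{1,1}\otimes B'$; $\mathrm{ls}_{rc}\circ\Phi=\Phi\circ\mathrm{ls}$ if $B=B^{r,s}\otimes B'$ with $s\ge2$; $\mathrm{lb}_{rc}\circ\Phi=\Phi\circ\mathrm{lb}$ if $B=B^{r,1}\otimes B'$ with $r\ge2$. *)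

(* Defs.v *)
From HB Require Import structures.
From mathcomp Require Import all_boot all_order all_algebra.
From mathcomp Require Import finmap multiset.
From mathcomp Require Import boolp classical_sets functions.

Set Implicit Arguments.
Unset Strict Implicit.
Unset Printing Implicit Defensive.

Import Order.TTheory GRing.Theory Num.Theory.

(* Conventions.  Letters, the index set I = {1, ..., n-1}, tableau rows and
   columns are numbered from 1, as natural numbers.  A finite multiset is a
   {mset T}: [A x] is the multiplicity of [x] in [A], and a big operator over
   [x <- A] runs over the elements of [A] with multiplicity; see [sum_mset] in
   multiset.v.  Partial maps, whose undefined value is written 0 on paper, are
   maps to an option type. *)

(** * Paths and their crystal operators *)

Section Paths.
Local Open Scope nat_scope.

(* A tableau is the sequence of its rows, top row first. *)
Definition tableau : Type := seq (seq nat).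

Definition is_tableau (n r s : nat) (T : tableau) : bool :=
  [&& size T == r,
      all (fun row => [&& size row == s, sorted leq row
                        & all (fun x => 1 <= x <= n) row]) T
    & sorted (all2 ltn) T].

(* The list of the (r_j, s_j), and a path, are given with the leftmost tensor
   factor first: B^{r_k,s_k} (x) ... (x) B^{r_1,s_1} is
   [:: (r_k, s_k); ...; (r_1, s_1)]. *)
Definition shapes : Type := seq (nat * nat).
Definition cpath : Type := seq tableau.

Definition is_shapes (n : nat) (B : shapes) : bool :=
  all (fun x => (1 <= x.1 < n) && (1 <= x.2)) B.

Definition is_path (n : nat) (B : shapes) (b : cpath) : bool :=
  all2 (fun x T => is_tableau n x.1 x.2 T) B b.

Definition word (T : tableau) : seq nat := flatten (rev T).

(* The tableau with the same shape as [T] and word [w]. *)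
Definition unword (T : tableau) (w : seq nat) : tableau :=
  rev (reshape (shape (rev T)) w).

Definition letters (b : cpath) : seq nat := flatten (map word b).

Definition wt (n : nat) (b : cpath) : n.-tuple nat :=
  [tuple count_mem (i.+1 : nat) (letters b) | i < n].

Definition paths (n : nat) (B : shapes) (lam : n.-tuple nat) : set cpath :=
  [set b | is_path n B b /\ wt n b = lam]%classic.

Definition all_paths (n : nat) (B : shapes) : set cpath :=
  (\bigcup_(lam : n.-tuple nat) paths B lam)%classic.

(* The positions, in increasing order, of the letters i and i+1 of [w] that
   remain when matched pairs (an i+1 followed by an i) are removed: the subword
   is read from its end, and [s] holds what remains of the part already read. *)
Definition cancel_pair (i : nat) (w : seq nat) (j : nat) (s : seq nat) :
    seq nat :=
  if s is k :: s' then
    if (nth 0 w j == i.+1) && (nth 0 w k == i) then s' else j :: s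
  else [:: j].

Definition unmatched (i : nat) (w : seq nat) : seq nat :=
  foldr (cancel_pair i w) [::]
    [seq j <- iota 0 (size w) | nth 0 w j \in [:: i; i.+1]].

Definition write (w ps vs : seq nat) : seq nat :=
  foldr (fun pv w' => set_nth 0 w' pv.1 pv.2) w (zip ps vs).

Definition word_f (i : nat) (w : seq nat) : option (seq nat) :=
  let u := unmatched i w in
  let p := count (fun j => nth 0 w j == i) u in
  let q := count (fun j => nth 0 w j == i.+1) u in
  if 0 < p then Some (write w u (nseq p.-1 i ++ nseq q.+1 i.+1)) else None.

Definition word_e (i : nat) (w : seq nat) : option (seq nat) :=
  let u := unmatched i w in
  let p := count (fun j => nth 0 w j == i) u in
  let q := count (fun j => nth 0 w j == i.+1) u in
  if 0 < q then Some (write w u (nseq p.+1 i ++ nseq q.-1 i.+1)) else None.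

Definition tab_f (i : nat) (T : tableau) : option tableau :=
  omap (unword T) (word_f i (word T)).
Definition tab_e (i : nat) (T : tableau) : option tableau :=
  omap (unword T) (word_e i (word T)).

(* max {k <= N | op^k x is defined} *)
Definition max_iter (X : Type) (op : X -> option X) (N : nat) (x : X) : nat :=
  \max_(k < N.+1 | isSome (iter k (obind op) (Some x))) k.

(* Each application of e_i or f_i changes one letter between i+1 and i, always
   in the same direction, so the number of letters bounds the number of
   iterations. *)
Definition tab_eps (i : nat) (T : tableau) : nat :=
  max_iter (tab_e i) (size (word T)) T.

(* f_i on tensor products of [k] factors; the recursion is on [k] because
   phi_i(b') iterates f_i on b'. *)
Fixpoint tensor_f (k i : nat) (b : cpath) : option cpath :=
  match k, b with
  | k'.+1, c :: b' =>
      if max_iter (tensor_f k' i) (size (letters b')) b' <= tab_eps i c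
      then omap (fun c' => c' :: b') (tab_f i c)
      else omap (cons c) (tensor_f k' i b')
  | _, _ => None
  end.

Definition path_f (i : nat) (b : cpath) : option cpath :=
  tensor_f (size b) i b.

Definition path_phi (i : nat) (b : cpath) : nat :=
  max_iter (path_f i) (size (letters b)) b.

Fixpoint path_e (i : nat) (b : cpath) : option cpath :=
  if b is c :: b' then
    if path_phi i b' < tab_eps i c
    then omap (fun c' => c' :: b') (tab_e i c)
    else omap (cons c) (path_e i b')
  else None.

(* Splitting maps; each is meant for the stated form of the leftmost factor and
   the other values are junk. *)

(* (1,1) *)
Definition lh_shapes (B : shapes) : shapes := behead B.
Definition lh (b : cpath) : cpath := behead b.

(* (r,s) with s >= 2 *)
Definition ls_shapes (B : shapes) : shapes :=
  if B is (r, s) :: B' then [:: (r, 1), (r, s.-1) & B'] else B.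
Definition ls (b : cpath) : cpath :=
  if b is c :: b' then [:: map (take 1) c, map behead c & b'] else b.

(* (r,1) with r >= 2 *)
Definition lb_shapes (B : shapes) : shapes :=
  if B is (r, _) :: B' then [:: (1, 1), (r.-1, 1) & B'] else B.
Definition lb (b : cpath) : cpath :=
  if b is c :: b' then
    [:: [:: last [::] c], take (size c).-1 c & b'] else b.

End Paths.

(** * Unrestricted rigged configurations *)

Local Open Scope ring_scope.
Local Open Scope mset_scope.

(* L (a, i) = L_i^(a) *)
Definition mult_array (B : shapes) : {mset nat * nat} := seq_mset B.

(* A sequence of partitions: nu a = nu^(a) is the multiset of its parts, so that
   nu a i = m_i^(a). *)
Definition partitions : Type := nat -> {mset nat}.

(* A string is a pair (length, rigging), and [strings rc a] is the multiset of
   strings of (nu, J)^(a); the parts of J^(a,i) are the riggings of the strings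
   of length i in [strings rc a]. *)
Definition rconf : Type :=
  {fsfun nat -> {mset nat * int} with (@mset0 (nat * int)%type)}.

Definition strings (rc : rconf) (a : nat) : {mset nat * int} := rc a.

Definition empty_rconf : rconf := [fsfun].

Definition lengths (S : {mset nat * int}) : {mset nat} :=
  seq_mset [seq s.1 | s <- S].

Definition nu_of (rc : rconf) : partitions := fun a => lengths (strings rc a).

(* J^(a,i) *)
Definition riggings (rc : rconf) (a i : nat) : seq int :=
  sort (fun x y => y <= x) [seq s.2 | s <- strings rc a & s.1 == i].

Definition epsilon (n k : nat) : 'rV[int]_n := \row_(j < n) (j.+1 == k)%:R.
Definition alpha (n a : nat) : 'rV[int]_n := epsilon n a - epsilon n a.+1.
Definition Lambda (n a : nat) : 'rV[int]_n :=
  \sum_(1 <= k < a.+1) epsilon n k.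

(* The Cartan matrix of type A. *)
Definition cartan (a b : nat) : int :=
  if a == b then 2
  else if (a == b.+1) || (b == a.+1) then -1 else 0.

(* C(L, lambda) *)
Definition is_configuration (n : nat) (L : {mset nat * nat})
    (lam : n.-tuple nat) (nu : partitions) : Prop :=
  (forall a, (1 <= a < n)%N -> 0%N \notin nu a) /\
  \sum_(1 <= a < n) \sum_(i <- nu a) alpha n a *+ i =
    \sum_(x <- L) Lambda n x.1 *+ x.2 - \row_(j < n) (tnth lam j)%:Z.

(* p_i^(a) *)
Definition vacancy (n : nat) (L : {mset nat * nat}) (nu : partitions)
    (a i : nat) : int :=
  \sum_(x <- L | x.1 == a) (minn i x.2)%:Z
  - \sum_(1 <= b < n) \sum_(j <- nu b) cartan a b * (minn i j)%:Z.

(* c_k = lambda_{k+1} + ... + lambda_n for k >= 1 and c_0 = c_1; here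
   tnth lam j = lambda_{j+1}. *)
Definition colsize (n : nat) (lam : n.-tuple nat) (k : nat) : nat :=
  (\sum_(j < n | maxn k 1 <= j) tnth lam j)%N.

(* A(lambda'); t j k is the entry in row j and column k, and only the entries
   with 1 <= k <= n-1 and 1 <= j <= c_k matter. *)
Definition is_filling (n : nat) (lam : n.-tuple nat) (t : nat -> nat -> nat) :
    Prop :=
  forall k, (1 <= k < n)%N ->
    (forall j, (1 <= j <= colsize lam k)%N ->
       (1 <= t j k <= colsize lam k.-1)%N) /\
    (forall j, (1 <= j < colsize lam k)%N -> (t j.+1 k < t j k)%N).

(* M_i^(a)(t); for a = n-1 the second sum is empty, as c_n = 0. *)
Definition lower_bound (n : nat) (lam : n.-tuple nat) (t : nat -> nat -> nat)
    (a i : nat) : int :=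
  - (\sum_(1 <= j < (colsize lam a).+1) (t j a <= i))%N%:Z
  + (\sum_(1 <= j < (colsize lam a.+1).+1) (t j a.+1 <= i))%N%:Z.

Definition quasipartition (M p : int) (m : nat) (mu : seq int) : bool :=
  [&& size mu == m, sorted (fun x y => y <= x) mu
    & all (fun x => M <= x <= p) mu].

Definition RC (n : nat) (L : {mset nat * nat}) (lam : n.-tuple nat) :
    set rconf :=
  [set rc : rconf |
    [/\ forall a, ~~ (1 <= a < n)%N -> strings rc a = mset0,
        is_configuration L lam (nu_of rc)
      & exists2 t, is_filling lam t &
          forall a i, (1 <= a < n)%N -> (1 <= i)%N ->
            quasipartition (lower_bound lam t a i) (vacancy n L (nu_of rc) a i)
              (nu_of rc a i) (riggings rc a i)]]%classic.

Definition all_RC (n : nat) (L : {mset nat * nat}) : set rconf :=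
  (\bigcup_(lam : n.-tuple nat) RC L lam)%classic.

(** * Operators on rigged configurations *)

Definition I_set (n : nat) : {fset nat} := [fset a in iota 1 n.-1]%fset.

(* Strings of length 0 and parts of size 0 disappear. *)
Definition mset_string (s : nat * int) : {mset nat * int} :=
  if s.1 == 0%N then mset0 else [mset s].
Definition mset_part (i : nat) : {mset nat} :=
  if i == 0%N then mset0 else [mset i].

(* Replace the strings [old] of (nu, J)^(a) by the strings [new], and keep the
   colabels of all other strings fixed. *)
Definition replace_strings (n : nat) (L : {mset nat * nat}) (a : nat)
    (old new : {mset nat * int}) (rc : rconf) : rconf :=
  let kept (b : nat) := if b == a then strings rc b `\` old else strings rc b in
  let added (b : nat) := if b == a then new else mset0 in
  let nu' b := lengths (kept b `+` added b) in
  let relabel b (s : nat * int) :=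
    (s.1, s.2 - vacancy n L (nu_of rc) b s.1 + vacancy n L nu' b s.1) in
  [fsfun b in I_set n =>
     (seq_mset [seq relabel b s | s <- kept b] `+` added b)].

(* Smallest negative rigging, then smallest length. *)
Definition e_string (S : {mset nat * int}) : option (nat * int) :=
  ohead (sort (fun s t => (s.2 < t.2) || ((s.2 == t.2) && (s.1 <= t.1)%N))
           [seq s <- S | s.2 < 0]).

(* Smallest nonpositive rigging, then largest length. *)
Definition f_string (S : {mset nat * int}) : option (nat * int) :=
  ohead (sort (fun s t => (s.2 < t.2) || ((s.2 == t.2) && (t.1 <= s.1)%N))
           [seq s <- S | s.2 <= 0]).

Definition rc_e (n : nat) (L : {mset nat * nat}) (a : nat) (rc : rconf) :
    option rconf :=
  if e_string (strings rc a) is Some (k, x) then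
    Some (replace_strings n L a [mset (k, x)] (mset_string (k.-1, x + 1)) rc)
  else None.

Definition rc_f (n : nat) (L : {mset nat * nat}) (a : nat) (rc : rconf) :
    option rconf :=
  let rc' :=
    if f_string (strings rc a) is Some (k, x)
    then replace_strings n L a [mset (k, x)] [mset (k.+1, x - 1)] rc
    else replace_strings n L a mset0 [mset (1%N, -1)] rc in
  if rc' \in all_RC n L then Some rc' else None.

Definition singular (n : nat) (L : {mset nat * nat}) (rc : rconf) (a i : nat) :
    bool :=
  vacancy n L (nu_of rc) a i \in riggings rc a i.

(* The smallest i >= l such that J^(a,i) is singular. *)
Definition next_singular (n : nat) (L : {mset nat * nat}) (rc : rconf)
    (a l : nat) : option nat :=
  ohead (sort leq
    [seq i <- nu_of rc a | (l <= i)%N && singular n L rc a i]).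

(* ell^(a); once undefined it stays so. *)
Fixpoint ell (n : nat) (L : {mset nat * nat}) (rc : rconf) (a : nat) :
    option nat :=
  if a is a'.+1 then obind (next_singular n L rc a) (ell n L rc a')
  else Some 1%N.

Definition delta (n : nat) (L : {mset nat * nat}) (rc : rconf) : rconf :=
  let L' := L `\ (1%N, 1%N) in
  let kept a :=
    if ell n L rc a is Some l
    then strings rc a `\ (l, vacancy n L (nu_of rc) a l) else strings rc a in
  let nu' a :=
    if ell n L rc a is Some l
    then lengths (kept a) `+` mset_part l.-1 else lengths (kept a) in
  [fsfun a in I_set n =>
     (if ell n L rc a is Some l
      then kept a `+` mset_string (l.-1, vacancy n L' nu' a l.-1)
      else kept a)].

Definition ls_rc (rc : rconf) : rconf := rc.

(* [L'] is the multiplicity array of the target, lb(L). *)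
Definition lb_rc (n : nat) (L' : {mset nat * nat}) (r : nat) (rc : rconf) :
    rconf :=
  let nu' a :=
    if (1 <= a < r)%N then nu_of rc a `+` [mset 1%N] else nu_of rc a in
  [fsfun a in I_set n =>
     (if (1 <= a < r)%N
      then strings rc a `+` [mset (1%N, vacancy n L' nu' a 1%N)]
      else strings rc a)].

(** * The bijection Phi *)

(* The defining property of the family Phi: [Phi B] restricts, for every lambda,
   to the map from P(B, lambda) to RC(L, lambda). *)
Record is_Phi (n : nat) (Phi : shapes -> cpath -> rconf) : Prop := IsPhi {
  Phi_bij : forall (B : shapes) (lam : n.-tuple nat), is_shapes n B ->
    set_bij (paths B lam) (RC (mult_array B) lam) (Phi B);
  Phi_nil : Phi [::] [::] = empty_rconf;
  Phi_lh : forall (B' : shapes) (b : cpath),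
    let B := (1%N, 1%N) :: B' in
    is_shapes n B -> all_paths n B b ->
    delta n (mult_array B) (Phi B b) = Phi (lh_shapes B) (lh b);
  Phi_ls : forall (r s : nat) (B' : shapes) (b : cpath),
    let B := (r, s) :: B' in
    (2 <= s)%N -> is_shapes n B -> all_paths n B b ->
    ls_rc (Phi B b) = Phi (ls_shapes B) (ls b);
  Phi_lb : forall (r : nat) (B' : shapes) (b : cpath),
    let B := (r, 1%N) :: B' in
    (2 <= r)%N -> is_shapes n B -> all_paths n B b ->
    lb_rc n (mult_array (lb_shapes B)) r (Phi B b) = Phi (lb_shapes B) (lb b)
}.

(* Main.v *)
Require Import Defs.
From mathcomp Require Import all_boot all_order all_algebra.
From mathcomp Require Import finmap multiset.
From mathcomp Require Import boolp classical_sets functions.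
From mathcomp Require Import zify ring.

Set Implicit Arguments.
Unset Strict Implicit.
Unset Printing Implicit Defensive.

Import Order.TTheory GRing.Theory Num.Theory.

(* Only the lowering operators need work: with s the smallest nonpositive
   rigging (or 0), the induction also gives s = - epsilon_a, and then the
   raising operators follow because both sides invert the lowering ones.

   Validity is tested through an upper bound alone.  If (k, s) is the string
   that is lowered, the result has all riggings at most the vacancy numbers if
   and only if s < phi_a - epsilon_a, the limit of p_i^(a) for large i; this is
   concavity of i |-> p_i^(a) between consecutive parts of nu^(a).  The lower
   bounds M_i^(a)(t) never occur: that Phi f_a b lies in RC is part of the bijectivity
   of Phi, and delta, with the rank prescribed, is injective on all
   configurations whose riggings are at most the vacancy numbers.

   The splittings ls and lb commute with everything: row and column reading of
   a tableau leave the same letters unmatched, lowering a rigged configuration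
   does not depend on L, and the singular string of length 1 added by lb is
   never the lowered one.  For a factor B^{1,1} with letter x <= a, delta
   does not change the strings of (nu, J)^(a); if x = a and phi_a of the tail is
   0, then lowering turns the rank a into a+1.  For x > a, let delta remove a box
   from a string of length l in (nu, J)^(a).  Either the lowered string is the
   same before and after delta, or p^(a) is constant in between and the two
   operations trade places: lowering (k, s) makes delta select the new string
   of length k+1, and after delta the lowered string has length l-1. *)

(** * The signature rule on labelled words *)

(** Why $p^{(a)}$ is constant when lowering and delta interfere: riggings in component $a$ are at
    least $s$, and strings of lengths in $[\ell^{(a-1)},\ell^{(a)})$ are not singular, so $p^{(a)}$
    exceeds $s$ at these parts. Between consecutive parts it is concave, and a concave function that
    comes down to a lower bound of its boundary values inside the interval is constant. On a plateau
    the second difference vanishes, so the neighbouring components have no part of these lengths.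
    But $\ell^{(a-1)}$ before delta and $\ell^{(a+1)}-1$ after it are lengths of such parts (for
    $a=1$ the factor $B^{1,1}$ takes the place of the former). Only the configurations in which the
    operations trade places remain. Creating the string $(1,-1)$ is treated as lowering a string
    $(0,0)$; as $p_0=0$, the concavity arguments then start at length 0 and cover it. *)

(* Pairs (letter, label); the labels keep track of letters when words are
   rearranged. *)
Definition lword := seq (nat * nat).

Section Signature.
Variable a : nat.
Implicit Types (w : lword) (d : nat) (s t : seq nat * seq nat).

Definition sg_step (c : nat * nat) s : seq nat * seq nat :=
  if c.1 == a then (c.2 :: s.1, s.2)
  else if c.1 == a.+1 then
    (if s.1 is _ :: A then (A, s.2) else ([::], c.2 :: s.2))
  else s.

(* The labels of the unmatched letters a, and those of the unmatched letters
   a+1, both in reading order. *)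
Definition sg w := foldr sg_step ([::], [::]) w.

(** The product of the bicyclic monoid, with labels: the last unmatched [a.+1] of the left word
    cancel against the first unmatched [a] of the right word. *)
Definition sg_mul s t : seq nat * seq nat :=
  (s.1 ++ drop (size s.2) t.1, take (size s.2 - size t.1) s.2 ++ t.2).

Lemma sg_step_mul c s t : sg_step c (sg_mul s t) = sg_mul (sg_step c s) t.
Proof.
case: s t => A1 C1 [A2 C2]; rewrite /sg_step /sg_mul /=.
case: eqP => _ //=; case: eqP => _ //=; case: A1 => [|y A1] //=.
case E : (drop (size C1) A2) => [|y A].
  have h : size A2 <= size C1.
    by have := size_drop (size C1) A2; rewrite E /=; lia.
  by rewrite drop_oversize ?subSn //=; lia.
have h : size C1 < size A2.
  by have := size_drop (size C1) A2; rewrite E /=; lia.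
have -> : size C1 - size A2 = 0 by lia.
have -> : (size C1).+1 - size A2 = 0 by lia.
by rewrite take0 -addn1 addnC -drop_drop E /= drop0.
Qed.

Lemma sg_cat u v : sg (u ++ v) = sg_mul (sg u) (sg v).
Proof.
elim: u => [|c u IH] /=; last by rewrite IH sg_step_mul.
by rewrite /sg_mul /= drop0; case: (sg v).
Qed.

Lemma sg_sub w : {subset (sg w).1 ++ (sg w).2 <= [seq c.2 | c <- w]}.
Proof.
elim: w => [|c w IH] //= d; rewrite inE /sg_step.
case: (sg w) IH => A C /= IH; case: eqP => _ /=.
  by rewrite inE => /orP[->//|/IH ->]; rewrite orbT.
case: eqP => _ /=; last by move=> /IH ->; rewrite orbT.
case: A IH => [|y A] IH /=; first by rewrite inE => /orP[->//|/IH ->]; rewrite orbT.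
by move=> h; rewrite IH ?orbT // inE h orbT.
Qed.

Lemma sg1_sub w d : d \in (sg w).1 -> d \in [seq c.2 | c <- w].
Proof. by move=> h; apply: sg_sub; rewrite mem_cat h. Qed.

Lemma sg2_sub w d : d \in (sg w).2 -> d \in [seq c.2 | c <- w].
Proof. by move=> h; apply: sg_sub; rewrite mem_cat h orbT. Qed.

Lemma sg_relabel (g : nat -> nat) w :
  sg [seq (c.1, g c.2) | c <- w] = (map g (sg w).1, map g (sg w).2).
Proof.
elim: w => [|c w IH] //=; rewrite IH /sg_step /=.
case: eqP => _ //=; case: eqP => _ //=.
by case: (sg w).1.
Qed.

Lemma sg_count w : size (sg w).1 + count_mem a.+1 [seq c.1 | c <- w] =
  size (sg w).2 + count_mem a [seq c.1 | c <- w].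
Proof.
elim: w => [|c w] //=; move: (count_mem _ _) (count_mem _ _) => x y IH.
rewrite /sg_step; case: eqP => [->|ne] /=.
  by rewrite (_ : (a == a.+1) = false); lia.
by case: eqP => _; case: (sg w) IH => [[|z A] C] /=; lia.
Qed.

Definition upd (d v : nat) (w : lword) : lword :=
  [seq if c.2 == d then (v, d) else c | c <- w].

Lemma upd_id d v w : d \notin [seq c.2 | c <- w] -> upd d v w = w.
Proof.
move=> dw; rewrite /upd -[RHS]map_id; apply/eq_in_map => c cw.
by case: eqP => // e; case/mapP: dw; exists c.
Qed.

Lemma upd_labels d v w : [seq c.2 | c <- upd d v w] = [seq c.2 | c <- w].
Proof. by rewrite -map_comp; apply: eq_map => c /=; case: eqP. Qed.

(** No unmatched letter [a] follows the changed one, so all matched pairs stay as they are and the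
    changed letter finds no partner. *)
Lemma sg_f w A d C : uniq [seq c.2 | c <- w] -> sg w = (rcons A d, C) ->
  sg (upd d a.+1 w) = (A, d :: C).
Proof.
elim: w A => [|c w IH] A /=; first by case: A.
move=> /andP[cw uw]; rewrite -/(upd d a.+1 w) {1}/sg_step.
case E : (sg w) => [A' C'] /=.
have inw B : A' = rcons B d -> (c.2 == d) = false.
  move=> e; apply/negP => /eqP cd; case/negP: cw; rewrite cd.
  by apply: sg1_sub; rewrite E e mem_rcons inE eqxx.
case: eqP => [ca|ca].
  case: (lastP A') E inw => [|B d'] E inw [].
    case: A => [|y [|? ?]] //= [<-] <-.
    by rewrite eqxx upd_id // E /sg_step /= (_ : (a.+1 == a) = false) ?eqxx //; lia.
  rewrite -rcons_cons => /rcons_inj[<- ed] eC; subst d' C'; rewrite (inw B) //.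
  by rewrite (IH B) // /sg_step ca eqxx.
case: eqP => [ca1|ca1].
  case: A' E inw => [|y A'] E inw []; first by case: A.
  move=> e eC; subst C'; rewrite e in E inw; rewrite (inw (y :: A)) // (IH (y :: A)) ?E //.
  by rewrite /sg_step (introF eqP ca) ca1 eqxx.
move=> [e eC]; subst C'; rewrite e in E inw; rewrite (inw A) // (IH A) ?E //.
by rewrite /sg_step (introF eqP ca) (introF eqP ca1).
Qed.

Lemma sg_e w A d C : uniq [seq c.2 | c <- w] -> sg w = (A, d :: C) ->
  sg (upd d a w) = (rcons A d, C).
Proof.
elim: w A => [|c w IH] A //=.
move=> /andP[cw uw]; rewrite -/(upd d a w) {1}/sg_step.
case E : (sg w) => [A' C'] /=.
have inw B : C' = d :: B -> (c.2 == d) = false.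
  move=> e; apply/negP => /eqP cd; case/negP: cw; rewrite cd.
  by apply: sg2_sub; rewrite E e inE eqxx.
case: eqP => [ca|ca].
  move=> [eA eC]; rewrite (inw C) // (IH A') ?E ?eC //.
  by rewrite /sg_step ca eqxx -eA.
case: eqP => [ca1|ca1].
  case: A' E inw => [|y A'] E inw [].
    move=> <- e1 e2; rewrite e1 eqxx upd_id -?e1 // E /sg_step /= eqxx e2 //.
  move=> <- eC; rewrite (inw C) // (IH (y :: A')) ?E ?eC //.
  by rewrite /sg_step (introF eqP ca) ca1 eqxx.
move=> [eA eC]; rewrite (inw C) // (IH A') ?E ?eC //.
by rewrite /sg_step (introF eqP ca) (introF eqP ca1) eA.
Qed.

(* The labels of the letters changed by f_a and by e_a. *)
Definition fd w := ohead (rev (sg w).1).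
Definition ed w := ohead (sg w).2.

Lemma fd_Some w d : fd w = Some d -> exists A, sg w = (rcons A d, (sg w).2).
Proof.
rewrite /fd; case: (sg w) => A C /=; case: (lastP A) => // B y.
by rewrite rev_rcons /= => -[<-]; exists B.
Qed.

Lemma ed_Some w d : ed w = Some d -> exists C, sg w = ((sg w).1, d :: C).
Proof. by rewrite /ed; case: (sg w) => A [|y C] //= [<-]; exists C. Qed.

Lemma isSome_fd w : isSome (fd w) = (0 < size (sg w).1).
Proof. by rewrite /fd -(size_rev (sg w).1); case: rev. Qed.

Lemma isSome_ed w : isSome (ed w) = (0 < size (sg w).2).
Proof. by rewrite /ed; case: (sg w).2. Qed.

End Signature.

(** * Labelled and positional forms of the signature rule *)

Definition positioned (w js : seq nat) : lword := [seq (nth 0 w j, j) | j <- js].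

(** The single stack of [cancel_pair] always has the form $a^p(a+1)^q$, so it splits into the two
    components of [sg]. The letters are part of the induction because cancelling inspects the top of
    the stack. *)
Lemma unmatchedE a w : 
  let s := sg a (positioned w (iota 0 (size w))) in
  [/\ unmatched a w = s.1 ++ s.2, all (fun j => nth 0 w j == a) s.1,
      all (fun j => nth 0 w j == a.+1) s.2 & all (fun j => j < size w) (s.1 ++ s.2)].
Proof.
rewrite /unmatched; have : all (fun j => j < size w) (iota 0 (size w)).
  by apply/allP => j; rewrite mem_iota.
move: (iota 0 (size w)) => js alljs; suff [-> h1 h2] : 
  let s := sg a (positioned w js) in
  [/\ foldr (cancel_pair a w) [::] [seq j <- js | nth 0 w j \in [:: a; a.+1]] = s.1 ++ s.2,
   all (fun j => nth 0 w j == a) s.1 & all (fun j => nth 0 w j == a.+1) s.2].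
  split=> //; apply/allP => j /sg_sub; rewrite -map_comp map_id.
  by move: j; exact/allP.
elim: js {alljs} => [|j js] //=; case: (sg a (positioned w js)) => A C /= [IH hA hC].
rewrite !inE; rewrite /sg_step /=; case: eqP => [ja|ja] /=.
  rewrite IH hA hC ja eqxx; split=> //.
  rewrite /cancel_pair; case: (A ++ C) => // k s.
  by rewrite ja (_ : (a == a.+1) = false) //; lia.
case: eqP => [ja1|ja1] /=; last by rewrite IH hA hC.
rewrite IH /cancel_pair ja1 eqxx /=.
case: A hA {IH} => [|k A] /=; last by move=> /andP[-> ->].
move=> _; rewrite ?ja1 ?eqxx hC; split=> //; case: C hC => //= k C /andP[/eqP -> _].
by rewrite (_ : (a.+1 == a) = false) //; lia.
Qed.

Lemma set_nth_id (w : seq nat) j : j < size w -> set_nth 0 w j (nth 0 w j) = w.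
Proof.
move=> jw; apply: (@eq_from_nth _ 0); first by rewrite size_set_nth; lia.
by move=> i _; rewrite nth_set_nth /=; case: eqP => [->|].
Qed.

Lemma write_id w us vs : size us = size vs ->
  (forall k, k < size us -> nth 0 us k < size w /\ nth 0 w (nth 0 us k) = nth 0 vs k) ->
  write w us vs = w.
Proof.
elim: us vs => [|u us IH] [|v vs] //= [sz] h.
rewrite /write /= -/(write w us vs) IH //; last by move=> k ks; apply: (h k.+1).
by have [/= h1 <-] := h 0 isT; rewrite set_nth_id.
Qed.

Lemma write_cat w us us' vs vs' : size us = size vs ->
  write w (us ++ us') (vs ++ vs') = write (write w us' vs') us vs.
Proof. by move=> sz; rewrite /write zip_cat // foldr_cat. Qed.

(** The operators rewrite the whole unmatched subword, but every other letter of it already has the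
    value written. [foldr] writes from the right, so [A] is written after [d] and must not contain
    it. *)
Lemma sorted_write a v w A d C : all (fun j => nth 0 w j == a) A ->
  all (fun j => nth 0 w j == a.+1) C -> all (fun j => j < size w) (A ++ d :: C) ->
  d \notin A ->
  write w (A ++ d :: C) (nseq (size A) a ++ v :: nseq (size C) a.+1) = set_nth 0 w d v.
Proof.
move=> hA hC; rewrite all_cat /= => /and3P[sA dw sC] dA.
rewrite write_cat ?size_nseq // [write w (d :: C) _]/write /= -/(write w C _).
rewrite (@write_id w C) ?size_nseq //; last first.
  move=> k kC; have kin := mem_nth 0 kC; split; first exact: (allP sC).
  by rewrite nth_nseq kC; apply/eqP; exact: (allP hC).
apply: write_id; rewrite ?size_nseq // => k kA; have kin := mem_nth 0 kA.
have ne : nth 0 A k != d by apply: contraNneq dA => <-.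
rewrite size_set_nth nth_set_nth /= (negPf ne) nth_nseq kA.
split; last by apply/eqP; exact: (allP hA).
by have /= := allP sA _ kin; lia.
Qed.

Lemma positioned_uniq w : uniq [seq c.2 | c <- positioned w (iota 0 (size w))].
Proof. by rewrite -map_comp map_id iota_uniq. Qed.

Lemma uniq_sg a w : uniq [seq c.2 | c <- w] -> uniq ((sg a w).1 ++ (sg a w).2).
Proof.
elim: w => [|c w IH] //= /andP[cw /IH]; have := @sg_sub a w; rewrite {IH} /sg_step.
case: (sg a w) => A C /= sub uAC; have cAC : c.2 \notin A ++ C by apply: contra cw; exact: sub.
case: eqP => _ /=; first by rewrite cAC.
case: eqP => _ //=; case: A sub uAC cAC => [|y A] _ /=; first by move=> -> ->.
by case/andP.
Qed.

Section LabelledOps.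
Variables (a : nat) (lw : lword).
Hypothesis ulw : uniq [seq c.2 | c <- lw].

Let w := [seq c.1 | c <- lw].
Let g j := nth 0 [seq c.2 | c <- lw] j.

(** Any distinctly labelled word is a relabelling of the word labelled by its own positions; this
    carries [unmatchedE] over to arbitrary labels. *)
Let lwE : lw = [seq (c.1, g c.2) | c <- positioned w (iota 0 (size w))].
Proof.
apply: (@eq_from_nth _ (0, 0)); first by rewrite !size_map size_iota.
move=> i iw; rewrite -map_comp (nth_map 0) ?size_iota ?size_map // nth_iota ?size_map //=.
by rewrite add0n /g /w !(nth_map (0, 0)) //; case: nth.
Qed.

Let sgE := sg_relabel a g (positioned w (iota 0 (size w))).

Lemma set_nth_upd d v : d < size w -> set_nth 0 w d v = [seq c.1 | c <- upd (g d) v lw].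
Proof.
move=> dw; have dlw : d < size lw by rewrite size_map in dw.
apply: (@eq_from_nth _ 0).
  by rewrite size_set_nth (maxn_idPr dw) !size_map.
move=> i; rewrite size_set_nth nth_set_nth /= => iw.
have ilw : i < size lw by rewrite /w size_map in iw; lia.
rewrite -map_comp [RHS](nth_map (0, 0)) //=.
have -> : (nth (0, 0) lw i).2 = g i by rewrite /g (nth_map (0, 0)).
rewrite /g nth_uniq ?size_map //; case: eqP => //= _.
by rewrite /w (nth_map (0, 0)).
Qed.

Lemma word_f_labelled :
  word_f a w = omap (fun d => [seq c.1 | c <- upd d a.+1 lw]) (fd a lw).
Proof.
have [uE hA hC hs] := unmatchedE a w; have us := uniq_sg a (positioned_uniq w).
move: uE hA hC hs us sgE; rewrite -lwE; case: (sg a (positioned _ _)) => A C /= uE hA hC hs us sE.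
have cp : count (fun j => nth 0 w j == a) (unmatched a w) = size A.
  rewrite uE count_cat (eqP (etrans (esym (all_count _ _)) hA)) (_ : count _ C = 0) ?addn0 //.
  apply/eqP; rewrite -leqn0 leqNgt -has_count; apply/hasPn => j /(allP hC) /eqP ->; lia.
have cq : count (fun j => nth 0 w j == a.+1) (unmatched a w) = size C.
  rewrite uE count_cat (eqP (etrans (esym (all_count _ C)) hC)) (_ : count _ A = 0) //.
  apply/eqP; rewrite -leqn0 leqNgt -has_count; apply/hasPn => j /(allP hA) /eqP ->; lia.
rewrite /word_f cp cq uE /fd sE /=; case: (lastP A) hA hs us => [|B d] hA hs us //=.
rewrite size_rcons /= map_rcons rev_rcons /=; congr Some.
move: hA hs us; rewrite cat_rcons all_rcons => /andP[_ hB] hs us.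
rewrite sorted_write //; last first.
  by move: us; rewrite cat_uniq /= negb_or => /and3P[_ /andP[]].
by apply: set_nth_upd; move: hs; rewrite all_cat /= => /and3P[].
Qed.

Lemma word_e_labelled :
  word_e a w = omap (fun d => [seq c.1 | c <- upd d a lw]) (ed a lw).
Proof.
have [uE hA hC hs] := unmatchedE a w; have us := uniq_sg a (positioned_uniq w).
move: uE hA hC hs us sgE; rewrite -lwE; case: (sg a (positioned _ _)) => A C /= uE hA hC hs us sE.
have cp : count (fun j => nth 0 w j == a) (unmatched a w) = size A.
  rewrite uE count_cat (eqP (etrans (esym (all_count _ _)) hA)) (_ : count _ C = 0) ?addn0 //.
  apply/eqP; rewrite -leqn0 leqNgt -has_count; apply/hasPn => j /(allP hC) /eqP ->; lia.
have cq : count (fun j => nth 0 w j == a.+1) (unmatched a w) = size C.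
  rewrite uE count_cat (eqP (etrans (esym (all_count _ C)) hC)) (_ : count _ A = 0) //.
  apply/eqP; rewrite -leqn0 leqNgt -has_count; apply/hasPn => j /(allP hA) /eqP ->; lia.
rewrite /word_e cp cq uE /ed sE /=; case: C hC hs us {cq uE sE} => [|d C] hC hs us //=.
congr Some; have -> : a :: nseq (size A) a ++ nseq (size C) a.+1 = nseq (size A) a ++ a :: nseq (size C) a.+1.
  by elim: (size A) => //= k ->.
rewrite sorted_write //; first by apply: set_nth_upd; move: hs; rewrite all_cat /= => /and3P[].
  by case/andP: hC.
by move: us; rewrite cat_uniq /= negb_or => /and3P[_ /andP[]].
Qed.

End LabelledOps.

(** * Crystal operators on labelled tableaux and paths *)

Definition ltableau := seq lword.
Definition lpath := seq ltableau.

Definition tword (T : ltableau) : lword := flatten (rev T).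
Definition lletters (b : lpath) : lword := flatten (map tword b).
Definition unl (T : ltableau) : tableau := map (map fst) T.
Definition tupd d v (T : ltableau) : ltableau := map (upd d v) T.
Definition pupd d v (b : lpath) : lpath := map (tupd d v) b.
Definition labels (w : lword) := [seq c.2 | c <- w].

Lemma labels_cat u v : labels (u ++ v) = labels u ++ labels v.
Proof. exact: map_cat. Qed.

Lemma word_unl T : word (unl T) = map fst (tword T).
Proof. by rewrite /word /unl -map_rev map_flatten. Qed.

Lemma letters_unl b : letters (map unl b) = map fst (lletters b).
Proof.
rewrite /letters /lletters map_flatten -!map_comp; congr flatten.
by apply: eq_map => T /=; rewrite word_unl.
Qed.

Lemma tword_upd d v T : tword (tupd d v T) = upd d v (tword T).
Proof. by rewrite /tword /tupd /upd -map_rev map_flatten. Qed.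

Lemma lletters_upd d v b : lletters (pupd d v b) = upd d v (lletters b).
Proof.
rewrite /lletters /pupd /upd map_flatten -!map_comp; congr flatten.
by apply: eq_map => T /=; rewrite tword_upd.
Qed.

Lemma tupd_id d v T : d \notin labels (tword T) -> tupd d v T = T.
Proof.
move=> dT; rewrite /tupd -[RHS]map_id; apply/eq_in_map => R RT; apply: upd_id.
apply: contra dT => /mapP[c cR ->]; apply/mapP; exists c => //.
by apply/flattenP; exists R => //; rewrite mem_rev.
Qed.

Lemma pupd_id d v b : d \notin labels (lletters b) -> pupd d v b = b.
Proof.
move=> db; rewrite /pupd -[RHS]map_id; apply/eq_in_map => T Tb; apply: tupd_id.
apply: contra db => /mapP[c cT ->]; apply/mapP; exists c => //.
by apply/flattenP; exists (tword T) => //; apply/mapP; exists T.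
Qed.

Lemma unword_unl d v T :
  unword (unl T) [seq c.1 | c <- upd d v (tword T)] = unl (tupd d v T).
Proof.
rewrite -tword_upd -word_unl /unword /word.
have -> : shape (rev (unl T)) = shape (rev (unl (tupd d v T))).
  rewrite !(map_rev, shape_rev) /shape; congr rev.
  by rewrite -!map_comp; apply: eq_map => R /=; rewrite !size_map.
by rewrite flattenK revK.
Qed.

Lemma tab_f_labelled a T : uniq (labels (tword T)) ->
  tab_f a (unl T) = omap (fun d => unl (tupd d a.+1 T)) (fd a (tword T)).
Proof.
move=> uT; rewrite /tab_f word_unl word_f_labelled //.
by case: fd => //= d; rewrite unword_unl.
Qed.

Lemma tab_e_labelled a T : uniq (labels (tword T)) ->
  tab_e a (unl T) = omap (fun d => unl (tupd d a T)) (ed a (tword T)).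
Proof.
move=> uT; rewrite /tab_e word_unl word_e_labelled //.
by case: ed => //= d; rewrite unword_unl.
Qed.

Lemma rows_labelling (ss : seq (seq nat)) N :
  exists ls : seq lword, map (map fst) ls = ss /\ labels (flatten ls) = iota N (size (flatten ss)).
Proof.
elim: ss N => [|s ss IH] N; first by exists [::].
have [ls [e1 e2]] := IH (N + size s).
exists (zip s (iota N (size s)) :: ls) => /=; rewrite e1 -[map fst _]/(unzip1 _) unzip1_zip ?size_iota //.
split=> //; rewrite labels_cat e2 -[labels (zip _ _)]/(unzip2 _) unzip2_zip ?size_iota //.
by rewrite size_cat iotaD.
Qed.

Lemma labelling (b : cpath) : exists B : lpath, map unl B = b /\ uniq (labels (lletters B)).
Proof.
suff h N : exists B, map unl B = b /\ labels (lletters B) = iota N (size (letters b)).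
  by have [B [e1 e2]] := h 0; exists B; rewrite e2 iota_uniq.
elim: b N => [|T b IH] N; first by exists [::].
have [ls [e1 e2]] := rows_labelling (rev T) N.
have [B [e3 e4]] := IH (N + size (word T)).
exists (rev ls :: B) => /=; split; first by rewrite e3 /unl map_rev e1 revK.
rewrite /lletters /= /tword revK -/(lletters B) labels_cat e2 e4.
by rewrite /letters /= size_cat iotaD.
Qed.

Lemma tlabelling (T : tableau) : exists LT, unl LT = T /\ uniq (labels (tword LT)).
Proof.
have [[|LT [|? ?]] [e u]] := labelling [:: T] => //; exists LT.
by case: e => <-; move: u; rewrite /lletters /= cats0.
Qed.

(** [mu] counts the applications that remain. [Inv] confines the argument to inputs where the
    operator is understood: for [tensor_f k], paths of at most [k] factors. *)
Lemma max_iterE (X : Type) (op : X -> option X) (mu : X -> nat) (Inv : X -> Prop) N x :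
  (forall x, Inv x -> isSome (op x) = (0 < mu x)) ->
  (forall x y, Inv x -> op x = Some y -> mu y = (mu x).-1 /\ Inv y) ->
  Inv x -> mu x <= N -> max_iter op N x = mu x.
Proof.
move=> h1 h2 ix le.
have it k : isSome (iter k (obind op) (Some x)) = (k <= mu x) /\
    (forall y, iter k (obind op) (Some x) = Some y -> mu y = mu x - k /\ Inv y).
  elim: k => [|k [IH1 IH2]] /=; first by split=> // y [<-]; rewrite subn0.
  case E : (iter k _ _) IH1 IH2 => [y|] /= IH1 IH2; last by split=> //; lia.
  have [my iy] := IH2 y erefl; rewrite h1 // my; split; first lia.
  by move=> z /(h2 _ _ iy)[-> iz]; split=> //; lia.
apply/eqP; rewrite eqn_leq; apply/andP; split.
  by apply/bigmax_leqP => k; rewrite (it k).1.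
have lt : mu x < N.+1 by lia.
by apply: (leq_bigmax_cond (Ordinal lt)); rewrite (it _).1.
Qed.

(* All labels are 0, as only the numbers of unmatched letters matter. *)
Definition nolab (w : seq nat) : lword := [seq (x, 0) | x <- w].
Definition wphi a (w : seq nat) := size (sg a (nolab w)).1.
Definition weps a (w : seq nat) := size (sg a (nolab w)).2.

Lemma sg_nolab a (w : lword) : sg a (nolab (map fst w)) =
  (map (fun=> 0) (sg a w).1, map (fun=> 0) (sg a w).2).
Proof. by rewrite -(sg_relabel a (fun=> 0)); congr sg; rewrite /nolab -map_comp. Qed.

Lemma wphiE a w : wphi a (map fst w) = size (sg a w).1.
Proof. by rewrite /wphi sg_nolab size_map. Qed.

Lemma wepsE a w : weps a (map fst w) = size (sg a w).2.
Proof. by rewrite /weps sg_nolab size_map. Qed.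

Lemma wphi_size a w : wphi a w <= size w.
Proof.
rewrite /wphi; elim: w => //= x w IH; rewrite /sg_step /=.
by case: eqP => _ /=; [|case: eqP => _ /=; [case: (sg a (nolab w)) IH => [[|? ?] ?] /=|]]; lia.
Qed.

Lemma weps_size a w : weps a w <= size w.
Proof.
rewrite /weps; elim: w => //= x w IH; rewrite /sg_step /=.
by case: eqP => _ /=; [|case: eqP => _ /=; [case: (sg a (nolab w)) IH => [[|? ?] ?] /=|]]; lia.
Qed.

Lemma tab_epsE a T : tab_eps a T = weps a (word T).
Proof.
apply: (@max_iterE _ _ (fun T => weps a (word T)) (fun=> True)) => //; last exact: weps_size.
- move=> U _; have [LT [<- uT]] := tlabelling U.
  rewrite tab_e_labelled // word_unl wepsE -isSome_ed.
  by case: ed.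
- move=> U V _; have [LT [<- uT]] := tlabelling U.
  rewrite tab_e_labelled //.
  case E : (ed a (tword LT)) => [d|] //= [<-]; have [C sE] := ed_Some E.
  by rewrite !word_unl !wepsE tword_upd (sg_e uT sE) sE.
Qed.

Lemma fd_cat a u v : fd a (u ++ v) =
  if size (sg a u).2 < size (sg a v).1 then fd a v else fd a u.
Proof.
rewrite /fd sg_cat /sg_mul /=; case: ltnP => h; last by rewrite drop_oversize ?cats0.
rewrite rev_cat; have: 0 < size (drop (size (sg a u).2) (sg a v).1) by rewrite size_drop; lia.
rewrite -{3}(cat_take_drop (size (sg a u).2) (sg a v).1) rev_cat.
by case: (lastP (drop _ _)) => // s x; rewrite rev_rcons.
Qed.

Lemma ed_cat a u v : ed a (u ++ v) =
  if size (sg a v).1 < size (sg a u).2 then ed a u else ed a v.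
Proof.
rewrite /ed sg_cat /sg_mul /=; case: ltnP => h.
  by case: (sg a u).2 h => //= y s h; rewrite subSn.
by have -> : size (sg a u).2 - size (sg a v).1 = 0 by [lia]; rewrite take0.
Qed.

Lemma fd_in a w d : fd a w = Some d -> d \in labels w.
Proof. by move=> /fd_Some[A e]; apply: (@sg1_sub a); rewrite e mem_rcons inE eqxx. Qed.

Lemma ed_in a w d : ed a w = Some d -> d \in labels w.
Proof. by move=> /ed_Some[C e]; apply: (@sg2_sub a); rewrite e inE eqxx. Qed.

Lemma uniq_cat_notin u v d : uniq (labels (u ++ v)) ->
  (d \in labels u -> d \notin labels v) /\ (d \in labels v -> d \notin labels u).
Proof.
rewrite labels_cat cat_uniq => /and3P[_ /hasPn h _]; split=> hd; last exact: h.
by apply/negP => /h; rewrite hd.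
Qed.

(** The tensor product rule is the bracketing rule on the concatenated word: by [fd_cat] both
    compare the unmatched [a.+1] of the first factor with the unmatched [a] of the rest. *)
Lemma tensor_f_labelled a k (B : lpath) : size B <= k -> uniq (labels (lletters B)) ->
  tensor_f k a (map unl B) = omap (fun d => map unl (pupd d a.+1 B)) (fd a (lletters B)).
Proof.
elim: k B => [|k IH] [|T B] //= sB uB.
have uTB := uB; move: (uTB); rewrite /lletters /= -/(lletters B) labels_cat cat_uniq => /and3P[uT _ uB'].
(* Iterates of [tensor_f k] carry no labels, so each is labelled afresh before the induction
   hypothesis is applied. *)
have Inv_op b : size b <= k -> exists B', [/\ map unl B' = b, uniq (labels (lletters B')) &
    tensor_f k a b = omap (fun d => map unl (pupd d a.+1 B')) (fd a (lletters B'))].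
  move=> sb; have [B' [e u]] := labelling b; exists B'; split=> //.
  by rewrite -e IH // -(size_map unl) e.
have -> : max_iter (tensor_f k a) (size (letters (map unl B))) (map unl B) = size (sg a (lletters B)).1.
  rewrite -wphiE -letters_unl.
  apply: (@max_iterE _ _ (fun b => wphi a (letters b)) (fun b => size b <= k)).
  - move=> b /Inv_op[B' [<- u ->]]; rewrite letters_unl wphiE -isSome_fd.
    by case: fd.
  - move=> b c sb; have [B' [e u ->]] := Inv_op b sb; subst b; case E : (fd a (lletters B')) => [d|] //= [<-].
    have [A sE] := fd_Some E; rewrite !letters_unl !wphiE lletters_upd (sg_f u sE) sE /= size_rcons.
    by split=> //; move: sb; rewrite !size_map.
  - by rewrite size_map.
  - exact: wphi_size.
rewrite tab_epsE word_unl wepsE tab_f_labelled // IH // fd_cat leqNgt.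
case: ltnP => h /=.
  case E : (fd a (lletters B)) => [d|] //=.
  by rewrite tupd_id //; apply: (uniq_cat_notin d uTB).2; exact: fd_in E.
case E : (fd a (tword T)) => [d|] //=.
by rewrite pupd_id //; apply: (uniq_cat_notin d uTB).1; exact: fd_in E.
Qed.

(* phi_a and epsilon_a of a path. *)
Definition ph a (b : cpath) := wphi a (letters b).
Definition ep a (b : cpath) := weps a (letters b).

Lemma phE a (B : lpath) : ph a (map unl B) = size (sg a (lletters B)).1.
Proof. by rewrite /ph letters_unl wphiE. Qed.

Lemma epE a (B : lpath) : ep a (map unl B) = size (sg a (lletters B)).2.
Proof. by rewrite /ep letters_unl wepsE. Qed.

Lemma path_f_labelled a (B : lpath) : uniq (labels (lletters B)) ->
  path_f a (map unl B) = omap (fun d => map unl (pupd d a.+1 B)) (fd a (lletters B)).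
Proof. by move=> uB; rewrite /path_f tensor_f_labelled ?size_map. Qed.

Lemma isSome_path_f a b : isSome (path_f a b) = (0 < ph a b).
Proof.
have [B [<- uB]] := labelling b; rewrite path_f_labelled // phE -isSome_fd.
by case: fd.
Qed.

Lemma ph_path_f a b c : path_f a b = Some c -> ph a b = (ph a c).+1 /\ ep a c = (ep a b).+1.
Proof.
have [B [<- uB]] := labelling b; rewrite path_f_labelled //.
case E : (fd a (lletters B)) => [d|] //= [<-]; have [A sE] := fd_Some E.
by rewrite !phE !epE lletters_upd (sg_f uB sE) sE /= size_rcons.
Qed.

Lemma path_phiE a b : path_phi a b = ph a b.
Proof.
apply: (@max_iterE _ _ (ph a) (fun=> True)) => //; last exact: wphi_size.
- by move=> c _; exact: isSome_path_f.
- by move=> c d _ /ph_path_f[-> _].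
Qed.

Lemma path_e_labelled a (B : lpath) : uniq (labels (lletters B)) ->
  path_e a (map unl B) = omap (fun d => map unl (pupd d a B)) (ed a (lletters B)).
Proof.
elim: B => [|T B IH] //= uB.
have uTB := uB; move: (uTB); rewrite /lletters /= -/(lletters B) labels_cat cat_uniq => /and3P[uT _ uB'].
rewrite path_phiE phE tab_epsE word_unl wepsE tab_e_labelled // IH // ed_cat.
case: ltnP => h /=.
  case E : (ed a (tword T)) => [d|] //=.
  by rewrite pupd_id //; apply: (uniq_cat_notin d uTB).1; exact: ed_in E.
case E : (ed a (lletters B)) => [d|] //=.
by rewrite tupd_id //; apply: (uniq_cat_notin d uTB).2; exact: ed_in E.
Qed.

Lemma isSome_path_e a b : isSome (path_e a b) = (0 < ep a b).
Proof.
have [B [<- uB]] := labelling b; rewrite path_e_labelled // epE -isSome_ed.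
by case: ed.
Qed.

Lemma upd_twice d v v' w : upd d v' (upd d v w) = upd d v' w.
Proof.
rewrite /upd -map_comp; apply: eq_map => c /=.
by case E : (c.2 == d); rewrite /= ?eqxx ?E.
Qed.

Lemma sg2_letter a w d c : uniq (labels w) -> d \in (sg a w).2 -> c \in w -> c.2 = d -> c.1 = a.+1.
Proof.
elim: w => //= c' w IH /andP[cw uw]; rewrite /sg_step inE.
have lab (x : nat * nat) : x \in w -> x.2 \in labels w by move=> xw; apply/mapP; exists x.
have notin : c'.2 \notin (sg a w).2 by apply: contra cw; exact: sg2_sub.
case: (eqVneq c'.1 a) => [ca|ca] /=.
  move=> dC; case/predU1P => [->|cW] cd; last exact: IH uw dC cW cd.
  by move: dC; rewrite -cd (negPf notin).
case: (eqVneq c'.1 a.+1) => [ca1|ca1] /=.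
  case: (sg a w) IH {notin} => [[|y A] C] /= IH dC; case/predU1P => [->|cW] cd //.
    move: dC; rewrite inE => /orP[/eqP e|dC]; last exact: IH uw dC cW cd.
    by case/negP: cw; rewrite -e -cd; exact: lab.
  exact: IH uw dC cW cd.
move=> dC; case/predU1P => [->|cW] cd; last exact: IH uw dC cW cd.
by move: dC; rewrite -cd (negPf notin).
Qed.

Lemma path_eK a b c : path_e a b = Some c -> path_f a c = Some b.
Proof.
have [B [<- uB]] := labelling b; rewrite path_e_labelled //.
case E : (ed a (lletters B)) => [d|] //= [<-]; have [C sE] := ed_Some E.
have uB' : uniq (labels (lletters (pupd d a B))) by rewrite lletters_upd /labels upd_labels.
rewrite path_f_labelled // lletters_upd /fd (sg_e uB sE) rev_rcons /=.
congr (Some (map unl _)); rewrite /pupd -map_comp -[RHS]map_id; apply/eq_in_map => T TB /=.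
rewrite /tupd -map_comp -[RHS]map_id; apply/eq_in_map => R RT /=; rewrite upd_twice.
rewrite /upd -[RHS]map_id; apply/eq_in_map => x xR; case: eqP => // xd.
have xB : x \in lletters B.
  apply/flattenP; exists (tword T); first by apply/mapP; exists T.
  by apply/flattenP; exists R => //; rewrite mem_rev.
have := @sg2_letter a _ d x uB; rewrite sE /= inE eqxx => /(_ isT xB xd) <-.
by rewrite -xd; case: (x).
Qed.

(** * Splitting maps and preservation of tableaux *)

Lemma letters_box x b : letters ([:: [:: x]] :: b) = x :: letters b.
Proof. by []. Qed.

Lemma ep_box a x b : ep a ([:: [:: x]] :: b) =
  if x == a.+1 then ep a b + (ph a b == 0) else ep a b.
Proof.
rewrite /ep /ph letters_box /weps /wphi /= /sg_step /=.
case: (eqVneq x a) => [->|xa] /=; first by rewrite (_ : (a == a.+1) = false) //; lia.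
by case: eqP => // _; case: (sg a _) => [[|y A] C] /=; lia.
Qed.

(** The box is read before all other letters: a box [a] is the last unmatched one only if the tail
    has none, and a box [a.+1] uses up one unmatched [a] of the tail. *)
Lemma path_f_box a x b : path_f a ([:: [:: x]] :: b) =
  if (x == a) && (ph a b == 0) then Some ([:: [:: a.+1]] :: b)
  else if (x == a.+1) && (ph a b <= 1) then None
  else omap (cons [:: [:: x]]) (path_f a b).
Proof.
have [[|T B] [e uB]] := labelling ([:: [:: x]] :: b) => //; case: e => eT <-.
have [d0 eT'] : exists d0, T = [:: [:: (x, d0)]].
  by case: (T) eT => [|[|[y d0] [|? ?]] [|? ?]] //= [->]; exists d0.
subst T.
have uB1 := uB; move: (uB1); rewrite /lletters /= -/(lletters B) => /andP[d0B uB'].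
rewrite -[[:: [:: x]] :: _]/(map unl ([:: [:: (x, d0)]] :: B)) !path_f_labelled // phE.
rewrite /lletters /= -/(lletters B) {1}/fd /= /sg_step /=.
case: (eqVneq x a) => [->|xa] /=.
  rewrite (_ : (a == a.+1) = false) /=; last by lia.
  have [h|h] := posnP (size (sg a (lletters B)).1).
    by rewrite (size0nil h) /= eqxx pupd_id.
  rewrite rev_cons /fd; case E : (rev _) => [|d A] /=.
    by move: h; rewrite -size_rev E.
  by case: eqP => // e; case/negP: d0B; rewrite e; apply: (@sg1_sub a); rewrite -mem_rev E inE eqxx.
have fdE d : fd a (lletters B) = Some d -> (d0 == d) = false.
  by move=> /fd_in dB; apply/eqP => e; case/negP: d0B; rewrite e.
case: (eqVneq x a.+1) => [xa1|xa1] /=.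
  have := fdE; rewrite /fd; case: (sg a (lletters B)).1 => [|y [|z A]] //=.
  rewrite !rev_cons -!cats1; case: (rev A) => [|d s] /= h; first by rewrite h.
  by rewrite h.
by rewrite -/(fd a (lletters B)); case E : (fd _ _) => [d|] //=; rewrite fdE.
Qed.

Definition llb (b : lpath) : lpath :=
  if b is T :: b' then [:: [:: last [::] T], take (size T).-1 T & b'] else b.

Definition lls (b : lpath) : lpath :=
  if b is T :: b' then [:: map (take 1) T, map behead T & b'] else b.

Lemma lb_unl b : lb (map unl b) = map unl (llb b).
Proof.
case: b => [|T b] //=; rewrite /unl size_map map_take.
by congr [:: [:: _], _ & _]; case: T => // R T; rewrite -(last_map (map fst)).
Qed.

Lemma ls_unl b : ls (map unl b) = map unl (lls b).
Proof.
case: b => [|T b] //=; rewrite /unl -!map_comp; congr [:: _, _ & _].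
  by apply: eq_map => R /=; rewrite map_take.
by apply: eq_map => R /=; rewrite behead_map.
Qed.

Lemma llb_upd d v b : pupd d v (llb b) = llb (pupd d v b).
Proof.
case: b => [|T b] //=; rewrite /tupd size_map map_take.
by congr [:: [:: _], _ & _]; case: T => // R T; rewrite -(last_map (upd d v)).
Qed.

Lemma lls_upd d v b : pupd d v (lls b) = lls (pupd d v b).
Proof.
case: b => [|T b] //=; rewrite /tupd -!map_comp; congr [:: _, _ & _].
  by apply: eq_map => R /=; rewrite /upd map_take.
by apply: eq_map => R /=; rewrite /upd behead_map.
Qed.

(** Rows are read from the bottom, so the box split off by [lb] is already the first letter of the
    word. *)
Lemma lletters_llb T b : T != [::] -> lletters (llb (T :: b)) = lletters (T :: b).
Proof.
case/lastP: T => // T R _ /=; rewrite last_rcons size_rcons /= -cats1 take_size_cat //.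
by rewrite /lletters /= /tword rev_cat /= !cats0 catA.
Qed.

Lemma lb_invariant a T b : T != [::] ->
  [/\ ph a (lb (T :: b)) = ph a (T :: b), ep a (lb (T :: b)) = ep a (T :: b)
    & path_f a (lb (T :: b)) = omap lb (path_f a (T :: b))].
Proof.
move=> T0; have [[|LT B] [e uB]] := labelling (T :: b) => //; rewrite -e lb_unl.
have LT0 : LT != [::] by case: (LT) e => // -[e _]; rewrite -e in T0.
have := lletters_llb B LT0; move: uB; move: {e} (LT :: B) => LB uB E.
rewrite !phE !epE E; split=> //; rewrite !path_f_labelled ?E //.
by case: fd => //= d; rewrite llb_upd -lb_unl.
Qed.

Lemma sg_irrel a w v : all (fun c => (c.1 != a) && (c.1 != a.+1)) w -> sg a (w ++ v) = sg a v.
Proof.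
by elim: w => //= c w IH /andP[/andP[/negPf h1 /negPf h2] /IH ->]; rewrite /sg_step h1 h2.
Qed.

Lemma no_letter v (w : lword) : all (fun c => c.1 != v) w -> [seq c.2 | c <- w & c.1 == v] = [::].
Proof. by elim: w => //= c w IH /andP[/negPf -> /IH]. Qed.

Lemma sg_row a R : sorted leq (map fst R) ->
  sg a R = ([seq c.2 | c <- R & c.1 == a], [seq c.2 | c <- R & c.1 == a.+1]).
Proof.
elim: R => //= c R IH so; rewrite IH ?(path_sorted so) // /sg_step.
case: eqP => [ca|_] /=; first by rewrite (_ : (c.1 == a.+1) = false) //; lia.
case: eqP => [ca|_] //=; rewrite (_ : [seq c <- R | _] = [::]) //.
apply/eqP; rewrite -(negbK (_ == _)) -has_filter; apply/hasPn => x xR.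
have /allP /(_ x.1) := order_path_min leq_trans so.
by rewrite map_f // ca => /(_ isT); rewrite /=; lia.
Qed.

Definition rowlt (R R' : lword) := all2 ltn (map fst R) (map fst R').
Definition rows_ok (T : ltableau) :=
  [&& all (fun R => R != [::]) T, all (fun R => sorted leq (map fst R)) T & sorted rowlt T].

Lemma row_ge (x : nat * nat) (R : lword) : sorted leq (map fst (x :: R)) -> all (fun c => x.1 <= c.1) (x :: R).
Proof.
move=> so; rewrite /= leqnn /=; apply/allP => c cR.
by have /allP /(_ c.1) := order_path_min leq_trans so; rewrite map_f // => /(_ isT).
Qed.

Lemma rows_ok_cons R T : rows_ok (R :: T) = [&& R != [::], sorted leq (map fst R),
  (if T is R' :: _ then rowlt R R' else true) & rows_ok T].
Proof.
rewrite /rows_ok /=; case: T => [|R' T] /=; first by rewrite !andbT.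
by do ![case: (_ != _) => //=]; do ![case: (sorted _ _) => //=]; rewrite ?andbF //;
  case: (rowlt R R'); rewrite ?andbF.
Qed.

Lemma tword_cons R T : tword (R :: T) = tword T ++ R.
Proof. by rewrite /tword rev_cons flatten_rcons. Qed.

Lemma below_gt x R T : rows_ok ((x :: R) :: T) -> all (fun c => x.1 < c.1) (tword T).
Proof.
elim: T x R => [|R' T IH] x R //; rewrite rows_ok_cons => /and4P[_ _ xy ok].
move: (ok); rewrite rows_ok_cons => /and4P[]; case: R' xy ok => // y R' /andP[/= xy _] ok _ so _ _.
rewrite tword_cons all_cat; apply/andP; split.
  by apply: sub_all (IH y R' ok) => c /=; lia.
by apply: sub_all (row_ge so) => c /=; lia.
Qed.

Lemma tword_sub (f : lword -> lword) T c : (forall R, {subset f R <= R}) ->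
  c \in tword (map f T) -> c \in tword T.
Proof.
move=> h /flattenP[R]; rewrite mem_rev => /mapP[R' R'T ->] /h cR'.
by apply/flattenP; exists R' => //; rewrite mem_rev.
Qed.

Lemma take1_sub (R : lword) : {subset take 1 R <= R}.
Proof. by move=> c; exact: mem_take. Qed.

Lemma behead_sub (R : lword) : {subset behead R <= R}.
Proof. by move=> c; exact: mem_behead. Qed.

Lemma count_rowlt a (u v : seq nat) : all2 ltn u v -> all (leq a) u ->
  count_mem a.+1 v <= count_mem a u.
Proof.
elim: u v => [|x u IH] [|y v] //= /andP[xy /IH h] /andP[ax /h].
by move: (count_mem _ _) (count_mem _ _) xy => p q; rewrite /ltn /=; case: eqP; case: eqP; lia.
Qed.

Lemma size_letter a (R : lword) : size [seq c.2 | c <- R & c.1 == a] = count_mem a (map fst R).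
Proof. by rewrite size_map size_filter count_map. Qed.

(** Row by row, the entry [h] of the first column moves left past the remainder [W] of the rows
    below. All letters of [W] exceed [h], so the only delicate case is [h = a] above [a.+1]. There
    column strictness gives the row at least as many [a] as the next row has [a.+1]; in either order
    all these [a.+1] are matched and the same [a] are left over. *)
Lemma sg_split a T : rows_ok T ->
  sg a (tword T) = sg a (tword (map (take 1) T) ++ tword (map behead T)).
Proof.
elim: T => //= R T IH ok; move: (ok); rewrite rows_ok_cons => /and4P[R0 so RR' okT].
case: R R0 so RR' ok => // h t _ so RR' ok; rewrite !tword_cons /=.
set X := tword (map (take 1) T) in IH *; set W := tword (map behead T) in IH *.
have XW : sg a (tword T ++ h :: t) = sg a (X ++ W ++ h :: t).
  by rewrite catA !sg_cat IH // sg_cat.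
have below := below_gt ok.
have Wgt : all (fun c => h.1 < c.1) W.
  apply/allP => c cW; apply: (allP below); exact: (@tword_sub behead T c behead_sub cW).
rewrite XW take0 -catA /=; rewrite -[h :: W ++ t]cat1s.
case: (eqVneq h.1 a) => [ha|ha]; last first.
  case: (eqVneq h.1 a.+1) => [ha1|ha1].
    have irr v : sg a (W ++ v) = sg a v.
      by apply: sg_irrel; apply: sub_all Wgt => c /=; lia.
    by rewrite !(sg_cat _ X) irr (sg_cat _ [:: h]) irr -(sg_cat _ [:: h]).
  have irr v : sg a (h :: v) = sg a v by rewrite /= /sg_step (negPf ha) (negPf ha1).
  by rewrite !(sg_cat _ X) (sg_cat _ W) cat1s !irr -sg_cat.
clear IH XW; case: T RR' okT ok below @X @W Wgt => [|R' T] RR' okT ok below X W Wgt //.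
move: (okT); rewrite rows_ok_cons => /and4P[R'0 so' _ okT'].
case: R' RR' okT ok R'0 so' below @X @W Wgt => // h' t' RR' okT ok _ so' below X W Wgt.
have hh' : a < h'.1 by move: RR'; rewrite /rowlt /= ha => /andP[].
have below' := below_gt okT.
have XE : sg a X = sg a [:: h'].
  rewrite /X /= tword_cons take0; apply: sg_irrel; apply/allP => c cT.
  have /= := allP below' c (@tword_sub (take 1) T c take1_sub cT); clear -hh'; lia.
have WE : sg a W = sg a t'.
  rewrite /W /= tword_cons; apply: sg_irrel; apply/allP => c cT.
  have /= := allP below' c (@tword_sub behead T c behead_sub cT); clear -hh'; lia.
have so1 : sorted leq (map fst t) by exact: path_sorted so.
have so2 : sorted leq (map fst t') by exact: path_sorted so'.
have ge2 := row_ge so'.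
have tE := sg_row a so1; have t'E := sg_row a so2.
have A0 : [seq c.2 | c <- t' & c.1 == a] = [::].
  apply: no_letter; have /andP[_] := ge2; apply: sub_all => c /=; clear -hh'; lia.
case: (eqVneq h'.1 a.+1) => [h'a|h'a]; last first.
  have C0 : [seq c.2 | c <- t' & c.1 == a.+1] = [::].
    apply: no_letter; have /andP[_] := ge2; apply: sub_all => c /=; clear -hh' h'a; lia.
  have W1 v : sg a (W ++ v) = sg a v.
    by rewrite sg_cat WE t'E A0 C0 /sg_mul /= drop0; case: (sg a v).
  by rewrite !(sg_cat _ X) W1 (sg_cat _ [:: h]) W1 -(sg_cat _ [:: h]).
have cnt : size [seq c.2 | c <- t' & c.1 == a.+1] <= size [seq c.2 | c <- t & c.1 == a].
  rewrite !size_letter; apply: count_rowlt.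
    by move: RR'; rewrite /rowlt /= => /andP[].
  by rewrite all_map; have := row_ge so; rewrite /= => /andP[_]; rewrite ha.
rewrite -cat1s !sg_cat XE WE t'E A0 tE.
have -> : sg a [:: h] = ([:: h.2], [::]) by rewrite /= /sg_step ha eqxx.
have -> : sg a [:: h'] = ([::], [:: h'.2]).
  by rewrite /= /sg_step h'a eqxx (gtn_eqF (ltnSn a)).
move: cnt; move: [seq c.2 | c <- t' & c.1 == a.+1] [seq c.2 | c <- t & c.1 == a]
  [seq c.2 | c <- t & c.1 == a.+1] => C2 A1 C1 cnt; clear -cnt.
rewrite /sg_mul /= !drop0 size_drop /= drop_drop add1n /=.
have -> : 1 - ((size A1).+1 - size C2) = 0 by lia.
by have -> : size C2 - (size A1).+1 = size C2 - size A1 by lia.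
Qed.

Lemma tableau_rows_ok n r s T : 0 < s -> is_tableau n r s (unl T) -> rows_ok T.
Proof.
move=> s0 /and3P[_ rows so]; rewrite /rows_ok; apply/and3P; split.
- apply/allP => R RT; have /allP /(_ (map fst R)) := rows.
  rewrite map_f // => /(_ isT) /and3P[/eqP sz _ _]; case: (R) sz => //= e; lia.
- apply/allP => R RT; have /allP /(_ (map fst R)) := rows.
  by rewrite map_f // => /(_ isT) /and3P[].
- by move: so; rewrite /unl sorted_map.
Qed.

Lemma perm_split T : perm_eq (tword (map (take 1) T) ++ tword (map behead T)) (tword T).
Proof.
elim: T => //= R T IH; rewrite !tword_cons; apply/permP => p.
have := permP IH p; rewrite !count_cat.
have := congr1 (count p) (cat_take_drop 1 R); rewrite count_cat drop1; lia.
Qed.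

Lemma lletters_cons T B : lletters (T :: B) = tword T ++ lletters B.
Proof. by []. Qed.

Lemma ls_invariant a n r s T b : 0 < s -> is_tableau n r s T ->
  [/\ ph a (ls (T :: b)) = ph a (T :: b), ep a (ls (T :: b)) = ep a (T :: b)
    & path_f a (ls (T :: b)) = omap ls (path_f a (T :: b))].
Proof.
move=> s0 okT; have [[|LT B] [e uB]] := labelling (T :: b) => //; rewrite -e ls_unl.
have ok : rows_ok LT by case: e => e _; rewrite -e in okT; exact: tableau_rows_ok okT.
have E : sg a (lletters (lls (LT :: B))) = sg a (lletters (LT :: B)).
  by rewrite /lls !lletters_cons catA !(sg_cat _ _ (lletters B)) -sg_split.
have uB' : uniq (labels (lletters (lls (LT :: B)))).
  rewrite (perm_uniq (s2 := labels (lletters (LT :: B)))) //; apply: perm_map.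
  by rewrite /lls !lletters_cons catA perm_cat2r perm_split.
move: {e} (LT :: B) uB E uB' => LB uB E uB'.
rewrite !phE !epE E; split=> //; rewrite !path_f_labelled // /fd E.
by case: (ohead _) => //= d; rewrite lls_upd -ls_unl.
Qed.

(* Two adjacent rows, [R] above [R']. *)
Section Rows.
Variables (a : nat) (R R' : seq nat).
Hypotheses (soR : sorted leq R) (soR' : sorted leq R') (lt : all2 ltn R R').

Let sizeE : size R = size R'.
Proof. by move: lt; rewrite all2E => /andP[/eqP]. Qed.

Let nth_lt j : j < size R -> nth 0 R j < nth 0 R' j.
Proof.
move: lt; rewrite all2E => /andP[_ /allP h] jR.
have := h (nth (0, 0) (zip R R') j) (mem_nth _ _); rewrite size_zip -sizeE minnn => /(_ jR).
by rewrite nth_zip.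
Qed.

Let nth_le (u : seq nat) i j : sorted leq u -> i <= j -> j < size u -> nth 0 u i <= nth 0 u j.
Proof. by move=> so ij ju; apply: (sorted_leq_nth leq_trans leqnn) => //; rewrite inE; lia. Qed.

Lemma count_nth v (u : seq nat) : count_mem v u = \sum_(i < size u) (nth 0 u i == v).
Proof.
rewrite -(big_mkord xpredT (fun i => nth 0 u i == v : nat)) -(big_nth 0 xpredT (fun x => x == v : nat)).
by elim: u => [|x u IH]; rewrite ?big_nil ?big_cons //= IH.
Qed.

(** If the entry below the last [a] were [a.+1], weak increase would put [a.+1] below every [a] of
    [R], against the count. *)
Lemma row_below_f j : count_mem a.+1 R' < count_mem a R -> j < size R -> nth 0 R j = a ->
  (forall i, j < i < size R -> nth 0 R i != a) -> a.+1 < nth 0 R' j.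
Proof.
move=> cnt jR Rj last; have := nth_lt jR; rewrite Rj ltn_neqAle leq_eqVlt orbC => h.
rewrite ltn_neqAle; apply/andP; split; last by have := nth_lt jR; rewrite Rj.
apply/eqP => e; move: cnt; rewrite ltnNge => /negP; apply.
rewrite !count_nth -sizeE; apply: leq_sum => -[i iR] _ /=.
case: (eqVneq (nth 0 R i) a) => // Ri; have ij : i <= j.
  by rewrite leqNgt; apply/negP => ji; have := last i; rewrite ji iR Ri eqxx => /(_ isT).
have := nth_lt iR; have := nth_le soR' ij; rewrite -sizeE => /(_ jR).
rewrite -e Ri => h1 h2; have -> : nth 0 R' i = a.+1 by lia.
by rewrite eqxx.
Qed.

Lemma row_above_e j : count_mem a R < count_mem a.+1 R' -> j < size R -> nth 0 R' j = a.+1 ->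
  (forall i, i < j -> nth 0 R' i != a.+1) -> nth 0 R j < a.
Proof.
move=> cnt jR Rj first; have := nth_lt jR; rewrite Rj ltnS => h.
rewrite ltn_neqAle h andbT; apply/eqP => e.
move: cnt; rewrite ltnNge => /negP; apply.
rewrite !count_nth -sizeE; apply: leq_sum => -[i iR] _ /=.
case: (eqVneq (nth 0 R' i) a.+1) => // Ri; have ji : j <= i.
  by rewrite leqNgt; apply/negP => ij; have := first i ij; rewrite Ri eqxx.
have := nth_lt iR; have := nth_le soR ji iR.
rewrite e Ri => h1 h2; have -> : nth 0 R i = a by lia.
by rewrite eqxx.
Qed.

End Rows.

Lemma all2_set_nthl (u v : seq nat) j x : all2 ltn u v -> j < size u -> x < nth 0 v j ->
  all2 ltn (set_nth 0 u j x) v.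
Proof.
elim: u v j => [|y u IH] [|z v] [|j] //= /andP[yz uv] ju xv; first by rewrite /ltn /= xv.
by rewrite yz IH.
Qed.

Lemma all2_set_nthr (u v : seq nat) j x : all2 ltn u v -> j < size u -> nth 0 u j < x ->
  all2 ltn u (set_nth 0 v j x).
Proof.
elim: u v j => [|y u IH] [|z v] [|j] //= /andP[yz uv] ju xv; first by rewrite /ltn /= xv.
by rewrite yz IH.
Qed.

Lemma all2_size (u v : seq nat) : all2 ltn u v -> size u = size v.
Proof. by rewrite all2E => /andP[/eqP]. Qed.

Lemma all2_nth (u v : seq nat) j : all2 ltn u v -> j < size u -> nth 0 u j < nth 0 v j.
Proof. by elim: u v j => [|y u IH] [|z v] [|j] //= /andP[yz uv] ju; [exact: yz | exact: IH]. Qed.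

Lemma sorted_set_nth (u : seq nat) j x : sorted leq u -> j < size u ->
  (forall i, i < j -> nth 0 u i <= x) -> (forall i, j < i < size u -> x <= nth 0 u i) ->
  sorted leq (set_nth 0 u j x).
Proof.
move=> so ju h1 h2; apply/(sortedP 0) => i; rewrite size_set_nth (maxn_idPr ju) => iu.
rewrite !nth_set_nth /=; case: (eqVneq i j) => [e|ne].
  rewrite e (gtn_eqF (ltnSn j)) -e; apply: h2; lia.
case: eqP => [e|_]; first by apply: h1; lia.
by move/(sortedP 0): so; apply.
Qed.

Lemma all_set_nth (P : pred nat) (u : seq nat) j x : all P u -> j < size u -> P x ->
  all P (set_nth 0 u j x).
Proof. by elim: u j => [|y u IH] [|j] //= /andP[Py Pu] ju Px; rewrite ?Px ?Py ?IH. Qed.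

Lemma last_letter v (R : lword) d : ohead (rev [seq c.2 | c <- R & c.1 == v]) = Some d ->
  exists j, [/\ j < size R, nth 0 (labels R) j = d, nth 0 (map fst R) j = v &
    forall i, j < i < size R -> nth 0 (map fst R) i != v].
Proof.
elim/last_ind: R => // R c IH; rewrite filter_rcons; case: eqP => [cv|cv].
  rewrite map_rcons rev_rcons /= => -[<-]; exists (size R).
  rewrite /labels !map_rcons !nth_rcons !size_map ltnn eqxx size_rcons; split=> // i; lia.
move=> /IH[j [jR jd jv jl]]; exists j; rewrite size_rcons /labels !map_rcons !nth_rcons !size_map jR.
split=> //; first lia.
move=> i /andP[ji iR]; rewrite nth_rcons size_map; case: ltnP => [iR'|Ri]; first by apply: jl; rewrite ji.
by rewrite (_ : i == size R); [apply/eqP | lia].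
Qed.

Lemma first_letter v (R : lword) d : ohead [seq c.2 | c <- R & c.1 == v] = Some d ->
  exists j, [/\ j < size R, nth 0 (labels R) j = d, nth 0 (map fst R) j = v &
    forall i, i < j -> nth 0 (map fst R) i != v].
Proof.
elim: R => //= c R IH; case: eqP => [cv|cv] /=.
  by move=> [<-]; exists 0; split.
move=> /IH[j [jR jd jv jl]]; exists j.+1; split=> // -[_|i ij] /=; [exact/eqP|exact: jl].
Qed.

Lemma tword_nth T k : k < size T ->
  tword T = tword (drop k.+1 T) ++ nth [::] T k ++ tword (take k T).
Proof.
move=> kT; rewrite -{1}(cat_take_drop k T) (drop_nth [::] kT) /tword rev_cat rev_cons.
by rewrite flatten_cat flatten_rcons catA.
Qed.

(** With [V] the rows read earlier, that is, those below: the changed letter of [R] is unmatched, so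
    [V] leaves fewer [a.+1] than [R] has [a]. This supplies the count in [row_below_f]. *)
Lemma fd_middle a V R U d : uniq (labels (V ++ R ++ U)) -> fd a (V ++ R ++ U) = Some d ->
  d \in labels R -> fd a R = Some d /\ size (sg a V).2 < size (sg a R).1.
Proof.
move=> u; have [_ nV] := uniq_cat_notin d u.
have uRU : uniq (labels (R ++ U)) by move: u; rewrite labels_cat cat_uniq => /and3P[].
have [nU _] := uniq_cat_notin d uRU.
rewrite fd_cat; case: ltnP => h; last first.
  by move=> /fd_in dV dR; move: nV; rewrite labels_cat mem_cat dR => /(_ isT); rewrite dV.
rewrite fd_cat; case: ltnP => h'.
  by move=> /fd_in dU /nU; rewrite dU.
move=> -> _; split=> //; apply: leq_trans h _.
by rewrite sg_cat /= size_cat drop_oversize ?addn0.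
Qed.

Lemma ed_middle a V R U d : uniq (labels (V ++ R ++ U)) -> ed a (V ++ R ++ U) = Some d ->
  d \in labels R -> ed a R = Some d /\ size (sg a U).1 < size (sg a R).2.
Proof.
rewrite catA => u; have [nU _] := uniq_cat_notin d u.
have uVR : uniq (labels (V ++ R)) by move: u; rewrite labels_cat cat_uniq => /and3P[].
have [_ nV] := uniq_cat_notin d uVR.
rewrite ed_cat; case: ltnP => h; last first.
  by move=> /ed_in dU dR; move: nU; rewrite labels_cat mem_cat dR orbT => /(_ isT); rewrite dU.
rewrite ed_cat; case: ltnP => h'.
  by move=> /ed_in dV /nV; rewrite dV.
move=> -> _; split=> //; apply: leq_trans h _.
by rewrite sg_cat /= (eqP h') take0.
Qed.

Section Preserve.
Variables (a d v : nat) (T : ltableau).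
Hypotheses (ok : rows_ok T) (uT : uniq (labels (tword T))).

Let row k := nth [::] T k.

Lemma row_uniq k : k < size T -> uniq (labels (row k)).
Proof. by move=> kT; move: uT; rewrite (tword_nth kT) !labels_cat !cat_uniq => /and3P[_ _ /and3P[]]. Qed.

Lemma row_sorted k : k < size T -> sorted leq (map fst (row k)).
Proof. by move=> kT; case/and3P: ok => _ /allP h _; apply: h; exact: mem_nth. Qed.

Lemma row_lt k : k.+1 < size T -> all2 ltn (map fst (row k)) (map fst (row k.+1)).
Proof. by move=> kT; case/and3P: ok => _ _ /(sortedP [::]) /(_ k kT). Qed.

Lemma row_disjoint k : k.+1 < size T -> d \in labels (row k) -> d \notin labels (row k.+1).
Proof.
move=> kT dk; have := uT; rewrite (tword_nth (ltnW kT)) (tword_nth (T := drop _ _) (k := 0)); last first.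
  by rewrite size_drop; lia.
rewrite nth_drop addn0 => u; have [_ h] := uniq_cat_notin d u.
have := h; rewrite labels_cat mem_cat dk => /(_ isT).
by rewrite !labels_cat !mem_cat !negb_or => /and3P[].
Qed.

Lemma row_changed k j : k < size T -> j < size (row k) -> nth 0 (labels (row k)) j = d ->
  map fst (upd d v (row k)) = set_nth 0 (map fst (row k)) j v.
Proof. by move=> kT jk <-; rewrite (set_nth_upd (row_uniq kT)) // size_map. Qed.

Lemma sg_row_size k : k < size T ->
  size (sg a (row k)).1 = count_mem a (map fst (row k)) /\
  size (sg a (row k)).2 = count_mem a.+1 (map fst (row k)).
Proof. by move=> kT; rewrite (sg_row a (row_sorted kT)) /= !size_letter. Qed.

Lemma tableau_changed n r s :
  is_tableau n r s (unl T) -> 1 <= v <= n ->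
  (forall k, k < size T -> d \in labels (row k) -> exists j,
    [/\ j < size (row k), nth 0 (labels (row k)) j = d,
        forall i, i < j -> nth 0 (map fst (row k)) i <= v,
        forall i, j < i < size (row k) -> v <= nth 0 (map fst (row k)) i &
        (forall k', k'.+1 = k -> nth 0 (map fst (row k')) j < v) /\
        (k.+1 < size T -> v < nth 0 (map fst (row k.+1)) j)]) ->
  is_tableau n r s (unl (tupd d v T)).
Proof.
move=> /and3P[szT rows _] vn h; apply/and3P; split.
- by move: szT; rewrite !size_map.
- apply/allP => R; rewrite /unl /tupd -map_comp => /mapP[R0 /(nthP [::])[k kT <-] -> /=].
  have /allP /(_ (map fst (row k))) := rows; rewrite map_f ?mem_nth // => /(_ isT) /and3P[sz so al].
  have [dk|dk] := boolP (d \in labels (row k)); last by rewrite upd_id // sz so al.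
  have [j [jk jd h1 h2 _]] := h k kT dk; rewrite (row_changed kT jk jd).
  have jk' : j < size (map fst (row k)) by rewrite size_map.
  rewrite size_set_nth (maxn_idPr jk') sz sorted_set_nth ?all_set_nth //.
  by rewrite size_map.
- apply/(sortedP [::]) => k; rewrite !size_map => kT.
  have kT' := ltnW kT.
  rewrite !(nth_map [::]) ?size_map // -/(row k) -/(row k.+1).
  have lt := row_lt kT.
  have [dk|dk] := boolP (d \in labels (row k)).
    have [j [jk jd _ _ [_ h3]]] := h k kT' dk; rewrite (row_changed kT' jk jd).
    by rewrite upd_id ?row_disjoint // all2_set_nthl ?size_map ?h3.
  rewrite upd_id //; have [dk1|dk1] := boolP (d \in labels (row k.+1)); last by rewrite upd_id.
  have [j [jk jd _ _ [h3 _]]] := h k.+1 kT dk1; rewrite (row_changed kT jk jd).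
  by apply: all2_set_nthr => //; [rewrite (all2_size lt) size_map | exact: h3].
Qed.

End Preserve.

Lemma tab_f_tableau n r s a T T' : 0 < s -> a.+1 <= n -> is_tableau n r s T ->
  tab_f a T = Some T' -> is_tableau n r s T'.
Proof.
move=> s0 an okT; have [LT [e u]] := tlabelling T; subst T.
have ok := tableau_rows_ok s0 okT.
rewrite tab_f_labelled //; case E : (fd a (tword LT)) => [d|] //= [<-].
apply: tableau_changed => // k kT dk.
have := u; have := E; rewrite (tword_nth kT) => E' u'.
have [fdk lt] := fd_middle u' E' dk.
have so := row_sorted ok kT.
have [c1 c2] := sg_row_size a ok kT.
move: fdk; rewrite /fd (sg_row a so) => /last_letter[j [jk jd jv jl]].
have jk' : j < size (map fst (nth [::] LT k)) by rewrite size_map.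
exists j; split=> //.
- move=> i ij; have : nth 0 (map fst (nth [::] LT k)) i <= nth 0 (map fst (nth [::] LT k)) j.
    by apply: (sorted_leq_nth leq_trans leqnn) => //; rewrite ?inE; lia.
  by rewrite jv; lia.
- move=> i ii; have := jl i ii.
  have : nth 0 (map fst (nth [::] LT k)) j <= nth 0 (map fst (nth [::] LT k)) i.
    by apply: (sorted_leq_nth leq_trans leqnn) => //; rewrite ?inE ?size_map; lia.
  by rewrite jv; lia.
- split.
    move=> k' e; subst k; have ltk := row_lt ok kT.
    have := all2_nth (j := j) ltk; rewrite jv (all2_size ltk) => /(_ jk'); lia.
  move=> kT1; have ltk := row_lt ok kT1.
  apply: (@row_below_f a _ _ _ (row_sorted ok kT1) ltk j) => //; last by move=> i; rewrite size_map; exact: jl.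
  (* Row [k.+1] is read last among the rows below, so none of its [a.+1] is matched there. *)
  rewrite -(sg_row_size a ok kT1).2 -c1; apply: leq_ltn_trans lt.
  rewrite (tword_nth (T := drop _ _) (k := 0)); last by rewrite size_drop; lia.
  by rewrite nth_drop addn0 take0 cats0 sg_cat /= size_cat leq_addl.
Qed.

Lemma tab_e_tableau n r s a T T' : 0 < s -> 1 <= a <= n -> is_tableau n r s T ->
  tab_e a T = Some T' -> is_tableau n r s T'.
Proof.
move=> s0 an okT; have [LT [e u]] := tlabelling T; subst T.
have ok := tableau_rows_ok s0 okT.
rewrite tab_e_labelled //; case E : (ed a (tword LT)) => [d|] //= [<-].
apply: tableau_changed => // k kT dk.
have := u; have := E; rewrite (tword_nth kT) => E' u'.
have [edk lt] := ed_middle u' E' dk.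
have so := row_sorted ok kT.
have [c1 c2] := sg_row_size a ok kT.
move: edk; rewrite /ed (sg_row a so) => /first_letter[j [jk jd jv jl]].
have jk' : j < size (map fst (nth [::] LT k)) by rewrite size_map.
exists j; split=> //.
- move=> i ij; have := jl i ij.
  have : nth 0 (map fst (nth [::] LT k)) i <= nth 0 (map fst (nth [::] LT k)) j.
    by apply: (sorted_leq_nth leq_trans leqnn) => //; rewrite ?inE; lia.
  by rewrite jv; lia.
- move=> i ii.
  have : nth 0 (map fst (nth [::] LT k)) j <= nth 0 (map fst (nth [::] LT k)) i.
    by apply: (sorted_leq_nth leq_trans leqnn) => //; rewrite ?inE ?size_map; lia.
  by rewrite jv; lia.
- split.
    move=> k' e; subst k; have ltk := row_lt ok kT.
    apply: (@row_above_e a _ _ (row_sorted ok (ltnW kT)) (row_sorted ok kT) ltk j) => //; last by rewrite (all2_size ltk).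
    (* Row [k'] is read first among the rows above, so none of its [a] is matched there. *)
    rewrite -(sg_row_size a ok (ltnW kT)).1 -c2; apply: leq_ltn_trans lt.
    rewrite (tword_nth (T := take _ _) (k := k')); last by rewrite size_take kT.
    rewrite nth_take // drop_oversize ?size_take ?kT //.
    by rewrite [tword [::]]/(tword _) /= sg_cat /= size_cat leq_addr.
  move=> kT1; have := all2_nth (row_lt ok kT1) jk'; rewrite jv; lia.
Qed.

(** * Concavity of vacancy numbers *)

Local Open Scope ring_scope.
Local Open Scope mset_scope.

Section Concave.
Variable p : nat -> int.

Definition concave (u v : nat) :=
  forall i, (u < i < v)%N -> p i.-1 + p i.+1 <= p i *+ 2.

Lemma slope_dec u v i j : concave u v -> (u <= i <= j)%N -> (j < v)%N ->
  p j.+1 - p j <= p i.+1 - p i.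
Proof.
move=> cv /andP[ui]; elim: j => [|j IH] ij jv; first by have -> : i = 0%N by lia.
have [<-//|ne] := eqVneq i j.+1.
have {}IH := IH ltac:(lia) ltac:(lia).
have := cv j.+1 ltac:(lia); rewrite /=; lia.
Qed.

Lemma noninc_after u v i j : concave u v -> (u <= i <= j)%N -> (j <= v)%N ->
  (i < v)%N -> p i.+1 <= p i -> p j <= p i /\ ((i < j)%N -> p j <= p i.+1).
Proof.
move=> cv /andP[ui ij] jv iv le; elim: j => [|j IH] in ij jv *.
  by have -> : i = 0%N; [lia | split].
have [<-|ne] := eqVneq i j.+1; first by split=> //; lia.
have {}IH := IH ltac:(lia) ltac:(lia).
have := @slope_dec u v i j cv ltac:(lia) ltac:(lia).
have [<-|ne'] := eqVneq i j; first by lia.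
by case: IH => _ /(_ ltac:(lia)); lia.
Qed.

Lemma nondec_before u v i j : concave u v -> (u <= i <= j)%N -> (j < v)%N ->
  p j <= p j.+1 -> p i <= p j.
Proof.
move=> cv /andP[ui ij] jv le.
elim: j => [|j IH] in ij jv le *; first by have -> : i = 0%N by lia.
have [<-//|ne] := eqVneq i j.+1.
have := @slope_dec u v j j.+1 cv ltac:(lia) ltac:(lia) => h.
by have := IH ltac:(lia) ltac:(lia) ltac:(lia); lia.
Qed.

Lemma ge_between u v c i : concave u v -> c <= p u -> c <= p v ->
  (u <= i <= v)%N -> c <= p i.
Proof.
move=> cv cu cv' /andP[ui iv].
have [le|gt] := lerP (p i.+1) (p i).
  have [<-//|ne] := eqVneq v i.
  by have [] := @noninc_after u v i v cv ltac:(lia) ltac:(lia) ltac:(lia) le; lia.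
have [<-//|ne] := eqVneq v i.
by have := @nondec_before u v u i cv ltac:(lia) ltac:(lia) ltac:(lia); lia.
Qed.

(** The minimum principle for concave functions. *)
Lemma flat_between u v c w i : concave u v -> c <= p u -> c <= p v ->
  (u < w < v)%N -> p w <= c -> (u <= i <= v)%N -> p i = c.
Proof.
move=> cv cu cv' uwv pw uiv.
have geq j := @ge_between u v c j cv cu cv'.
have pwc : p w = c by have := geq w ltac:(lia); lia.
have := geq i uiv; have [le|gt] := leqP w i.
  have [->//|ne] := eqVneq i w.
  have := geq w.-1 ltac:(lia).
  have := cv w ltac:(lia) => h1 h2.
  have [_ /(_ ltac:(lia))] := @noninc_after u v w i cv ltac:(lia) ltac:(lia) ltac:(lia) ltac:(lia).
  lia.
have := geq w.+1 ltac:(lia).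
have := @nondec_before u v i w cv ltac:(lia) ltac:(lia).
lia.
Qed.

End Concave.

(** If no part follows [k], then [v] is a length beyond [N], where vacancy numbers have reached
    their limit; the limit then plays the part of a boundary value. *)
Lemma next_part (m : nat -> nat) N k :
  exists v, [/\ (k < v)%N, forall i, (k < i < v)%N -> m i = 0%N
              & (0 < m v)%N \/ (N < v)%N].
Proof.
have ex : exists v, (k < v)%N && ((0 < m v)%N || (N < v)%N).
  by exists (k + N).+1; apply/andP; split; [lia | apply/orP; right; lia].
exists (ex_minn ex); case: ex_minnP => v /andP[kv /orP mv] mn; split=> // i ikv.
apply/eqP; rewrite -leqn0 leqNgt; apply/negP => mi.
by have := mn i ltac:(lia); lia.
Qed.

Lemma prev_part (m : nat -> nat) k l : (k < l)%N ->
  exists u, [/\ (k <= u < l)%N, forall i, (u < i < l)%N -> m i = 0%N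
              & (0 < m u)%N \/ u = k].
Proof.
move=> kl; pose P := [pred u | (k <= u < l)%N && ((0 < m u)%N || (u == k))].
have ex : exists v, P v by exists k; rewrite /= eqxx; lia.
have bd i : P i -> (i <= l)%N by move=> /=; lia.
exists (ex_maxn ex bd); case: ex_maxnP => u /= /andP[h /orP h'] mx; split=> //.
  move=> i iu; apply/eqP; rewrite -leqn0 leqNgt; apply/negP => mi.
  by have := mx i ltac:(lia); lia.
by case: h' => [|/eqP]; [left|right].
Qed.

Section Vacancies.
Variables (p : nat -> int) (m g : nat -> nat) (N : nat) (pinf : int).

(* The shape of i |-> p_i^(a), with m_i = m_i^(a) and
   g_i = L_i^(a) + m_i^(a-1) + m_i^(a+1). *)
Definition vac_shape :=
  [/\ p 0%N = 0,
      forall i, (0 < i)%N ->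
        p i *+ 2 = p i.-1 + p i.+1 + (g i)%:Z - (m i)%:Z *+ 2,
      forall i, (N <= i)%N -> p i = pinf
    & forall i, (N < i)%N -> m i = 0%N].

Hypothesis H : vac_shape.

Lemma vac_concave u v : (forall i, (u < i < v)%N -> m i = 0%N) -> concave p u v.
Proof. by case: H => _ H2 _ _ mz i iuv; have := H2 i ltac:(lia); rewrite mz //; lia. Qed.

(** The contradictions below come from here: a plateau of [p] cannot contain a length selected by
    delta in a neighbouring component. *)
Lemma vac_flat u v c i : (forall i, (u < i < v)%N -> m i = 0%N) ->
  (forall i, (u <= i <= v)%N -> p i = c) -> (u < i < v)%N -> g i = 0%N.
Proof.
case: H => _ H2 _ _ mz pc iuv; have := H2 i ltac:(lia).
rewrite mz // !pc; lia.
Qed.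

(** Past the last part [p] is concave and finally constant, so its slopes cannot be negative. *)
Lemma vac_tail v i : (forall j, (v < j)%N -> m j = 0%N) -> (v <= i)%N ->
  p v <= p i <= pinf.
Proof.
move=> mz vi; case: (H) => _ _ Hinf _.
have cv w : concave p v w by apply: vac_concave => j jv; apply: mz; lia.
have mono j k : (v <= j <= k)%N -> p j <= p k.
  move=> jk; apply: (@nondec_before p v (k + N).+2 j k) => //; try lia.
  have := @slope_dec p v (k + N).+2 k (k + N).+1 (cv _) ltac:(lia) ltac:(lia).
  by rewrite !(Hinf (k + N).+1) ?(Hinf (k + N).+2); lia.
by rewrite mono ?leqnn //= -(Hinf (i + N)%N) ?mono //; lia.
Qed.

(** This bounds the lowered string [(k.+1, s - 1)], whose new vacancy number is [p k.+1 - 2]. If [p]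
    did not exceed [s] at [k.+1], concavity would keep it at most [s] up to the next part or to the
    limit. *)
Lemma next_vac_ge k s : s <= p k -> (forall i, (k < i)%N -> (0 < m i)%N -> s < p i) ->
  s < pinf -> s < p k.+1.
Proof.
move=> pk hi sinf; have [v [kv mz mv]] := next_part m N k.
have pv : s < p v.
  by case: mv => [/(hi v kv)//|Nv]; case: H => _ _ -> //; lia.
have [|//] := lerP (p k.+1) s => le.
have cv := vac_concave mz.
have [_] := @noninc_after p k v k v cv ltac:(lia) ltac:(lia) ltac:(lia) ltac:(lia).
by move=> /(_ kv); lia.
Qed.

(** Meant for the singular string of length 1 that lb adds: its rigging is [p 1]. *)
Lemma vac1_ge s : s <= 0 -> (forall i, (0 < m i)%N -> s <= p i) -> s <= p 1%N.
Proof.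
move=> s0 hi; have [v [v0 mz mv]] := next_part m N 0.
case: (H) => p0 _ _ mN.
case: mv => [mv|Nv].
  apply: (@ge_between p 0 v) => //; [exact: vac_concave | by rewrite p0 | exact: hi].
apply: le_trans s0 _; rewrite -p0.
have [] // := andP (@vac_tail 0 1 _ isT) => j j0.
by have [/(conj j0)/andP/mz//|vj] := ltnP j v; apply: mN; lia.
Qed.

End Vacancies.

(* Here lm, l and lp stand for ell^(a-1), ell^(a) and ell^(a+1), and primes for
   the situation after delta. *)
Section Removal.
Variables (p : nat -> int) (m g : nat -> nat) (N : nat) (pinf : int).
Hypothesis H : vac_shape p m g N pinf.
Variables (lm l : nat).
Hypotheses (lm_gt0 : (0 < lm)%N) (lml : (lm <= l)%N).
Hypothesis glm : (lm < l)%N -> (0 < g lm)%N.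

(** Delta lowers the vacancy number at [l.-1] by [(lm < l)], so the shortened string gets a rigging
    at least [s]. Otherwise [p] is constant from the previous part [u] to [l]; then [lm] is not
    strictly inside by [vac_flat], so [lm <= u], and [p u = s] contradicts the bound at [u]. *)
Lemma vac_before_selected s : s <= 0 -> s <= p l ->
  (forall i, (0 < i < l)%N -> (0 < m i)%N -> s + (lm <= i)%:Z <= p i) ->
  s + (lm < l)%:Z <= p l.-1.
Proof.
move=> s0 pl hi; case: (H) => p0 H2 _ _.
have [u [ul mz mu]] := @prev_part m 0 l ltac:(lia).
have pu : s <= p u.
  case: mu => [mu|->]; last by rewrite p0.
  have [->|u0] := posnP u; first by rewrite p0.
  by have := hi u ltac:(lia) mu; lia.
have cv := vac_concave H mz.
have [ul1|ul1] := eqVneq u l.-1.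
  case: mu => [mu|u0]; last by rewrite -ul1 u0 p0; lia.
  have [u0|u0] := posnP u; first by rewrite -ul1 u0 p0; lia.
  by have := hi u ltac:(lia) mu; rewrite -ul1; lia.
have := @ge_between p u l s l.-1 cv pu pl ltac:(lia).
have [lt|] := ltnP lm l; last by lia.
have [le|] := lerP (p l.-1) s; last by lia.
have fl i := @flat_between p u l s l.-1 i cv pu pl ltac:(lia) le.
have g0 i := @vac_flat p m g N pinf H u l s i mz fl.
have lmu : (lm <= u)%N.
  by rewrite leqNgt; apply/negP => ulm; have := g0 lm ltac:(lia); have := glm lt; lia.
case: mu => [mu|]; last by lia.
by have := hi u ltac:(lia) mu; have := fl u ltac:(lia); lia.
Qed.

(* The f-string (k, s) is shorter than the selected one. *)
Section Shorter.
Variables (k : nat) (s : int).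
Hypotheses (kl : (k < l)%N) (pk : s + ((0 < k)%N && (lm <= k)%N)%:Z <= p k).
Hypothesis hi : forall i, (k < i < l)%N -> (0 < m i)%N -> s + 1 + (lm <= i)%:Z <= p i.
Hypotheses (pl : s < p l) (ml : (0 < m l)%N).

(** The excluded condition says that the new string [(k.+1, s - 1)] is singular and long enough for
    delta to select it. Without it the string shortened by delta gets a rigging above [s], so it
    does not become the lowered one. *)
Lemma shorter_not_reached : (k < l.-1)%N ->
  ~ ((lm <= k.+1)%N /\ p k.+1 = s + 1) -> s + (lm < l)%:Z < p l.-1.
Proof.
move=> kl1 nc; case: (H) => p0 H2 _ _.
have [u [ul mz mu]] := @prev_part m k l kl.
have cv := vac_concave H mz.
have pu : s + (k < u)%:Z <= p u.
  have [<-|ne] := eqVneq k u; first by rewrite ltnn; lia.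
  by case: mu => [mu|]; last lia; have := hi (i:=u) ltac:(lia) mu; lia.
have [ul1|ul1] := eqVneq u l.-1.
  by case: mu => [mu|]; last lia; have := hi (i:=u) ltac:(lia) mu; rewrite -ul1; lia.
have pu1 : s < p u.+1.
  have [|//] := lerP (p u.+1) s => le.
  by have [_ /(_ ltac:(lia))] := @noninc_after p u l u l cv ltac:(lia) ltac:(lia) ltac:(lia) ltac:(lia); lia.
have cv1 : concave p u.+1 l by move=> i iu; apply: cv; lia.
have ge1 := @ge_between p u.+1 l (s + 1) l.-1 cv1 ltac:(lia) ltac:(lia) ltac:(lia).
have [lt|] := ltnP lm l; last by lia.
have [le|] := lerP (p l.-1) (s + 1); last by lia.
have mz1 i : (u.+1 < i < l)%N -> m i = 0%N by move=> iu; apply: mz; lia.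
have [uk|uk] := eqVneq u k; last first.
  have fl i := @flat_between p u l (s + 1) l.-1 i cv ltac:(lia) ltac:(lia) ltac:(lia) le.
  have g0 i := @vac_flat p m g N pinf H u l _ i mz fl.
  have lmu : (lm <= u)%N.
    by rewrite leqNgt; apply/negP => ulm; have := g0 lm ltac:(lia); have := glm lt; lia.
  case: mu => [mu|]; last by lia.
  by have := hi (i:=u) ltac:(lia) mu; have := fl u ltac:(lia); lia.
subst u; have [kl2|kl2] := eqVneq k.+1 l.-1.
  by case: nc; rewrite kl2; split; lia.
have fl i := @flat_between p k.+1 l (s + 1) l.-1 i cv1 ltac:(lia) ltac:(lia) ltac:(lia) le.
have g0 i := @vac_flat p m g N pinf H k.+1 l _ i mz1 fl.
have [lk|lk] := leqP lm k.+1; first by case: nc; split=> //; apply: fl; lia.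
by have := g0 lm ltac:(lia); have := glm lt; lia.
Qed.

(** Here the two operations trade places. [p] is level at [s + 1] after [k]; it can rise only from
    [k] to [k.+1], and that kink is paid for by the one unit of [g] at [lm = k.+1]. *)
Lemma shorter_reached : (k.+1 < l)%N -> (lm <= k.+1)%N -> p k.+1 = s + 1 ->
  [/\ forall i, (k < i < l)%N -> m i = 0%N,
      forall i, (k < i <= l)%N -> p i = s + 1,
      p k = s + (lm <= k)%:Z
    & forall i, (k < i < l)%N -> g i = (i == lm)].
Proof.
move=> kl1 lmk pk1; case: (H) => p0 H2 _ _.
have pk0 : s <= p k by lia.
have h2 := H2 k.+1 isT; rewrite /= in h2.
have [v [kv mz mv]] := next_part m l k.
have glm' : (0 < g lm)%N by apply: glm; lia.
have vl : v = l.
  apply/eqP; rewrite eqn_leq [(l <= v)%N]leqNgt; apply/andP; split.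
    by rewrite leqNgt; apply/negP => lv; have := mz l ltac:(lia); lia.
  apply/negP => vl; case: mv => [mv|]; last by lia.
  have cv := vac_concave H mz.
  have pv := hi (i:=v) ltac:(lia) mv.
  have vk : v <> k.+1 by move=> vk; subst v; lia.
  have [le|gt] := lerP (p k.+1) (p k).
    by have [_ /(_ ltac:(lia))] := @noninc_after p k v k v cv ltac:(lia) ltac:(lia) ltac:(lia) le; lia.
  have klm : lm = k.+1 by lia.
  have := mz k.+1 ltac:(lia) => mk1.
  have le : p k.+2 <= p k.+1 by subst lm; lia.
  have [_ /(_ ltac:(lia))] := @noninc_after p k v k.+1 v cv ltac:(lia) ltac:(lia) ltac:(lia) le; lia.
subst v; have cv := vac_concave H mz.
have mk1 := mz k.+1 ltac:(lia).
have [le|gt] := lerP (s + 1) (p k).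
  have fl i := @flat_between p k l (s + 1) k.+1 i cv le ltac:(lia) ltac:(lia) ltac:(lia).
  have g0 i := @vac_flat p m g N pinf H k l _ i mz fl.
  have lmk' : (lm <= k)%N.
    by rewrite leqNgt; apply/negP => h; have := g0 lm ltac:(lia); lia.
  split=> //; [by move=> i h; apply: fl; lia | by rewrite fl; lia |].
  by move=> i h; rewrite g0 //; lia.
have cv1 : concave p k.+1 l by move=> i iu; apply: cv; lia.
have mz1 i : (k.+1 < i < l)%N -> m i = 0%N by move=> iu; apply: mz; lia.
have geq := @ge_between p k.+1 l (s + 1) k.+2 cv1 ltac:(lia) ltac:(lia) ltac:(lia).
have klm : lm = k.+1.
  case: (k) lmk pk gt mz lm_gt0 => [|k'] //; last by lia.
  by lia.
have gk : g k.+1 = 1%N by subst lm; lia.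
have fl i : (k.+1 <= i <= l)%N -> p i = s + 1.
  have [<-|ne] := eqVneq k.+2 l.
    move=> h; have [->//|h'] := eqVneq i k.+1; have -> : i = k.+2 by lia.
    lia.
  apply: (@flat_between p k.+1 l (s + 1) k.+2 i cv1); lia.
have g0 i := @vac_flat p m g N pinf H k.+1 l _ i mz1 fl.
split=> //; first lia.
by move=> i h; have [->|ne] := eqVneq i k.+1; [lia|rewrite g0; lia].
Qed.

End Shorter.

(* [hp] tells whether a string of length [lp] is selected in the next component. *)
Variables (hp : bool) (lp : nat).
Hypotheses (llp : hp -> (l <= lp)%N) (lpN : hp -> (lp <= N)%N).
Variables (p' : nat -> int) (m' g' : nat -> nat) (pinf' : int).
Hypothesis H' : vac_shape p' m' g' N pinf'.
Hypothesis pp' : forall i,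
  p' i = p i + (l <= i)%:Z *+ 2 - (lm <= i)%:Z - (hp && (lp <= i)%N)%:Z.
Hypothesis mm' : forall i, (l <= i)%N -> (m' i + (i == l))%N = m i.
Hypothesis glp : hp -> (1 < lp)%N -> (0 < g' lp.-1)%N.

(* The selected string is the only longest string with the smallest rigging s. *)
Variable s : int.
Hypotheses (pl : p l = s) (ml : m l = 1%N).
Hypothesis hi : forall i, (l < i)%N -> (0 < m i)%N -> s < p i.

Let p'_ge i : (l <= i)%N -> p i <= p' i.
Proof. by move=> li; rewrite pp'; lia. Qed.

Let m'l : m' l = 0%N.
Proof. by have := mm' (leqnn l); rewrite eqxx; lia. Qed.

Let hi' i : (l.-1 < i)%N -> (0 < m' i)%N -> s < p' i.
Proof.
move=> li mi; have li' : (l <= i)%N by lia.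
have [e|ne] := eqVneq i l; first by rewrite e m'l in mi.
have := mm' li'; rewrite (negPf ne) addn0 => e.
by have := hi (i:=i) ltac:(lia) ltac:(lia); have := p'_ge li'; lia.
Qed.

Lemma pinf'E : pinf' = pinf + (~~ hp)%:Z.
Proof using H lml lpN H' pp'.
clear -H lml lpN H' pp'; case: (H) (H') => _ _ h _ [_ _ h' _].
rewrite -(h' (N + l)%N) ?leq_addr // pp' (h (N + l)%N) ?leq_addr //.
by case: (hp) lpN => [/(_ isT)|_]; lia.
Qed.

(** Otherwise [p'] is at least [s + 1] at [l.-1] and at the next part [v], while [p' l <= s + 1], so
    it is constant in between. If [hp] fails, the removal raises [p v > s] to at least [s + 2]; if
    [hp] holds, [lp.-1] lies inside the plateau, against [vac_flat]. *)
Lemma selected_lowest : hp || (s < pinf) -> p' l.-1 <= s.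
Proof.
move=> hinf; rewrite leNgt; apply/negP => gt.
case: (H') => _ H2' Hinf' mN'.
have [v [lv mz mv]] := next_part m' N l.-1.
have {}lv : (l < v)%N.
  rewrite ltn_neqAle; apply/andP; split; last by lia.
  by apply/eqP => e; subst v; case: mv => [|Nl]; [rewrite m'l | have := mm' (leqnn l); case: H => _ _ _ /(_ l Nl); lia].
have cv := vac_concave H' mz.
have pv : s < p' v.
  case: mv => [mv|Nv]; first by apply: hi' => //; lia.
  rewrite (Hinf' v) ?(ltnW Nv) //.
  have cvw : forall j, (l.-1 < j)%N -> m' j = 0%N.
    by move=> j lj; have [/(conj lj)/andP/mz//|vj] := ltnP j v; apply: mN'; lia.
  by have := @vac_tail p' m' g' N pinf' H' l.-1 l.-1 cvw (leqnn _); lia.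
have p'l : p' l = s + 1.
  have := @ge_between p' l.-1 v (s + 1) l cv ltac:(lia) ltac:(lia) ltac:(lia).
  by have := pp' l; lia.
have fl i := @flat_between p' l.-1 v (s + 1) l i cv ltac:(lia) ltac:(lia) ltac:(lia) ltac:(lia).
have g0 i := @vac_flat p' m' g' N pinf' H' l.-1 v _ i mz fl.
have p'v := fl v ltac:(lia).
have [hpT|hpF] := boolP hp; last first.
  rewrite (negPf hpF) /= in hinf.
  have pvs : s < p v.
    case: mv => [mv|Nv]; last by case: H => _ _ ->; lia.
    have e := mm' (ltnW lv); apply: hi => //; lia.
  by have := pp' v; rewrite (negPf hpF) /=; lia.
have lpl : (l < lp)%N.
  by rewrite ltnNge; apply/negP => h; have := pp' l; rewrite hpT h; lia.
have lpv : (lp <= v)%N.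
  case: mv => [mv|Nv]; last by have := lpN hpT; lia.
  rewrite leqNgt; apply/negP => h.
  have e := mm' (ltnW lv); have := hi (i:=v) ltac:(lia) ltac:(lia).
  by have := pp' v; rewrite [(lp <= v)%N]leqNgt h andbF; lia.
by have := g0 lp.-1 ltac:(lia); have := glp hpT ltac:(lia); lia.
Qed.

(** Lowering [(l, s)] before delta, or [(l.-1, s)] after it, gives strings with vacancy numbers
    [p l.+1 - 2] and [p' l - 2]. Both equal [s - 1], so both strings are singular and delta turns
    the first into the second. *)
Lemma selected_moves : s < pinf -> p' l.-1 = s ->
  [/\ p l.+1 = s + 1, hp -> (l < lp)%N, p' l = s + 1
    & g' l = (hp && (lp == l.+1))].
Proof.
move=> sinf p'l1; case: (H') => _ H2' _ _.
have sinf' : s < pinf' by rewrite pinf'E; lia.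
have l0 : (0 < l)%N by lia.
have := @next_vac_ge p' m' g' N pinf' H' l.-1 s ltac:(lia) hi' sinf'.
rewrite prednK // => p'lge.
have p1 := @next_vac_ge p m g N pinf H l s ltac:(lia) hi sinf.
have p'le := pp' l; rewrite leqnn lml in p'le.
have hpl : hp -> (l < lp)%N.
  by move=> hpT; rewrite ltnNge; apply/negP => h; rewrite hpT h in p'le; lia.
have h2 := H2' l l0; rewrite m'l p'l1 /= in h2.
have p'1 := pp' l.+1.
have -> : (lp == l.+1) = (lp <= l.+1)%N && (l < lp)%N by lia.
have [hpT|hpF] := boolP hp; last by rewrite (negPf hpF) /= in p'1 p'le *; split=> //; lia.
have lt := hpl hpT; rewrite hpT lt /= in p'1 p'le *.
have g1 : lp = l.+1 -> (0 < g' l)%N by move=> e; have := glp hpT; rewrite e /=; apply; lia.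
have [e|ne] := eqVneq lp l.+1.
  by have := g1 e; split=> //; lia.
by split=> //; lia.
Qed.

End Removal.

Section TightTop.
Variables (p : nat -> int) (m g : nat -> nat) (N : nat) (pinf : int).
Hypothesis H : vac_shape p m g N pinf.

(** The boundary case opposite to [next_vac_ge]: past a longest part above [k], [p] would increase
    from more than [s] to a limit at most [s]. So there is no such part, and [p] is squeezed between
    [p k] and the limit. *)
Lemma tight_top k s : s <= p k -> (forall i, (k < i)%N -> (0 < m i)%N -> s < p i) ->
  pinf <= s ->
  [/\ forall i, (k < i)%N -> m i = 0%N, forall i, (k <= i)%N -> p i = s
    & forall i, (k < i)%N -> g i = 0%N].
Proof.
move=> pk hi pinfE; have [p0 H2 Hinf mN] := H.
have mz i : (k < i)%N -> m i = 0%N.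
  move=> ki; case: (posnP (m i)) => // mi.
  have [u [iu mz mu]] := @prev_part m i (i + N).+1 ltac:(lia).
  have mu' : (0 < m u)%N by case: mu => [//|->].
  have mzu j : (u < j)%N -> m j = 0%N.
    by move=> uj; have [h|h] := ltnP j (i + N).+1; [apply: mz; lia | apply: mN; lia].
  have := @vac_tail p m g N pinf H u u mzu (leqnn _).
  by have := hi u ltac:(lia) mu'; lia.
have pE i : (k <= i)%N -> p i = s.
  move=> ki; have := @vac_tail p m g N pinf H k i mz ki.
  by have := @vac_tail p m g N pinf H i i (fun j ij => mz j (leq_ltn_trans ki ij)) (leqnn _); lia.
split=> // i ki; have := H2 i ltac:(lia).
by rewrite !pE ?mz; lia.
Qed.

End TightTop.

(** * Strings and vacancy numbers of rigged configurations *)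

Section MsetSums.
Variables (K : choiceType) (V : nmodType).
Implicit Types (A B : {mset K}) (F : K -> V).

Lemma sum_msetD A B F :
  \sum_(x <- A `+` B) F x = \sum_(x <- A) F x + \sum_(x <- B) F x.
Proof.
rewrite -big_cat; apply: perm_big; apply/allP => x _ /=.
by rewrite count_cat !count_mem_mset msetE2.
Qed.

Lemma sum_seq_mset (s : seq K) F : \sum_(x <- seq_mset s) F x = \sum_(x <- s) F x.
Proof. exact/perm_big/perm_eq_seq_mset. Qed.

Lemma sum_mset1 x F : \sum_(y <- [mset x]) F y = F x.
Proof. by rewrite big_msetn. Qed.

End MsetSums.

Lemma seq_mset_cat (K : choiceType) (s t : seq K) :
  seq_mset (s ++ t) = seq_mset s `+` seq_mset t.
Proof. by apply/msetP => x; rewrite msetE2 !mset_seqE count_cat. Qed.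

Lemma mem_seq_mset (K : choiceType) (s : seq K) x : (x \in seq_mset s) = (x \in s).
Proof. by rewrite in_mset mset_seqE -has_count has_pred1. Qed.

Lemma in_mset1E (K : choiceType) (a b : K) : (a \in [mset b]) = (a == b).
Proof. exact: in_mset1. Qed.

Lemma msetDI (K : choiceType) (A B C : {mset K}) : A `+` C = B `+` C -> A = B.
Proof. by move=> e; rewrite -(msetDKBC C A) e msetDKBC. Qed.

Lemma map_msetD (K K' : choiceType) (f : K -> K') (A B : {mset K}) :
  seq_mset [seq f x | x <- A `+` B] = seq_mset [seq f x | x <- A] `+` seq_mset [seq f x | x <- B].
Proof.
rewrite -seq_mset_cat -map_cat; apply/eq_seq_msetP/perm_map/allP => x _ /=.
by rewrite count_cat !count_mem_mset msetE2.
Qed.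

Lemma map_mset1 (K K' : choiceType) (f : K -> K') (x : K) :
  seq_mset [seq f y | y <- [mset x]] = [mset f x].
Proof. by rewrite enum_msetn; apply/msetP => y; rewrite mset_seqE msetnE /= addn0 eq_sym; case: eqP. Qed.

Lemma map_mset0 (K K' : choiceType) (f : K -> K') :
  seq_mset [seq f y | y <- mset0] = mset0.
Proof. by rewrite enum_mset0; apply/msetP => y; rewrite mset_seqE mset0E. Qed.

Notation strs := {mset nat * int}.

(** The number of boxes in the first [i] columns. *)
Definition qsum (S : strs) (i : nat) : int := \sum_(t <- S) (minn i t.1)%:Z.
Definition cnt (S : strs) (i : nat) : nat := (\sum_(t <- S) (t.1 == i))%N.

Lemma qsumD S T i : qsum (S `+` T) i = qsum S i + qsum T i.
Proof. exact: sum_msetD. Qed.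

Lemma cntD S T i : cnt (S `+` T) i = (cnt S i + cnt T i)%N.
Proof. by rewrite /cnt sum_msetD. Qed.

Lemma qsum1 t i : qsum [mset t] i = (minn i t.1)%:Z.
Proof. exact: sum_mset1. Qed.

Lemma cnt1 t i : cnt [mset t] i = (t.1 == i).
Proof. exact: sum_mset1. Qed.

Lemma qsum_str t i : qsum (mset_string t) i = (minn i t.1)%:Z.
Proof.
rewrite /mset_string; case: eqP => [->|_]; last exact: qsum1.
by rewrite /qsum big_mset0 minn0.
Qed.

Lemma cnt_str t i : (0 < i)%N -> cnt (mset_string t) i = (t.1 == i).
Proof.
move=> i0; rewrite /mset_string; case: eqP => [->|_]; last exact: cnt1.
by rewrite /cnt big_mset0 eq_sym eqn0Ngt i0.
Qed.

Lemma in_mset_string t u : (u \in mset_string t) = (t.1 != 0%N) && (u == t).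
Proof.
by rewrite /mset_string; case: eqP => _ /=; rewrite ?in_mset1E // in_mset mset0E.
Qed.

Lemma cnt_gt0 S i : (0 < cnt S i)%N = has (fun t => t.1 == i) S.
Proof. by rewrite /cnt -big_mkcond -[has _ _]/(has _ (S : seq _)) sum1_count has_count. Qed.

Lemma cnt_gt0P S i : (0 < cnt S i)%N -> exists x, (i, x) \in S.
Proof. by rewrite cnt_gt0 => /hasP[[j x] jS /= /eqP <-]; exists x. Qed.

Lemma mem_cnt_gt0 S i x : (i, x) \in S -> (0 < cnt S i)%N.
Proof. by move=> h; rewrite cnt_gt0; apply/hasP; exists (i, x) => /=. Qed.

Lemma cnt_eq0 S i x : cnt S i = 0%N -> (i, x) \notin S.
Proof. by move=> h; apply/negP => /mem_cnt_gt0; rewrite h. Qed.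

Lemma min_second_diff i j : (0 < i)%N ->
  (minn i j)%:Z *+ 2 = (minn i.-1 j)%:Z + (minn i.+1 j)%:Z + (j == i)%:Z.
Proof. lia. Qed.

Lemma qsum_second_diff S i : (0 < i)%N ->
  qsum S i *+ 2 = qsum S i.-1 + qsum S i.+1 + (cnt S i)%:Z.
Proof.
move=> i0; rewrite /qsum /cnt -sumrMnl -big_split /= -[(\sum_(t <- _) _)%N%:Z]natz natr_sum.
by rewrite -big_split /=; apply: eq_bigr => t _; rewrite min_second_diff // natz.
Qed.

Lemma qsum0 S : qsum S 0 = 0.
Proof. by rewrite /qsum big1 // => t _; rewrite min0n. Qed.

Lemma qsum_mset0 i : qsum mset0 i = 0.
Proof. by rewrite /qsum big_mset0. Qed.

Definition boxes (S : strs) : int := \sum_(t <- S) (t.1)%:Z.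

Lemma qsum_large S N : (forall t, t \in S -> (t.1 <= N)%N) ->
  qsum S N = boxes S.
Proof.
by move=> h; apply: eq_big_seq => t tS; rewrite (minn_idPr (h t tS)).
Qed.

(** Adding a box to a string of length [k] changes the vacancy numbers of a component by a constant
    at all lengths above [k] and nowhere else, so keeping colabels fixed is a [shift]. *)
Definition shift (c : int) (k : nat) (S : strs) : strs :=
  seq_mset [seq (t.1, t.2 + c * (k < t.1)%N%:Z) | t <- S].

Lemma shiftD c k S T : shift c k (S `+` T) = shift c k S `+` shift c k T.
Proof. exact: map_msetD. Qed.

Lemma shift1 c k t : shift c k [mset t] = [mset (t.1, t.2 + c * (k < t.1)%N%:Z)].
Proof. exact: map_mset1. Qed.

Lemma shift_mset0 c k : shift c k mset0 = mset0.
Proof. exact: map_mset0. Qed.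

Lemma shift_str c k t : shift c k (mset_string t) = mset_string (t.1, t.2 + c * (k < t.1)%N%:Z).
Proof. by rewrite /mset_string /=; case: eqP => _; [exact: shift_mset0 | exact: shift1]. Qed.

Lemma qsum_shift c k S i : qsum (shift c k S) i = qsum S i.
Proof. by rewrite /qsum sum_seq_mset big_map. Qed.

Lemma mem_shift c k S i x : ((i, x) \in shift c k S) = ((i, x - c * (k < i)%N%:Z) \in S).
Proof.
rewrite mem_seq_mset; apply/mapP/idP => [[[j y] jS [-> ->]]|h]; first by rewrite addrK.
by exists (i, x - c * (k < i)%N%:Z) => //=; rewrite subrK.
Qed.

Lemma shift_congr c k k' S :
  (forall t, t \in S -> (k < t.1)%N = (k' < t.1)%N) -> shift c k S = shift c k' S.
Proof.
by move=> h; rewrite /shift; congr seq_mset; apply/eq_in_map => t /h ->.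
Qed.

Lemma shift0 k S : shift 0 k S = S.
Proof.
rewrite /shift -[RHS]seq_mset_id; congr seq_mset; rewrite -[RHS]map_id.
by apply: eq_map => -[i x] /=; rewrite mul0r addr0.
Qed.

Definition supported (n : nat) (rc : rconf) :=
  (forall b, ~~ (1 <= b < n)%N -> strings rc b = mset0) /\
  (forall b t, t \in strings rc b -> (0 < t.1)%N).

Definition vac n L (rc : rconf) a i := vacancy n L (nu_of rc) a i.

Definition lqsum (L : {mset nat * nat}) a i : int := \sum_(x <- L | x.1 == a) (minn i x.2)%:Z.
Definition lcnt (L : {mset nat * nat}) a i : nat := (\sum_(x <- L | x.1 == a) (x.2 == i))%N.

Lemma lqsum_second_diff L a i : (0 < i)%N ->
  lqsum L a i *+ 2 = lqsum L a i.-1 + lqsum L a i.+1 + (lcnt L a i)%:Z.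
Proof.
move=> i0; rewrite /lqsum /lcnt -sumrMnl -big_split /= -[(\sum_(t <- _ | _) _)%N%:Z]natz natr_sum.
by rewrite -big_split /=; apply: eq_bigr => t _; rewrite min_second_diff // natz.
Qed.

Lemma eq_vacancy n L nu nu' a i : (forall b, (1 <= b < n)%N -> nu b = nu' b) ->
  vacancy n L nu a i = vacancy n L nu' a i.
Proof. by move=> e; congr (_ - _); apply: eq_big_nat => b /e ->. Qed.

Lemma cartanE a b : (0 < a)%N ->
  cartan a b = (b == a)%:Z *+ 2 - (b == a.-1)%:Z - (b == a.+1)%:Z.
Proof. by rewrite /cartan => a0; do ![case: eqP => ? /=]; lia. Qed.

Lemma sum_pick n c (Q : nat -> int) : Q 0%N = 0 -> (forall b, (n <= b)%N -> Q b = 0) ->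
  \sum_(1 <= b < n) (b == c)%:Z * Q b = Q c.
Proof.
move=> Q0 Qn; rewrite (eq_bigr (fun b => if b == c then Q b else 0)); last first.
  by move=> b _; case: eqP; rewrite ?mul1r ?mul0r.
rewrite -big_mkcond big_nat1_eq; case: ifP => // h.
by have [nc|cn] := leqP n c; [rewrite Qn | have -> : c = 0%N by lia].
Qed.

(** As [Q] vanishes at 0 and from [n] on, the boundary rows of the Cartan matrix obey the same
    formula as the inner ones. *)
Lemma sum_cartan n a (Q : nat -> int) : (0 < a)%N -> Q 0%N = 0 ->
  (forall b, (n <= b)%N -> Q b = 0) ->
  \sum_(1 <= b < n) cartan a b * Q b = Q a *+ 2 - Q a.-1 - Q a.+1.
Proof.
move=> a0 Q0 Qn; rewrite -{1}(@sum_pick n a Q) // -(@sum_pick n a.-1 Q) // -(@sum_pick n a.+1 Q) //.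
rewrite -sumrMnl -!sumrB; apply: eq_bigr => b _.
by rewrite cartanE //; ring.
Qed.

Lemma vacancyE n L (S : nat -> strs) a i :
  (forall b, ~~ (1 <= b < n)%N -> S b = mset0) -> (1 <= a < n)%N ->
  vacancy n L (fun b => lengths (S b)) a i =
    lqsum L a i - qsum (S a) i *+ 2 + qsum (S a.-1) i + qsum (S a.+1) i.
Proof.
move=> sup an; rewrite /vacancy -/(lqsum L a i).
rewrite (eq_bigr (fun b => cartan a b * qsum (S b) i)); last first.
  by move=> b _; rewrite /qsum mulr_sumr /lengths sum_seq_mset big_map.
rewrite (@sum_cartan n a (fun b => qsum (S b) i)); try lia.
- by rewrite sup ?qsum_mset0.
- by move=> b nb; rewrite sup ?qsum_mset0 //; lia.
Qed.

Lemma vacE n L rc a i : supported n rc -> (1 <= a < n)%N ->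
  vac n L rc a i = lqsum L a i - qsum (strings rc a) i *+ 2
    + qsum (strings rc a.-1) i + qsum (strings rc a.+1) i.
Proof. by case=> sup _; apply: vacancyE. Qed.

(** From such an [N] on all vacancy numbers are constant, so [vac n L rc a N] stands for their
    limit. *)
Definition bounded (L : {mset nat * nat}) (rc : rconf) (N : nat) :=
  (forall x, x \in L -> (x.2 <= N)%N) /\
  (forall b t, t \in strings rc b -> (t.1 <= N)%N).

Lemma bounded_le L rc N M : (N <= M)%N -> bounded L rc N -> bounded L rc M.
Proof. by move=> NM [h1 h2]; split=> *; apply: leq_trans NM; [apply: h1 | apply: h2; eassumption]. Qed.

Lemma supported_bounded n L rc : supported n rc -> exists N, bounded L rc N.
Proof.
move=> [sup _].
exists (\max_(x <- L) x.2 + \max_(b < n) \max_(t <- strings rc b) t.1)%N; split.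
  by move=> x xL; apply: leq_trans (leq_addr _ _); apply: (leq_bigmax_seq (F := fun x => x.2)).
move=> b t tb; apply: leq_trans (leq_addl _ _).
have [bn|nb] := ltnP b n.
  apply: leq_trans (leq_bigmax (Ordinal bn)).
  by apply: (leq_bigmax_seq (F := fun t => t.1)).
by move: tb; rewrite sup ?in_mset ?mset0E //; lia.
Qed.

Definition gsum L (rc : rconf) a i : nat :=
  (lcnt L a i + cnt (strings rc a.-1) i + cnt (strings rc a.+1) i)%N.

Lemma vac_shape_rc n L rc a N : supported n rc -> (1 <= a < n)%N -> bounded L rc N ->
  vac_shape (vac n L rc a) (cnt (strings rc a)) (gsum L rc a) N (vac n L rc a N).
Proof.
move=> sup an [bL bS]; split.
- rewrite vacE // !qsum0 /lqsum big1 ?mul0rn ?subr0 ?addr0 // => x _.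
  by rewrite min0n.
- move=> i i0; rewrite !vacE // /gsum.
  have := lqsum_second_diff L a i0.
  have := qsum_second_diff (strings rc a) i0.
  have := qsum_second_diff (strings rc a.-1) i0.
  by have := qsum_second_diff (strings rc a.+1) i0; rewrite !mulr2n; lia.
- move=> i Ni; rewrite !vacE //.
  have qE b : qsum (strings rc b) i = qsum (strings rc b) N.
    by rewrite !qsum_large // => t /bS h; apply: leq_trans h _.
  rewrite !qE; congr (_ - _ + _ + _); rewrite /lqsum big_seq_cond [RHS]big_seq_cond.
  apply: eq_bigr => x /andP[/bL]; lia.
- move=> i Ni; apply/eqP; rewrite -leqn0 leqNgt; apply/negP => /cnt_gt0P[x /bS /=]; lia.
Qed.

(** * The lowering operator *)

(* rc1 is obtained from rc by lowering the string (k, s) of rc^(a), validity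
   aside.  When no rigging is nonpositive, the new string (1, -1) is a lowered
   virtual string (0, 0). *)
Record lowering (n a k : nat) (s : int) (rc rc1 : rconf) : Prop := {
  lowering_sup : supported n rc;
  lowering_sup1 : supported n rc1;
  lowering_at : exists O, [/\ strings rc a = O `+` mset_string (k, s),
          strings rc1 a = shift (-2) k O `+` [mset (k.+1, s - 1)]
        & forall i x, (i, x) \in O -> s <= x /\ (x = s -> (i <= k)%N)];
  lowering_off : forall b, b != a -> strings rc1 b = shift (- cartan a b) k (strings rc b);
  lowering_le0 : s <= 0;
  lowering_virtual : k = 0%N -> s = 0 }.

Definition upper n L rc :=
  forall b i x, (i, x) \in strings rc b -> x <= vac n L rc b i.

Section LoweringFacts.
Variables (n : nat) (L : {mset nat * nat}) (a k : nat) (s : int) (rc rc1 : rconf).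
Hypotheses (F : lowering n a k s rc rc1) (an : (1 <= a < n)%N).

Lemma lowering_vac b i : (1 <= b < n)%N ->
  vac n L rc1 b i = vac n L rc b i - cartan a b * (k < i)%N%:Z.
Proof.
move=> bn; rewrite (vacE L i (lowering_sup F) bn) (vacE L i (lowering_sup1 F) bn).
have q1 c : qsum (strings rc1 c) i = qsum (strings rc c) i + (c == a)%:Z * (k < i)%N%:Z.
  case: (eqVneq c a) => [->|ne]; last by rewrite (lowering_off F) // qsum_shift mul0r addr0.
  have [O [-> -> _]] := lowering_at F.
  by rewrite !qsumD qsum_shift qsum_str qsum1 /=; lia.
rewrite !q1 cartanE; last by lia.
have -> : (b.-1 == a) = (b == a.+1) by lia.
have -> : (b.+1 == a) = (b == a.-1) by lia.
ring.
Qed.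

Lemma lowering_min i x : (i, x) \in strings rc a -> s <= x /\ (x = s -> (i <= k)%N).
Proof.
have [O [-> _ lo]] := lowering_at F; rewrite in_msetD in_mset_string => /orP[/lo//|].
by case/andP=> _ /eqP[-> ->].
Qed.

Hypothesis U : upper n L rc.

Lemma lowering_vac_ge : s <= vac n L rc a k.
Proof.
have [k0|k0] := posnP k.
  have [N bN] := supported_bounded L (lowering_sup F).
  by have [] := vac_shape_rc (lowering_sup F) an bN; rewrite k0 (lowering_virtual F k0) => ->.
apply: U; have [O [-> _ _]] := lowering_at F.
by rewrite in_msetD in_mset_string eqxx -lt0n k0 orbT.
Qed.

Lemma lowering_vac_gt i : (k < i)%N -> (0 < cnt (strings rc a) i)%N -> s < vac n L rc a i.
Proof.
move=> ki /cnt_gt0P[x ix]; have [lo hi] := lowering_min ix.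
apply: lt_le_trans (U ix); rewrite lt_neqAle lo andbT; apply/eqP => e.
by move: (hi (esym e)); lia.
Qed.

Variable N : nat.
Hypothesis bN : bounded L rc N.

Lemma lowering_next_vac : s < vac n L rc a N -> s < vac n L rc a k.+1.
Proof.
exact: (next_vac_ge (vac_shape_rc (lowering_sup F) an bN) lowering_vac_ge lowering_vac_gt).
Qed.

Lemma lowering_upper : s < vac n L rc a N -> upper n L rc1.
Proof.
move=> sN b i x ix.
have bn : (1 <= b < n)%N.
  by apply/idPn => /(proj1 (lowering_sup1 F)) e; rewrite e in_mset mset0E in ix.
rewrite lowering_vac //.
have [e|ne] := eqVneq b a; last by move: ix; rewrite (lowering_off F) // mem_shift => /U; lia.
subst b; move: ix; have [O [e -> _]] := lowering_at F.
rewrite in_msetD mem_shift in_mset1E => /orP[ix|/eqP[-> ->]].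
  have /U : (i, x - -2 * (k < i)%N%:Z) \in strings rc a by rewrite e in_msetD ix.
  by rewrite /cartan eqxx; lia.
by have := lowering_next_vac sN; rewrite ltnSn /cartan eqxx; lia.
Qed.

Lemma lowering_upper_lt : upper n L rc1 -> s < vac n L rc a N.
Proof.
move=> U1; rewrite ltNge; apply/negP => le.
have [_ pE _] := tight_top (vac_shape_rc (lowering_sup F) an bN) lowering_vac_ge lowering_vac_gt le.
have /U1 : (k.+1, s - 1) \in strings rc1 a.
  by have [O [_ -> _]] := lowering_at F; rewrite in_msetD in_mset1E eqxx orbT.
by rewrite lowering_vac // pE // ltnSn /cartan eqxx; lia.
Qed.

End LoweringFacts.

Lemma sorted_head_min (T : eqType) (r : rel T) (s : seq T) x0 x : total r -> transitive r ->
  ohead (sort r s) = Some x0 -> x \in s -> r x0 x.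
Proof.
move=> tot tr; have so := sort_sorted tot s; rewrite -(mem_sort r).
case: (sort r s) so => //= y t so [<-]; rewrite inE => /predU1P[->|xt].
  by have := tot y y; rewrite orbb.
by move/(order_path_min tr)/allP: so => /(_ x xt).
Qed.

Lemma ohead_sort_mem (T : eqType) (r : rel T) (s : seq T) x : ohead (sort r s) = Some x -> x \in s.
Proof. by rewrite -(mem_sort r); case: (sort r s) => //= y t [->]; rewrite inE eqxx. Qed.

Lemma ohead_sort_None (T : eqType) (r : rel T) (s : seq T) : ohead (sort r s) = None -> s = [::].
Proof. by move=> h; apply/eqP; rewrite -size_eq0 -(size_sort r); case: (sort r s) h. Qed.

Lemma f_string_Some S k s : f_string S = Some (k, s) ->
  [/\ (k, s) \in S, s <= 0 & forall i x, (i, x) \in S -> s <= x /\ (x = s -> (i <= k)%N)].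
Proof.
rewrite /f_string; set r := (fun _ _ => _) => h.
have := ohead_sort_mem h; rewrite mem_filter /= => /andP[s0 ksS]; split=> // i x ixS.
have [x0|x0] := lerP x 0; last by split; lia.
have tot : total r by move=> [i1 x1] [i2 x2]; rewrite /r /=; lia.
have tr : transitive r by move=> [i1 x1] [i2 x2] [i3 x3]; rewrite /r /=; lia.
have := @sorted_head_min _ r _ _ (i, x) tot tr h; rewrite mem_filter /= x0 => /(_ ixS).
by rewrite /r /=; lia.
Qed.

Lemma f_string_None S : f_string S = None -> forall i x, (i, x) \in S -> 0 < x.
Proof.
rewrite /f_string => /ohead_sort_None h i x ixS; rewrite ltNge; apply/negP => x0.
have : (i, x) \in [seq s <- S | s.2 <= 0] by rewrite mem_filter x0.
by rewrite h.
Qed.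

Definition rc_lower n L a rc : rconf :=
  if f_string (strings rc a) is Some (k, x)
  then replace_strings n L a [mset (k, x)] [mset (k.+1, x - 1)] rc
  else replace_strings n L a mset0 [mset (1%N, -1)] rc.

Lemma rc_fE n L a rc : rc_f n L a rc = if rc_lower n L a rc \in all_RC n L then Some (rc_lower n L a rc) else None.
Proof. by []. Qed.

Lemma in_I_set n b : (b \in I_set n) = (1 <= b < n)%N.
Proof. by rewrite inE /= mem_iota; lia. Qed.

(** The relabelling involves only differences of vacancy numbers, in which the contributions of [L]
    and of all kept strings cancel. *)
Lemma replace_stringsE n L a old new O rc b : supported n rc -> (1 <= a < n)%N ->
  strings rc a = O `+` old ->
  strings (replace_strings n L a old new rc) b =
    if ~~ (1 <= b < n)%N then mset0 else
    let c i := cartan b a * (qsum old i - qsum new i) in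
    let rel (S : strs) := seq_mset [seq (t.1, t.2 + c t.1) | t <- S] in
    if b == a then rel O `+` new else rel (strings rc b).
Proof.
move=> sup an e; rewrite /replace_strings /strings fsfunE in_I_set -/(strings rc).
case: ifP => //= bn.
pose S b := (if b == a then strings rc b `\` old else strings rc b) `+` (if b == a then new else mset0).
have supS c : ~~ (1 <= c < n)%N -> S c = mset0.
  by move=> cn; rewrite /S; have -> : (c == a) = false by [lia]; rewrite (proj1 sup) // msetD0.
have kE : strings rc a `\` old = O by rewrite e msetDKBC.
have SE c i : qsum (S c) i = qsum (strings rc c) i - (c == a)%:Z * (qsum old i - qsum new i).
  rewrite /S; case: eqP => [->|_]; last by rewrite msetD0 mul0r subr0.
  by rewrite mul1r kE e !qsumD; ring.
have vE i : vacancy n L (fun c => lengths (S c)) b i - vacancy n L (nu_of rc) b i = cartan b a * (qsum old i - qsum new i).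
  rewrite vacancyE // -/(vac n L rc b i) vacE // !SE cartanE; last by lia.
  have -> : (b.-1 == a) = (a == b.-1) by lia.
  have -> : (b == a) = (a == b) by lia.
  have -> : (b.+1 == a) = (a == b.+1) by lia.
  ring.
rewrite -/(S _).
have relE (T : strs) : seq_mset [seq (s.1, s.2 - vacancy n L (nu_of rc) b s.1 + vacancy n L (fun c => lengths (S c)) b s.1) | s <- T] =
   seq_mset [seq (t.1, t.2 + cartan b a * (qsum old t.1 - qsum new t.1)) | t <- T].
  by congr seq_mset; apply: eq_map => t; rewrite -vE; congr pair; ring.
rewrite -/(strings rc _) relE; case: eqP => [->|_]; first by rewrite kE.
by rewrite msetD0.
Qed.

Lemma cartan_sym a b : cartan a b = cartan b a.
Proof. by rewrite /cartan eq_sym orbC. Qed.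

Lemma rc_lowerP n L a rc : supported n rc -> (1 <= a < n)%N ->
  exists k s, lowering n a k s rc (rc_lower n L a rc).
Proof.
move=> sup an.
have [k [s [O [eO eF lo s0 k0]]]] : exists k s O,
   [/\ strings rc a = O `+` mset_string (k, s),
       rc_lower n L a rc = replace_strings n L a (mset_string (k, s)) [mset (k.+1, s - 1)] rc,
       forall i x, (i, x) \in O -> s <= x /\ (x = s -> (i <= k)%N), s <= 0 & k = 0%N -> s = 0].
  rewrite /rc_lower; case E : (f_string (strings rc a)) => [[k s]|].
    have [ks s0 lo] := f_string_Some E; exists k, s, (strings rc a `\ (k, s)).
    have kn0 : (0 < k)%N by have := proj2 sup _ _ ks.
    have -> : mset_string (k, s) = [mset (k, s)] by rewrite /mset_string /= eqn0Ngt kn0.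
    split=> //; [by rewrite msetDC msetB1K | | by lia].
    by move=> i x ix; apply: lo; move: ix; rewrite in_msetB [_ \in strings _ _]in_mset; apply: leq_ltn_trans.
  exists 0%N, 0, (strings rc a); split=> //; first by rewrite msetD0.
  by move=> i x /(f_string_None E); lia.
exists k, s; rewrite eF; set rc1 := replace_strings _ _ _ _ _ _.
have rE b : strings rc1 b = _ := @replace_stringsE n L a _ [mset (k.+1, s - 1)] O rc b sup an eO.
have shE b (T : strs) : seq_mset [seq (t.1, t.2 + cartan b a * (qsum (mset_string (k, s)) t.1 - qsum [mset (k.+1, s - 1)] t.1)) | t <- T]
     = shift (- cartan a b) k T.
  rewrite /shift; congr seq_mset; apply: eq_map => t; rewrite qsum_str qsum1 /= cartan_sym.
  congr pair; have -> : (minn t.1 k)%:Z - (minn t.1 k.+1)%:Z = - (k < t.1)%N%:Z by lia.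
  by rewrite mulrN mulNr.
have r1 b : b != a -> strings rc1 b = shift (- cartan a b) k (strings rc b).
  move=> ba; rewrite rE; case: ifP => bn; last by rewrite /= (negPf ba) shE.
  by rewrite (proj1 sup) // shift_mset0.
have ra : strings rc1 a = shift (-2) k O `+` [mset (k.+1, s - 1)].
  by rewrite rE an eqxx /= shE /cartan eqxx.
split=> //; last by exists O.
split; first by move=> b bn; rewrite rE bn.
move=> b [i x]; have [->|ba] := eqVneq b a; last first.
  by rewrite r1 // mem_shift; apply: (proj2 sup).
rewrite ra in_msetD mem_shift in_mset1E => /orP[ix|/eqP[->//]].
by apply: (proj2 sup a (i, x - -2 * (k < i)%N%:Z)); rewrite eO in_msetD ix.
Qed.

(** The lowered string characterised by minimality rather than by sorting. By [fstring_uniq],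
    exhibiting a candidate suffices to identify it after delta or lb. *)
Definition fstring S (k : nat) (s : int) :=
  [/\ exists O, S = O `+` mset_string (k, s),
      forall i x, (i, x) \in S -> s <= x /\ (x = s -> (i <= k)%N),
      s <= 0 & k = 0%N -> s = 0].

Lemma lowering_fstring n a k s rc rc1 : lowering n a k s rc rc1 -> fstring (strings rc a) k s.
Proof.
move=> F; split; [|exact: lowering_min F|exact: lowering_le0 F|exact: lowering_virtual F].
by have [O [e _ _]] := lowering_at F; exists O.
Qed.

Lemma fstring_uniq S k s k' s' : fstring S k s -> fstring S k' s' -> k = k' /\ s = s'.
Proof.
have sle k1 s1 k2 s2 : fstring S k1 s1 -> fstring S k2 s2 -> s1 <= s2 /\ (s1 = s2 -> (k2 <= k1)%N).
  move=> [_ lo s0 _] [[O e] _ _ z2].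
  have [k0|k0] := posnP k2; first by rewrite (z2 k0) k0.
  have : (k2, s2) \in S by rewrite e in_msetD in_mset_string eqxx -lt0n k0 orbT.
  by move=> /lo [h1 h2]; split=> // es; apply: h2.
move=> F F'; have [h1 h2] := sle _ _ _ _ F F'; have [h3 h4] := sle _ _ _ _ F' F.
have es : s = s' by lia.
by split=> //; have := h2 es; have := h4 (esym es); lia.
Qed.

Lemma lowering_atE n a k s rc rc1 O : lowering n a k s rc rc1 -> strings rc a = O `+` mset_string (k, s) ->
  strings rc1 a = shift (-2) k O `+` [mset (k.+1, s - 1)].
Proof. by move=> F; have [O' [-> -> _]] := lowering_at F => /msetDI ->. Qed.

(** * The map delta *)

Definition removed n (L L' : {mset nat * nat}) (lm lb : nat) (rc rc' : rconf) b :=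
  exists O, [/\ strings rc b = O `+` [mset (lb, vac n L rc b lb)],
     strings rc' b = O `+` mset_string (lb.-1, vac n L' rc' b lb.-1)
   & forall i y, (i, y) \in O -> (lm <= i < lb)%N -> y <> vac n L rc b i].

(* rc' is the image of rc under delta, with rank x and selected lengths l b. *)
Record removal n (L L' : {mset nat * nat}) (x : nat) (l : nat -> nat) (rc rc' : rconf) : Prop := {
  removal_L : L = [mset (1, 1)%N] `+` L';
  removal_rank : (1 <= x <= n)%N;
  removal_sup : supported n rc;
  removal_sup' : supported n rc';
  removal_l0 : l 0%N = 1%N;
  removal_le : forall b, (1 <= b < x)%N -> (l b.-1 <= l b)%N;
  removal_lt : forall b, (1 <= b < x)%N -> removed n L L' (l b.-1) (l b) rc rc' b;
  removal_stop : (x < n)%N -> forall i y, (i, y) \in strings rc x -> (l x.-1 <= i)%N -> y <> vac n L rc x i;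
  removal_ge : forall b, (x <= b)%N -> strings rc' b = strings rc b }.

Section RemovalFacts.
Variables (n : nat) (L L' : {mset nat * nat}) (x : nat) (l : nat -> nat) (rc rc' : rconf).
Hypothesis D : removal n L L' x l rc rc'.

(** Whether the box removed from component [b] lies in its first [i] columns. Since [l 0 = 1], the
    case [b = 0] accounts for the factor removed from [L]. *)
Definition hsel b i := (b < x)%N && (l b <= i)%N.

Lemma l_mono b c : (b <= c < x)%N -> (l b <= l c)%N.
Proof.
case/andP; elim: c => [|c IH] bc cx; first by have -> : b = 0%N by lia.
have [->//|ne] := eqVneq b c.+1.
by have := IH ltac:(lia) ltac:(lia); have /= := removal_le D (b:=c.+1) ltac:(lia); lia.
Qed.

Lemma l_gt0 b : (b < x)%N -> (0 < l b)%N.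
Proof. by move=> bx; rewrite -(removal_l0 D); apply: l_mono. Qed.

Lemma removal_qsum b i : (0 < b)%N -> qsum (strings rc b) i = qsum (strings rc' b) i + (hsel b i)%:Z.
Proof.
move=> b0; rewrite /hsel; have [bx|xb] := ltnP b x; last by rewrite (removal_ge D) // addr0.
have [O [-> -> _]] := removal_lt D (b:=b) ltac:(lia); have := l_gt0 bx.
by rewrite !qsumD qsum1 qsum_str /=; lia.
Qed.

Lemma removal_lqsum b i : (0 < b)%N -> lqsum L b i = lqsum L' b i + ((b == 1%N) && (0 < i)%N)%:Z.
Proof.
move=> b0; rewrite /lqsum (removal_L D) big_mkcond sum_msetD sum_mset1 /= -big_mkcond eq_sym addrC.
by congr (_ + _); case: eqP => //= _; lia.
Qed.

Lemma removal_vac b i : (1 <= b < n)%N ->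
  vac n L' rc' b i = vac n L rc b i + (hsel b i)%:Z *+ 2 - (hsel b.-1 i)%:Z - (hsel b.+1 i)%:Z.
Proof.
move=> bn; rewrite (vacE L' i (removal_sup' D) bn) (vacE L i (removal_sup D) bn).
rewrite removal_lqsum ?(removal_qsum (b:=b)) ?(removal_qsum (b:=b.+1)) //; try lia.
case: b bn => [|[|b]] //= bn; last by rewrite (removal_qsum (b:=b.+1)) //; lia.
have -> : hsel 0 i = (0 < i)%N.
  by rewrite /hsel (removal_l0 D); have := removal_rank D; lia.
by rewrite (proj1 (removal_sup D) 0%N) // (proj1 (removal_sup' D) 0%N) // qsum_mset0; lia.
Qed.

Lemma removal_mem b : (1 <= b < x)%N -> (l b, vac n L rc b (l b)) \in strings rc b.
Proof.
by move=> /(removal_lt D) [O [-> _ _]]; rewrite in_msetD in_mset1E eqxx orbT.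
Qed.

Lemma removal_mem' b : (1 <= b < x)%N -> (1 < l b)%N ->
  ((l b).-1, vac n L' rc' b (l b).-1) \in strings rc' b.
Proof.
move=> /(removal_lt D) [O [_ -> _]] lb; rewrite in_msetD in_mset_string eqxx /= orbC.
by case: (l b) lb => [|[]].
Qed.

Hypothesis U : upper n L rc.

(* Strings that are longer than the shortened one, but short enough to feel
   its removal alone, are nonsingular after the removal. *)
Lemma removal_nonsing b i y : (1 <= b < x)%N -> (i, y) \in strings rc' b -> (l b <= i)%N ->
  ((b.+1 < x)%N -> (i < l b.+1)%N) -> y < vac n L' rc' b i.
Proof.
move=> bx iy li il; have xn := removal_rank D; rewrite removal_vac; last by lia.
have lb := l_mono (b:=b.-1) (c:=b) ltac:(lia).
have := l_gt0 (b:=b) ltac:(lia) => lb0.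
have [O [e e' _]] := removal_lt D bx; move: iy; rewrite e' in_msetD in_mset_string.
case/orP=> [iy|]; last by move=> /andP[_ /eqP[e1 _]]; lia.
have /U : (i, y) \in strings rc b by rewrite e in_msetD iy.
rewrite /hsel; have [bx1|bx1] := ltnP b.+1 x; first by have := il bx1; lia.
lia.
Qed.

End RemovalFacts.

(* The box removed in component b came from a string one longer than the longest
   singular string of rc'^(b) that is shorter than l b.+1, so x and rc' determine
   the lengths l b, from b = x-1 downwards. *)
Lemma removal_inj n L L' x l1 l2 rc1 rc2 rc' : removal n L L' x l1 rc1 rc' -> removal n L L' x l2 rc2 rc' ->
  upper n L rc1 -> upper n L rc2 -> rc1 = rc2.
Proof.
move=> D1 D2 U1 U2.
have le1 la lb ra rb : removal n L L' x la ra rc' -> removal n L L' x lb rb rc' -> upper n L rb ->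
    forall b, (1 <= b < x)%N -> ((b.+1 < x)%N -> la b.+1 = lb b.+1) -> (la b <= lb b)%N.
  move=> Da Db Ub b bx e; rewrite leqNgt; apply/negP => lt.
  have lb0 := l_gt0 Db (b:=b) ltac:(lia).
  have m := removal_mem' Da bx ltac:(lia).
  have := removal_nonsing Db Ub bx m ltac:(lia); rewrite ltxx => h.
  suff : false by []. apply: h => b1; rewrite -e //.
  by have := l_mono Da (b:=b) (c:=b.+1) ltac:(lia); lia.
have le j : forall b, (1 <= b < x)%N -> (x <= b + j)%N -> l1 b = l2 b.
  elim: j => [|j IH] b bx xj; first by lia.
  have e : (b.+1 < x)%N -> l1 b.+1 = l2 b.+1 by move=> h; apply: IH; lia.
  apply/eqP; rewrite eqn_leq (le1 _ _ _ _ D1 D2 U2) // (le1 _ _ _ _ D2 D1 U1) // => h.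
  by rewrite e.
have el b : (b < x)%N -> l1 b = l2 b.
  case: b => [|b] bx; first by rewrite (removal_l0 D1) (removal_l0 D2).
  by apply: (le x) => //; lia.
have hE b i : hsel x l1 b i = hsel x l2 b i.
  by rewrite /hsel; case: ltnP => //= bx; rewrite el.
have vE b i : (1 <= b < n)%N -> vac n L rc1 b i = vac n L rc2 b i.
  move=> bn; have := removal_vac D1 i bn; rewrite (removal_vac D2 i bn) !hE; lia.
have xn := removal_rank D1.
apply/fsfunP => b; rewrite -/(strings rc1 b) -/(strings rc2 b).
have [b0|b0] := posnP b.
  by rewrite (proj1 (removal_sup D1)) ?(proj1 (removal_sup D2)) // b0.
have [bx|xb] := ltnP b x; last by rewrite -(removal_ge D1) ?(removal_ge D2).
have [O1 [-> e1 _]] := removal_lt D1 (b:=b) ltac:(lia).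
have [O2 [-> e2 _]] := removal_lt D2 (b:=b) ltac:(lia).
rewrite vE; last by lia.
by rewrite el // in e1 *; rewrite e1 in e2; rewrite (msetDI e2).
Qed.

Lemma next_singular_Some n L rc b l i : next_singular n L rc b l = Some i ->
  [/\ (l <= i)%N, (i, vac n L rc b i) \in strings rc b
    & forall j y, (j, y) \in strings rc b -> (l <= j < i)%N -> y <> vac n L rc b j].
Proof.
rewrite /next_singular => h.
have sing j : singular n L rc b j -> (j, vac n L rc b j) \in strings rc b.
  rewrite /singular /riggings mem_sort => /mapP[[j' y]]; rewrite mem_filter /=.
  by case/andP => /eqP -> jy e; rewrite /vac e.
have := ohead_sort_mem h; rewrite mem_filter => /andP[/andP[li /sing iS] _]; split=> // j y jy ji e.
have jm : j \in [seq i <- nu_of rc b | (l <= i)%N && singular n L rc b i].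
  rewrite mem_filter; apply/andP; split; last first.
    by rewrite /nu_of mem_seq_mset; apply/mapP; exists (j, y).
  apply/andP; split; first by lia.
  rewrite /singular /riggings mem_sort; apply/mapP; exists (j, y) => //=.
  by rewrite mem_filter /= eqxx.
by have := sorted_head_min leq_total leq_trans h jm; lia.
Qed.

Lemma next_singular_None n L rc b l : next_singular n L rc b l = None ->
  forall j y, (j, y) \in strings rc b -> (l <= j)%N -> y <> vac n L rc b j.
Proof.
rewrite /next_singular => /ohead_sort_None h j y jy lj e.
suff : j \in [seq i <- nu_of rc b | (l <= i)%N && singular n L rc b i] by rewrite h.
rewrite mem_filter; apply/andP; split; last first.
  by rewrite /nu_of mem_seq_mset; apply/mapP; exists (j, y).
rewrite lj; rewrite /singular /riggings mem_sort; apply/mapP; exists (j, y) => //=.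
by rewrite mem_filter /= eqxx.
Qed.

Lemma boxesD (S T : strs) : boxes (S `+` T) = boxes S + boxes T.
Proof. exact: sum_msetD. Qed.

Lemma boxes1 t : boxes [mset t] = (t.1)%:Z.
Proof. exact: sum_mset1. Qed.

Lemma boxes_str t : boxes (mset_string t) = (t.1)%:Z.
Proof.
rewrite /mset_string; case: eqP => [->|_]; last exact: boxes1.
by rewrite /boxes big_mset0.
Qed.

Lemma lengthsD (S T : strs) : lengths (S `+` T) = lengths S `+` lengths T.
Proof. exact: map_msetD. Qed.

Lemma lengths_str t : lengths (mset_string t) = mset_part t.1.
Proof.
rewrite /mset_string /mset_part; case: eqP => _; [exact: map_mset0 | exact: map_mset1].
Qed.

(** Each component in which delta selects a string loses exactly one box, so the rank can be read
    off from the box counts, and these are determined by the weights. *)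
Lemma delta_removal n L L' x rc : L = [mset (1, 1)%N] `+` L' -> (1 <= x <= n)%N ->
  supported n rc -> supported n (delta n L rc) ->
  (forall b, (1 <= b < n)%N -> boxes (strings rc b) = boxes (strings (delta n L rc) b) + (b < x)%N%:Z) ->
  exists l, removal n L L' x l rc (delta n L rc).
Proof.
move=> eL xn sup sup' sz; set rc' := delta n L rc in sup' sz *.
have L'E : L `\ (1, 1)%N = L' by rewrite eL msetD1K.
have ellS b : ell n L rc b.+1 = obind (next_singular n L rc b.+1) (ell n L rc b) by [].
have mem b i : (0 < b)%N -> ell n L rc b = Some i -> (i, vac n L rc b i) \in strings rc b.
  by case: b => [//|b] _; rewrite ellS; case: (ell n L rc b) => //= j /next_singular_Some[].
have rE b : (1 <= b < n)%N -> strings rc' b =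
    if ell n L rc b is Some i
    then strings rc b `\ (i, vac n L rc b i) `+` mset_string (i.-1, vac n L' rc' b i.-1)
    else strings rc b.
  move=> bn; rewrite /rc' /delta {1}/strings fsfunE in_I_set bn; case E : (ell n L rc b) => [i|//].
  congr (_ `+` mset_string (_, _)); rewrite L'E; apply: eq_vacancy => c cn.
  rewrite /nu_of /strings fsfunE in_I_set cn -/(strings rc c).
  by case E' : (ell n L rc c) => [j|//]; rewrite lengthsD lengths_str.
have szE b i : (1 <= b < n)%N -> ell n L rc b = Some i ->
    boxes (strings rc b) = boxes (strings rc' b) + 1.
  move=> bn E; have m := mem b i ltac:(lia) E.
  rewrite rE // E -{1}(msetB1K m) !boxesD boxes1 boxes_str /=.
  by have := proj2 sup _ _ m => /= i0; lia.
have ellP b : (1 <= b < n)%N -> isSome (ell n L rc b) = (b < x)%N.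
  move=> bn; have := sz b bn; case E : (ell n L rc b) => [i|] /=.
    by rewrite (szE b i) //; lia.
  by rewrite rE // E; lia.
pose l b := odflt 0%N (ell n L rc b).
have ellE b : (b < x)%N -> ell n L rc b = Some (l b).
  case: b => [//|b] bx; have := ellP b.+1 ltac:(lia); rewrite bx /l.
  by case: (ell n L rc b.+1).
have nxt b : (1 <= b < x)%N -> next_singular n L rc b (l b.-1) = Some (l b).
  case: b => [//|b] bx; have := ellE b.+1 ltac:(lia); rewrite ellS (ellE b) //=; lia.
exists l; split=> //.
- by move=> b /nxt /next_singular_Some[].
- move=> b bx; have [_ m mn] := next_singular_Some (nxt b bx).
  exists (strings rc b `\ (l b, vac n L rc b (l b))); split.
  + by rewrite msetDC msetB1K.
  + by rewrite rE ?ellE //; lia.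
  + move=> i y iy; apply: mn; move: iy; rewrite in_msetB [_ \in strings _ _]in_mset.
    exact: leq_ltn_trans.
- move=> xn' i y; apply: next_singular_None.
  have := ellP x ltac:(lia); rewrite ltnn; case: (x) xn ellE => [//|x' xn2 ellE2].
  by rewrite ellS ellE2 //=; case: next_singular.
- move=> b xb; have [bn|nb] := ltnP b n; last first.
    by rewrite (proj1 sup) ?(proj1 sup') //; lia.
  rewrite rE; last by lia.
  by have := ellP b ltac:(lia); rewrite ltnNge xb; case: ell.
Qed.

(** * The lowering operator and delta *)

Lemma lowering_pinf n L a k s rc rc1 N : lowering n a k s rc rc1 -> (1 <= a < n)%N ->
  upper n L rc -> bounded L rc N -> s <= vac n L rc a N.
Proof.
move=> F an U bN; rewrite leNgt; apply/negP => lt.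
have sh := vac_shape_rc (lowering_sup F) an bN.
have [_ pE _] := tight_top sh (lowering_vac_ge F an U) (lowering_vac_gt F an U) (ltW lt).
have [_ _ Hinf _] := sh; have := Hinf (N + k)%N ltac:(lia); rewrite pE; last lia.
lia.
Qed.

Lemma cnt_removed n L L' lm lb rc rc' b i : removed n L L' lm lb rc rc' b -> (0 < i)%N ->
  (cnt (strings rc' b) i + (i == lb) = cnt (strings rc b) i + (i == lb.-1))%N.
Proof.
by move=> [O [-> -> _]] i0; rewrite !cntD cnt1 cnt_str //= (eq_sym lb) (eq_sym lb.-1); lia.
Qed.

Lemma shift_id c k S : (forall i y, (i, y) \in S -> c * (k < i)%N%:Z = 0) -> shift c k S = S.
Proof.
move=> h; rewrite -[RHS]seq_mset_id -[X in _ = seq_mset X]map_id /shift; congr seq_mset.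
by apply/eq_in_map => -[i y] iy /=; rewrite (h i y iy) addr0.
Qed.

Section Step.
Variables (n : nat) (L L' : {mset nat * nat}) (x : nat) (l : nat -> nat) (rc rc' rc1 rc1' : rconf).
Variables (a k k' : nat) (s s' : int) (N : nat).
Hypotheses (D : removal n L L' x l rc rc') (an : (1 <= a < n)%N).
Hypotheses (F : lowering n a k s rc rc1) (F' : lowering n a k' s' rc' rc1').
Hypotheses (U : upper n L rc) (U' : upper n L' rc').
Hypotheses (bN : bounded L rc N) (bN' : bounded L' rc' N).

(* The lowered strings before and after delta have lengths k and k', and la is the
   length selected in component a after lowering. *)
Lemma transfer la : s = s' ->
  (forall b i, (1 <= b < n)%N -> b != a -> cartan a b != 0 -> (k < i)%N != (k' < i)%N ->
     cnt (strings rc b) i = ((b < x)%N && (i == l b))) ->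
  ((a < x)%N -> (l a.-1 <= la)%N /\ removed n L L' (l a.-1) la rc1 rc1' a) ->
  ((a.+1 < x)%N -> (la <= l a.+1)%N) ->
  (forall i, (a < x)%N -> (a.+1 < n)%N -> (la <= i < l a)%N ->
     cnt (strings rc a.+1) i = ((a.+1 < x)%N && (i == l a.+1))) ->
  (a = x -> forall i y, (i, y) \in strings rc1 a -> (l a.-1 <= i)%N -> y <> vac n L rc1 a i) ->
  ((x <= a)%N -> strings rc1' a = strings rc1 a) ->
  exists l1, removal n L L' x l1 rc1 rc1'.
Proof.
move=> es nb hA hA1 hA2 hB hC; subst s'.
exists (fun b => if b == a then la else l b).
have xn := removal_rank D.
have shE b O : (1 <= b < n)%N -> b != a -> (forall i, (0 < cnt O i)%N -> (k < i)%N != (k' < i)%N -> cartan a b != 0 -> False) ->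
    shift (- cartan a b) k O = shift (- cartan a b) k' O.
  move=> bn ba h; have [->|c0] := eqVneq (cartan a b) 0; first by rewrite oppr0 !shift0.
  apply: shift_congr => -[i y] iy; have [//|ne] := eqVneq (k < i)%N (k' < i)%N.
  by case: (h i (mem_cnt_gt0 iy) ne c0).
split.
- exact: removal_L D.
- exact: removal_rank D.
- exact: lowering_sup1 F.
- exact: lowering_sup1 F'.
- by have -> : (0%N == a) = false by [lia]; exact: removal_l0 D.
- move=> b bx; case: (eqVneq b a) => [e|ne].
    by subst b; have -> : (a.-1 == a) = false by [lia]; case: hA; lia.
  case: (eqVneq b.-1 a) => [e|ne']; last exact: (removal_le D).
  by have -> : b = a.+1 by [lia]; apply: hA1; lia.
- move=> b bx; case: (eqVneq b a) => [e|ne].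
    subst b; have -> : (a.-1 == a) = false by [lia]; by case: hA => //; lia.
  have bn : (1 <= b < n)%N by lia.
  have [O [e e' ns]] := removal_lt D bx.
  (* At lengths between [k] and [k'], [nb] leaves only the selected string, which [O] omits. *)
  have cntO i : (0 < cnt O i)%N -> (k < i)%N != (k' < i)%N -> cartan a b != 0 -> False.
    move=> Oi ne2 c0; have := nb b i bn ne c0 ne2; rewrite e cntD cnt1 /=; lia.
  exists (shift (- cartan a b) k O); split.
  + by rewrite (lowering_off F) // e shiftD shift1 /= (lowering_vac L F an) // mulNr.
  + rewrite (lowering_off F') // e' shiftD shift_str /= (lowering_vac L' F' an) // mulNr; congr (_ `+` _).
    by rewrite shE.
  + move=> i y; rewrite mem_shift => iy ii.
    have [h|h] := boolP (l b.-1 <= i < l b)%N.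
      by have := ns _ _ iy h; rewrite (lowering_vac L F an) //; lia.
    (* For [b = a.+1] the search starts at [la] instead of [l a]; [hA2] deals with the additional
       lengths. *)
    move: ii h; case: (eqVneq b.-1 a) => [e2|_ ii]; last by rewrite ii.
    rewrite e2 => ii h; have eb : b = a.+1 by lia.
    subst b; have := hA2 i ltac:(lia) ltac:(lia) ltac:(lia).
    by have := mem_cnt_gt0 iy; rewrite e cntD cnt1 /=; lia.
- move=> xn' i y; have [e|ne] := eqVneq x a.
    by subst x; have -> : (a.-1 == a) = false by [lia]; apply: hB.
  rewrite (lowering_off F) // mem_shift => iy ii.
  rewrite (lowering_vac L F an); last by lia.
  have [h|h] := boolP (l x.-1 <= i)%N; first by have := removal_stop D xn' iy h; lia.
  move: ii h; case: (eqVneq x.-1 a) => [e2|_ ii]; last by rewrite ii.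
  rewrite e2 => ii h; have eb : x = a.+1 by lia.
  have := hA2 i ltac:(lia) ltac:(lia) ltac:(lia).
  by have := mem_cnt_gt0 iy; rewrite -eb ltnn /=; lia.
- move=> b xb; have [e|ne] := eqVneq b a; first by subst b; apply: hC.
  have [bn|bn] := boolP (1 <= b < n)%N; last first.
    by rewrite (proj1 (lowering_sup1 F)) // (proj1 (lowering_sup1 F')).
  rewrite (lowering_off F) // (lowering_off F') // (removal_ge D) // shE // => i ci ne2 c0.
  by have := nb b i bn ne c0 ne2; lia.
Qed.

Lemma step_lt : (x < a)%N -> s = s' /\ exists l1, removal n L L' x l1 rc1 rc1'.
Proof.
move=> xa; have eS := removal_ge D (ltnW xa).
have [ek es] := fstring_uniq (lowering_fstring F) (eq_ind _ (fun S => fstring S k' s') (lowering_fstring F') _ eS).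
(* Nothing is selected in component [a], so [la] is a dummy. *)
split=> //; apply: (@transfer 0%N es) => //; try by move=> *; lia.
by move=> _; have [O [e -> _]] := lowering_at F; rewrite (lowering_atE F' (O := O)) -?ek -?es // eS.
Qed.

Lemma step_eq_low : x = a -> s = s' /\ k = k'.
Proof.
move=> xa; have eS := removal_ge D (eq_leq xa).
by have [ek es] := fstring_uniq (lowering_fstring F) (eq_ind _ (fun S => fstring S k' s') (lowering_fstring F') _ eS).
Qed.

Let p := vac n L rc a.
Let p' := vac n L' rc' a.
Let sh : vac_shape p (cnt (strings rc a)) (gsum L rc a) N (p N) := vac_shape_rc (lowering_sup F) an bN.
Let sh' : vac_shape p' (cnt (strings rc' a)) (gsum L' rc' a) N (p' N) := vac_shape_rc (lowering_sup F') an bN'.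

Lemma step_eq_vac : x = a -> forall i, p' i = p i - (l a.-1 <= i)%N%:Z.
Proof.
move=> xa i; rewrite /p /p' (removal_vac D) // /hsel xa.
by have -> : (a.-1 < a)%N by [lia]; rewrite !ltnNge leqnn leqnSn /=; lia.
Qed.

(** The rank stays [a]: the new string can be reached only if [l a.-1 <= k.+1], and then
    [p k.+1 = p' k.+1 + 1 > s + 1], so it is not singular. *)
Lemma step_eq : x = a -> s' < p' N -> exists l1, removal n L L' x l1 rc1 rc1'.
Proof.
move=> xa sN; have eS := removal_ge D (eq_leq xa); have [es ek] := step_eq_low xa.
have nv := lowering_next_vac F' an U' bN' sN.
apply: (@transfer 0%N es) => //; try by move=> *; lia.
- move=> _ i y; have [O [e -> _]] := lowering_at F; rewrite in_msetD mem_shift in_mset1E.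
  rewrite (lowering_vac L F an) // /cartan eqxx => /orP[iy|/eqP[-> ->]] li.
    have := removal_stop D (n := n) ltac:(lia) (i := i) (y := y - -2 * (k < i)%N%:Z).
    by rewrite xa e in_msetD iy => /(_ isT li); lia.
  by have := step_eq_vac xa k.+1; rewrite /p /p' li; rewrite -ek in nv; lia.
- by move=> _; have [O [e -> _]] := lowering_at F; rewrite (lowering_atE F' (O := O)) -?ek -?es // eS.
Qed.

(* When phi vanishes on the tail, the lowering operator turns the rank a into a+1. *)
Lemma step_tight : x = a -> s' = p' N -> exists l1, removal n L L' a.+1 l1 rc1 rc'.
Proof.
move=> xa sN; have eS := removal_ge D (eq_leq xa); have [es ek] := step_eq_low xa.
have lo := lowering_vac_ge F' an U'; have hi := lowering_vac_gt F' an U'.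
rewrite -es -ek in lo hi sN.
have sN' : p' N <= s by rewrite sN.
have [mz pE gz] := tight_top sh' lo hi sN'.
have xn := removal_rank D.
have gz1 b i : (b == a.-1) || (b == a.+1) -> (k < i)%N -> cnt (strings rc' b) i = 0%N.
  by move=> hb /gz; rewrite /gsum; case/orP: hb => /eqP ->; lia.
(* The string shortened in component [a.-1] has length [(l a.-1).-1], and the flat tail of [p']
   allows no length above [k] there. *)
have lk : (l a.-1 <= k.+1)%N.
  rewrite leqNgt; apply/negP => lt.
  have [a1|a1] := eqVneq a 1%N; first by move: lt; rewrite a1 (removal_l0 D).
  have := mem_cnt_gt0 (removal_mem' D (b:=a.-1) ltac:(lia) ltac:(lia)).
  by rewrite (gz1 a.-1) ?eqxx //; lia.
have pk : p k.+1 = s + 1.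
  by have := step_eq_vac xa k.+1; rewrite pE ?lk //=; lia.
have cz b i y : b != a -> (0 < b)%N -> (i, y) \in strings rc' b -> cartan a b * (k < i)%N%:Z = 0.
  move=> ba b0 iy; case: ltnP => ki; last by rewrite mulr0.
  rewrite mulr1 cartanE ?(negPf ba); last by lia.
  have := gz1 b i; have := mem_cnt_gt0 iy.
  by case: (b == a.-1); case: (b == a.+1) => //= h1 h2; have := h2 isT ki; lia.
(* By [pk] the new string [(k.+1, s - 1)] is singular, so delta selects it and shortens it back to
   [(k, s)]. Component [a.+1] has no string longer than [k], which ends the selection there. *)
exists (fun b => if b == a then k.+1 else l b); split.
- exact: removal_L D.
- by lia.
- exact: lowering_sup1 F.
- exact: lowering_sup F'.
- by have -> : (0%N == a) = false by [lia]; exact: removal_l0 D.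
- move=> b bx; have -> : (b.-1 == a) = false by lia.
  by case: eqVneq => [->//|ne]; apply: (removal_le D); lia.
- move=> b bx; have -> : (b.-1 == a) = false by lia.
  case: eqVneq => [->|ne]; last first.
    have [O [e e' ns]] := removal_lt D (b:=b) ltac:(lia).
    have czO i y : (i, y) \in O -> cartan a b * (k < i)%N%:Z = 0.
      by move=> iy; apply: (cz b i y) => //; [lia | rewrite e' in_msetD iy].
    exists O; split=> //.
      rewrite (lowering_off F) // e shiftD shift1 /= (lowering_vac L F an) ?mulNr //; last by lia.
      by rewrite shift_id // => i y /czO; rewrite mulNr => ->; rewrite oppr0.
    move=> i y iy ii; rewrite (lowering_vac L F an) ?(czO _ _ iy) ?subr0; last by lia.
    exact: ns iy ii.
  have [O [e e1 _]] := lowering_at F; exists O; split.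
  + rewrite e1 (lowering_vac L F an) // ltnSn -/p pk shift_id; last first.
      move=> i y iy; have [ki|] := ltnP k i; last by rewrite mulr0.
      by have := mz i ki; rewrite eS e cntD; have := mem_cnt_gt0 iy; lia.
    by rewrite /cartan eqxx; congr (_ `+` [mset (_, _)]); lia.
  + by rewrite eS e /=; congr (_ `+` mset_string (_, _)); rewrite -/p' pE.
  + move=> i y iy ii; rewrite (lowering_vac L F an) //.
    have := removal_stop D (n:=n) ltac:(lia) (i:=i) (y:=y); rewrite xa e in_msetD iy.
    by move=> /(_ isT); lia.
- move=> an1 i y /=; rewrite eqxx => iy ki.
  rewrite (lowering_off F) ?mem_shift in iy; last by lia.
  have := gz1 a.+1 i; rewrite eqxx orbT (removal_ge D); last by lia.
  by have := mem_cnt_gt0 iy; lia.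
- move=> b ab; have [bn|bn] := boolP (1 <= b < n)%N; last first.
    by rewrite (proj1 (lowering_sup1 F)) // (proj1 (lowering_sup F')).
  rewrite (lowering_off F) ?(removal_ge D) ?shift_id //; try lia.
  move=> i y iy; rewrite mulNr (cz b i y) ?oppr0 //; try lia.
  by rewrite (removal_ge D) //; lia.
Qed.

End Step.

(** * Ranks above [a] *)

Section StepGt.
Variables (n : nat) (L L' : {mset nat * nat}) (x : nat) (l : nat -> nat) (rc rc' rc1 rc1' : rconf).
Variables (a k k' : nat) (s s' : int) (N : nat).
Hypotheses (D : removal n L L' x l rc rc') (an : (1 <= a < n)%N).
Hypotheses (F : lowering n a k s rc rc1) (F' : lowering n a k' s' rc' rc1').
Hypotheses (U : upper n L rc) (U' : upper n L' rc').
Hypotheses (bN : bounded L rc N) (bN' : bounded L' rc' N).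
Hypothesis ax : (a < x)%N.

Let p := vac n L rc a.
Let p' := vac n L' rc' a.
Let m := cnt (strings rc a).
Let g := gsum L rc a.
Let m' := cnt (strings rc' a).
Let g' := gsum L' rc' a.
Let sh : vac_shape p m g N (p N) := vac_shape_rc (lowering_sup F) an bN.
Let sh' : vac_shape p' m' g' N (p' N) := vac_shape_rc (lowering_sup F') an bN'.
Let lm := l a.-1.
Let la := l a.
Let lp := l a.+1.
Let hp := (a.+1 < x)%N.

Let lm_gt0 : (0 < lm)%N. Proof. by apply: (l_gt0 D); lia. Qed.
Let lml : (lm <= la)%N. Proof. by apply: (l_mono D); lia. Qed.
Let la_gt0 : (0 < la)%N. Proof. exact: leq_trans lml. Qed.
Let llp : hp -> (la <= lp)%N. Proof. by move=> h; apply: (l_mono D); rewrite /hp in h; lia. Qed.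

Let lpN : hp -> (lp <= N)%N.
Proof. by move=> h; have := proj2 bN _ _ (removal_mem D (b:=a.+1) ltac:(rewrite /hp in h; lia)). Qed.

Let glm_gt0 : (0 < g lm)%N.
Proof.
rewrite /g /gsum; have [a1|a1] := eqVneq a 1%N.
  rewrite /lcnt (removal_L D) big_mkcond sum_msetD sum_mset1 a1 /= /lm a1 (removal_l0 D); lia.
by have := mem_cnt_gt0 (removal_mem D (b:=a.-1) ltac:(lia)); rewrite -/lm; lia.
Qed.

Let pp' i : p' i = p i + (la <= i)%:Z *+ 2 - (lm <= i)%:Z - (hp && (lp <= i)%N)%:Z.
Proof.
by rewrite /p' (removal_vac D) // /hsel ax (_ : (a.-1 < x)%N) //; lia.
Qed.

Let rem : removed n L L' lm la rc rc' a. Proof. by apply: (removal_lt D); lia. Qed.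

Let mm' i : (la <= i)%N -> (m' i + (i == la))%N = m i.
Proof.
move=> li; have := cnt_removed rem (i:=i) ltac:(lia); rewrite -/m -/m'.
lia.
Qed.

Let glp : hp -> (1 < lp)%N -> (0 < g' lp.-1)%N.
Proof.
move=> h l1; have := mem_cnt_gt0 (removal_mem' D (b:=a.+1) ltac:(rewrite /hp in h; lia) l1).
by rewrite /g' /gsum -/lp; lia.
Qed.

Let sel_in : (la, p la) \in strings rc a.
Proof. by apply: (removal_mem D); lia. Qed.

Let nons i y : (i, y) \in strings rc a -> (lm <= i < la)%N -> y < p i.
Proof.
move=> iy ii; have [O [e _ ns]] := rem; move: (iy); rewrite e in_msetD in_mset1E => /orP[iyO|].
  by rewrite lt_neqAle (U iy) andbT; apply/eqP; exact: ns iyO ii.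
by move=> /eqP[e1 _]; lia.
Qed.

Let before : s <= p' la.-1.
Proof.
have : s + (lm < la)%N%:Z <= p la.-1.
  apply: (vac_before_selected sh lm_gt0 lml (fun _ => glm_gt0) (lowering_le0 F)).
    by have [h _] := lowering_min F sel_in.
  move=> i il mi; have [y iy] := cnt_gt0P mi; have [h _] := lowering_min F iy.
  have := nons iy; have := U iy; rewrite -/(p i); have [lmi|lmi] := leqP lm i; last by lia.
  by move=> _ /(_ ltac:(lia)); lia.
have := pp' la.-1.
have -> : (la <= la.-1)%N = false by lia.
have -> : hp && (lp <= la.-1)%N = false by move: llp; case: (hp) => //= /(_ isT); lia.
lia.
Qed.

Let s_le : s <= s'.
Proof.
have [O' [e' _ _]] := lowering_at F'; have [O [e er _]] := rem.
have [k0|k0] := posnP k'; first by rewrite (lowering_virtual F' k0); exact: lowering_le0 F.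
have : (k', s') \in strings rc' a by rewrite e' in_msetD in_mset_string eqxx -lt0n k0 orbT.
rewrite er in_msetD in_mset_string => /orP[h|/andP[_ /eqP[_ ->]] //].
by case: (lowering_min F (i:=k') (x:=s')); rewrite ?e ?in_msetD ?h.
Qed.

Let p'0 : p' 0%N = 0. Proof. by case: sh'. Qed.

(** Either a copy of the lowered string, possibly the virtual one, is left alone by delta, or its
    only copy is the selected string. *)
Let cases : (exists O2, strings rc a = O2 `+` mset_string (k, s) `+` [mset (la, p la)] /\
                strings rc' a = O2 `+` mset_string (k, s) `+` mset_string (la.-1, p' la.-1)) \/
  [/\ k = la, s = p la & exists O, [/\ strings rc a = O `+` [mset (la, p la)],
      strings rc' a = O `+` mset_string (la.-1, p' la.-1) & (k, s) \notin O]].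
Proof.
have [O [e er _]] := rem; have [O' [e' _ _]] := lowering_at F.
have [k0|k0] := posnP k; first by left; exists O; rewrite /mset_string k0 eqxx /= msetD0.
have [ks|ks] := boolP ((k, s) \in O).
  left; exists (O `\ (k, s)).
  have -> : mset_string (k, s) = [mset (k, s)] by rewrite /mset_string /= eqn0Ngt k0.
  by rewrite [_ `\ _ `+` _]msetDC msetB1K.
right.
have h : (k, s) \in strings rc a by rewrite e' in_msetD in_mset_string eqxx -lt0n k0 orbT.
rewrite e in_msetD in_mset1E (negPf ks) /= in h; move/eqP: h => [kE sE].
by split=> //; exists O.
Qed.

Section Selected.
Variable O : strs.
Hypotheses (kla : k = la) (spl : s = p la) (eO : strings rc a = O `+` [mset (la, p la)])
  (eO' : strings rc' a = O `+` mset_string (la.-1, p' la.-1)) (ksO : (k, s) \notin O).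

Let inO i y : (i, y) \in O -> (i, y) \in strings rc a.
Proof. by rewrite eO in_msetD => ->. Qed.

Let O_la : cnt O la = 0%N.
Proof.
apply/eqP; rewrite -leqn0 leqNgt; apply/negP => /cnt_gt0P[y iy].
have [h1 _] := lowering_min F (inO iy); have := U (inO iy); rewrite -/p -spl => h2.
by move: ksO; rewrite kla (_ : s = y) ?iy //; lia.
Qed.

Let m_la : m la = 1%N.
Proof. by rewrite /m eO cntD cnt1 eqxx O_la. Qed.

Let hi i : (la < i)%N -> (0 < m i)%N -> s < p i.
Proof. by rewrite -kla; exact: (lowering_vac_gt F an U). Qed.

Let p'la1 : hp || (s < p N) -> p' la.-1 = s.
Proof.
move=> h; apply/eqP; rewrite eq_le before andbT.
exact: (selected_lowest sh lm_gt0 lml (fun _ => glm_gt0) llp lpN sh' pp' mm' glp (esym spl) m_la hi h).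
Qed.

(** If [hp] holds or [s] is below the limit, the shortened string keeps the rigging [s], or vanishes
    with [s = p' 0 = 0]; in both cases [s'] cannot exceed [s]. *)
Lemma selected_low : s < s' -> [/\ x = a.+1, s = p N & s' = s + 1].
Proof.
move=> lt; have : ~~ (hp || (s < p N)).
  apply/negP => /p'la1 e.
  have [l1|l1] := leqP la 1.
    have la1 : la = 1%N by lia.
    by move: e; rewrite la1 p'0 => s0; have := lowering_le0 F'; lia.
  have : (la.-1, p' la.-1) \in strings rc' a.
    by rewrite eO' in_msetD in_mset_string eqxx /= -lt0n orbC -ltnS prednK ?l1.
  by move=> /(lowering_min F')[]; lia.
rewrite negb_or -leNgt => /andP[hpF le].
have sN : s = p N by have := lowering_pinf F an U bN; rewrite -/p; lia.
have := lowering_pinf F' an U' bN'; rewrite -/p'.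
rewrite (pinf'E sh lml lpN sh' pp') hpF => h.
split=> //; last by lia.
by move: hpF; rewrite /hp; lia.
Qed.

Lemma selected_step : s < p N -> exists l1, removal n L L' x l1 rc1 rc1'.
Proof.
move=> sN; have p'1 := p'la1 ltac:(by rewrite sN orbT).
have [pl1 hpl p'l g'l] := selected_moves sh lm_gt0 lml (fun _ => glm_gt0) llp lpN sh' pp' mm' glp (esym spl) m_la hi sN p'1.
have [ek es] : k' = la.-1 /\ s' = s.
  apply: (fstring_uniq (lowering_fstring F')); split.
  - by exists O; rewrite eO' p'1.
  - move=> i y; rewrite eO' in_msetD in_mset_string p'1 => /orP[iy|/andP[_ /eqP[-> ->]]//].
    have [h1 h2] := lowering_min F (inO iy); split=> // /h2; rewrite kla => ila.
    have : i != la by apply/eqP => e; have := cnt_eq0 y O_la; rewrite -e iy.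
    lia.
  - exact: lowering_le0 F.
  - by move=> e; rewrite -p'1 e.
have eF : strings rc a = O `+` mset_string (k, s).
  by rewrite eO /mset_string kla spl /= eqn0Ngt la_gt0.
have eF' : strings rc' a = O `+` mset_string (k', s') by rewrite eO' p'1 ek es.
have e1 := lowering_atE F eF; have e1' := lowering_atE F' eF'.
have shO : shift (-2) k' O = shift (-2) k O.
  apply: shift_congr => -[i y] iy /=; rewrite ek kla.
  have : i != la by apply/eqP => e; have := cnt_eq0 y O_la; rewrite -e iy.
  lia.
apply: (transfer D an F F' (la := k.+1) (esym es)) => //.
(* The comparisons with [k = la] and [k' = la.-1] differ only at length [la]. There [g'l] allows no
   neighbouring part after delta except a shortened one of length [lp.-1]. *)
- move=> b i bn ba c0 ne; have il : i = la by move: ne; rewrite ek kla; lia.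
  subst i; move: g'l; rewrite /g' /gsum.
  have [eb|eb] := eqVneq b a.+1.
    subst b; have [bx|bx] := boolP (a.+1 < x)%N; last first.
      by rewrite /hp (negPf bx) (removal_ge D (b:=a.+1)) //; lia.
    have := cnt_removed (removal_lt D (b:=a.+1) ltac:(lia)) la_gt0; rewrite -/lp /hp bx /=.
    have := hpl bx; lia.
  have eb1 : b = a.-1 by apply/eqP; move: c0; rewrite cartanE ?(negPf ba) ?(negPf eb); [case: (b == a.-1) | lia].
  subst b; have := cnt_removed (removal_lt D (b:=a.-1) ltac:(lia)) la_gt0; rewrite -/lm /hp.
  have -> : (a.-1 < x)%N by lia.
  case E : (a.+1 < x)%N; last by lia.
  have := cnt_removed (removal_lt D (b:=a.+1) ltac:(lia)) la_gt0; rewrite -/lp.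
  have := hpl E; lia.
- move=> _; split; first by rewrite kla -/lm; lia.
  exists (shift (-2) k O); split.
  + by rewrite e1 (lowering_vac L F an) // ltnSn /cartan eqxx kla -/p pl1; congr (_ `+` [mset (_, _)]); lia.
  + rewrite e1' shO /mset_string /= kla eqn0Ngt la_gt0 (lowering_vac L' F' an) // -/p' p'l ek es.
    by rewrite /cartan eqxx /= prednK //; congr (_ `+` [mset (_, _)]); lia.
  + move=> i y; rewrite mem_shift (lowering_vac L F an) // => iy ii.
    have ne : i != la by apply/eqP => e; have := cnt_eq0 (y - -2 * (k < i)%N%:Z) O_la; rewrite -e iy.
    have := nons (inO iy); rewrite /cartan eqxx -/p /lm => /(_ ltac:(lia)); lia.
- by move=> h; rewrite kla; exact: hpl.
- by move=> i _ _; rewrite kla -/la; lia.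
- by move=> e; lia.
- by lia.
Qed.

End Selected.

Section Survives.
Variable O2 : strs.
Hypotheses (eO : strings rc a = O2 `+` mset_string (k, s) `+` [mset (la, p la)])
  (eO' : strings rc' a = O2 `+` mset_string (k, s) `+` mset_string (la.-1, p' la.-1)).

Let inO i y : (i, y) \in O2 -> (i, y) \in strings rc a.
Proof. by rewrite eO !in_msetD => ->. Qed.

Lemma survives_low : s' = s.
Proof.
have [k0|k0] := posnP k; first by have := lowering_virtual F k0; have := lowering_le0 F'; have := s_le; lia.
have : (k, s) \in strings rc' a.
  by rewrite eO' !in_msetD in_mset_string eqxx -lt0n k0 /= orbT.
by move=> /(lowering_min F')[h _]; have := s_le; lia.
Qed.

Let fstr_survives : (p' la.-1 = s -> (la.-1 <= k)%N) -> k' = k.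
Proof.
move=> h; have [] // : k' = k /\ s' = s.
apply: (fstring_uniq (lowering_fstring F')); split.
- exists (O2 `+` mset_string (la.-1, p' la.-1)); rewrite eO'.
  by rewrite -!msetDA [mset_string (k, s) `+` _]msetDC.
- move=> i y; rewrite eO' !in_msetD !in_mset_string => /orP[/orP[iy|/andP[_ /eqP[-> ->]]//]|].
    exact: (lowering_min F (inO iy)).
  by move=> /andP[_ /eqP[-> ->]]; split=> //; exact: before.
- exact: lowering_le0 F.
- exact: lowering_virtual F.
Qed.

Let pk : (k < la)%N -> s + ((0 < k)%N && (lm <= k)%N)%:Z <= p k.
Proof.
move=> kla; have := lowering_vac_ge F an U; rewrite -/p; have [k0|k0] := posnP k; first by lia.
have ks : (k, s) \in strings rc a.
  by rewrite eO !in_msetD in_mset_string eqxx -lt0n k0 /= orbT.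
have [lmk|lmk] := leqP lm k; last by lia.
by have := nons ks ltac:(lia); lia.
Qed.

Let hi i : (k < i < la)%N -> (0 < m i)%N -> s + 1 + (lm <= i)%:Z <= p i.
Proof.
move=> ki mi; have [y iy] := cnt_gt0P mi; have [h1 h2] := lowering_min F iy.
have sy : s < y by rewrite lt_neqAle h1 andbT; apply/eqP => e; have := h2 (esym e); lia.
have := U iy; rewrite -/p => py; have [lmi|lmi] := leqP lm i; last by lia.
by have := nons iy ltac:(lia); lia.
Qed.

Let pla : (k < la)%N -> s < p la.
Proof.
move=> kla; have [h1 h2] := lowering_min F sel_in.
by rewrite lt_neqAle h1 andbT; apply/eqP => e; have := h2 (esym e); lia.
Qed.

Let m_la : (0 < m la)%N. Proof. exact: mem_cnt_gt0 sel_in. Qed.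

Lemma survives_step : exists l1, removal n L L' x l1 rc1 rc1'.
Proof.
have es := survives_low.
have eF : strings rc a = O2 `+` [mset (la, p la)] `+` mset_string (k, s) by rewrite msetDAC.
have e1 := lowering_atE F eF.
have p'la1 : p' la.-1 = p la.-1 - (lm < la)%N%:Z.
  rewrite pp'.
  have -> : (la <= la.-1)%N = false by lia.
  have -> : hp && (lp <= la.-1)%N = false by move: llp; case: (hp) => //= /(_ isT); lia.
  lia.
(* The new string [(k.+1, s - 1)] has vacancy number [p k.+1 - 2]; the test asks whether delta
   selects it before reaching [la]. If it is singular and [k.+1 = la], it equals the string selected
   anyway, hence the strict inequality. *)
have [/and3P[lmk kla1 /eqP pk1]|nc] := boolP [&& (lm <= k.+1)%N, (k.+1 < la)%N & p k.+1 == s + 1].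
  have kla : (k < la)%N by lia.
  have [mz pE pkE gE] := shorter_reached sh lm_gt0 lml (fun _ => glm_gt0) kla (pk kla) hi (pla kla) m_la kla1 lmk pk1.
  have p'1 : p' la.-1 = s by rewrite p'la1 pE; lia.
  have ek : k' = la.-1.
    have [] // : k' = la.-1 /\ s' = s.
    apply: (fstring_uniq (lowering_fstring F')); split.
    - by exists (O2 `+` mset_string (k, s)); rewrite eO' p'1.
    - move=> i y; rewrite eO' !in_msetD !in_mset_string p'1 => /orP[/orP[iy|]|/andP[_ /eqP[-> ->]]//].
        by have [h1 h2] := lowering_min F (inO iy); split=> // /h2; lia.
      by move=> /andP[_ /eqP[-> ->]]; split=> //; lia.
    - exact: lowering_le0 F.
    - by lia.
  have eF' : strings rc' a = O2 `+` mset_string (k, s) `+` mset_string (k', s') by rewrite eO' p'1 ek es.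
  have e1' := lowering_atE F' eF'.
  have shO : shift (-2) k' O2 = shift (-2) k O2.
    apply: shift_congr => -[i y] iy /=; rewrite ek.
    have := mz i; have := mem_cnt_gt0 (inO iy); rewrite -/m; lia.
  (* The roles are exchanged: lowering shifts the formerly selected [(la, s + 1)] to [(la, s - 1)],
     which is also what [(la.-1, s)] is lowered to, and delta shortens [(k.+1, s - 1)] back to
     [(k, s)]. *)
  apply: (transfer D an F F' (la := k.+1) (esym es)) => //.
  - move=> b i bn ba c0 ne; have il : (k < i < la)%N by move: ne; rewrite ek; lia.
    have := gE i il; rewrite /g /gsum.
    have [eb|eb] := eqVneq b a.+1.
      subst b; have -> : (a.+1 < x)%N && (i == l a.+1) = false.
        by apply/negP => /andP[h /eqP e]; have := llp h; rewrite /lp; lia.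
      have [e|] := eqVneq i lm; last by lia.
      move: glm_gt0; rewrite /g /gsum -e; have [a1|a1] := eqVneq a 1%N.
        suff : (0 < lcnt L a i)%N by lia.
        by rewrite /lcnt (removal_L D) big_mkcond sum_msetD sum_mset1 e a1 /= /lm a1 (removal_l0 D).
      by have := mem_cnt_gt0 (removal_mem D (b:=a.-1) ltac:(lia)); rewrite -/lm -e; lia.
    have eb1 : b = a.-1 by apply/eqP; move: c0; rewrite cartanE ?(negPf ba) ?(negPf eb); [case: (b == a.-1) | lia].
    subst b; have -> : (a.-1 < x)%N by lia.
    have := mem_cnt_gt0 (removal_mem D (b:=a.-1) ltac:(lia)); rewrite -/lm /=.
    by have [->|] := eqVneq i lm; lia.
  - move=> _; split; first exact: lmk.
    exists (shift (-2) k (O2 `+` [mset (la, p la)])); split.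
    + by rewrite e1 (lowering_vac L F an) // ltnSn /cartan eqxx -/p pk1; congr (_ `+` [mset (_, _)]); lia.
    + rewrite e1' !shiftD shO shift_str shift1 /= (lowering_vac L' F' an) //.
      have -> : (k' < k)%N = false by rewrite ek; lia.
      rewrite kla !mulr0 addr0 subr0 /= -/p' pp' pkE ek es prednK // pE; last by lia.
      have -> : (la <= k)%N = false by lia.
      have -> : hp && (lp <= k)%N = false by move: llp; case: (hp) => //= /(_ isT); lia.
      rewrite -!msetDA; congr (_ `+` _); rewrite msetDC; congr ([mset (_, _)] `+` mset_string (_, _)); lia.
    + move=> i y; rewrite mem_shift (lowering_vac L F an) // in_msetD in_mset1E => /orP[iy|/eqP[-> _]] ii; last by lia.
      have := nons (inO iy); rewrite /cartan eqxx -/p /lm => /(_ ltac:(lia)); lia.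
  - by move=> /llp; rewrite -/lp; lia.
  - move=> i _ _ ii; have := gE i ltac:(lia); rewrite /g /gsum.
    have -> : (a.+1 < x)%N && (i == l a.+1) = false.
      by apply/negP => /andP[h /eqP e]; have := llp h; rewrite /lp; lia.
    have [e|] := eqVneq i lm; last by lia.
    move: glm_gt0; rewrite /g /gsum -e; have [a1|a1] := eqVneq a 1%N.
      suff : (0 < lcnt L a i)%N by lia.
      by rewrite /lcnt (removal_L D) big_mkcond sum_msetD sum_mset1 e a1 /= /lm a1 (removal_l0 D).
    by have := mem_cnt_gt0 (removal_mem D (b:=a.-1) ltac:(lia)); rewrite -/lm -e; lia.
  - by lia.
  - by lia.
have ek : k' = k.
  apply: fstr_survives => e; rewrite leqNgt; apply/negP => kla.
  have kla' : (k < la)%N by lia.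
  have := shorter_not_reached sh lm_gt0 lml (fun _ => glm_gt0) kla' (pk kla') hi (pla kla') m_la kla.
  have h : ~ ((lm <= k.+1)%N /\ p k.+1 = s + 1).
    by move=> [h1 h2]; case/and3P: nc; split; [|lia|apply/eqP].
  by move=> /(_ h); rewrite p'la1 in e; lia.
have eF' : strings rc' a = O2 `+` mset_string (la.-1, p' la.-1) `+` mset_string (k', s').
  by rewrite eO' ek es msetDAC.
have e1' := lowering_atE F' eF'.
apply: (transfer D an F F' (la := la) (esym es)) => //; try by move=> *; lia.
move=> _; split => //.
exists (shift (-2) k O2 `+` [mset (k.+1, s - 1)]); split.
- by rewrite e1 shiftD shift1 /= (lowering_vac L F an) // /cartan eqxx mulNr msetDAC.
- by rewrite e1' shiftD shift_str /= (lowering_vac L' F' an) // /cartan eqxx mulNr ek es msetDAC.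
- move=> i y; rewrite in_msetD mem_shift in_mset1E (lowering_vac L F an) // /cartan eqxx -/p.
  case/orP=> [iy|/eqP[-> ->]] ii; first by have := nons (inO iy) ii; lia.
  rewrite ltnSn => e; case/negP: nc; apply/and3P; split; [lia|lia|].
  by apply/eqP; lia.
Qed.

End Survives.

(** The counterpart of [ep_box]: once [s'] is known to be minus epsilon of the tail, [p' N - s'] is
    phi of the tail, and a box [a.+1] stays unmatched exactly when this is 0. *)
Lemma step_gt_low : s = if (x == a.+1) && (s' == p' N) then s' - 1 else s'.
Proof.
have pN := lowering_pinf F an U bN; rewrite -/p in pN.
have pE := pinf'E sh lml lpN sh' pp'.
have [[O2 [e e']]|[kl sl [O [e e' no]]]] := cases.
  have es := survives_low e'; rewrite es; case: ifP => // /andP[/eqP xa /eqP h].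
  by move: pE; rewrite /hp xa ltnn; lia.
case: (ltP s s') => [lt|ge]; last first.
  have es : s' = s by have := s_le; lia.
  rewrite es; case: ifP => // /andP[/eqP xa /eqP h].
  by move: pE; rewrite /hp xa ltnn; lia.
have [xa sN es] := selected_low kl sl e e' no lt.
rewrite xa eqxx /= pE /hp xa ltnn /= es sN; case: eqP; lia.
Qed.

Lemma step_gt : s < p N -> exists l1, removal n L L' x l1 rc1 rc1'.
Proof.
move=> sN; have [[O2 [e e']]|[kl sl [O [e e' no]]]] := cases.
  exact: survives_step e e'.
exact: selected_step kl sl e e' no sN.
Qed.

End StepGt.

(** * Rigged configurations in RC, and the map lb *)

Section RCFacts.
Variables (n : nat) (L : {mset nat * nat}) (lam : n.-tuple nat) (rc : rconf).
Hypothesis R : RC L lam rc.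

Lemma RC_supported : supported n rc.
Proof.
case: R => out [pos _] _; split=> // b [i y] iy /=.
have bn : (1 <= b < n)%N by apply/idPn => /out e; rewrite e in_mset mset0E in iy.
rewrite lt0n; apply/eqP => i0; move/negP: (pos b bn); apply.
by rewrite /nu_of mem_seq_mset; apply/mapP; exists (i, y).
Qed.

Lemma RC_upper : upper n L rc.
Proof.
move=> b i y iy; have i0 := proj2 RC_supported _ _ iy.
case: R => out _ [t _ q].
have bn : (1 <= b < n)%N by apply/idPn => /out e; rewrite e in_mset mset0E in iy.
have /and3P[_ _ /allP] := q b i bn i0; move/(_ y).
rewrite /riggings mem_sort => h.
have /h /andP[] // : y \in [seq s.2 | s <- strings rc b & s.1 == i].
by apply/mapP; exists (i, y) => //; rewrite mem_filter /= eqxx.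
Qed.

Lemma RC_boxes (j : 'I_n) : boxes (strings rc j.+1) - boxes (strings rc j) =
  \sum_(x <- L) (if (j < x.1)%N then (x.2)%:Z else 0) - (tnth lam j)%:Z.
Proof.
have sup := RC_supported; case: R => _ [_ e] _.
have := congr1 (fun M : 'rV_n => M 0 j) e; rewrite !mxE !summxE => E.
transitivity (\sum_(1 <= b < n) ((b == j.+1)%:Z * boxes (strings rc b) - (b == j)%:Z * boxes (strings rc b))).
  have b0 b : ~~ (1 <= b < n)%N -> boxes (strings rc b) = 0.
    by move=> /(proj1 sup) ->; rewrite /boxes big_mset0.
  have pick c : \sum_(1 <= b < n) (b == c)%:Z * boxes (strings rc b) = boxes (strings rc c).
    by apply: (@sum_pick n c (fun b => boxes (strings rc b))); [exact: b0 | move=> b nb; apply: b0; lia].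
  by rewrite sumrB !pick.
transitivity (\sum_(1 <= b < n) (\sum_(i <- nu_of rc b) alpha n b *+ i) 0 j).
  apply: eq_big_nat => b bn; rewrite summxE /nu_of sum_seq_mset big_map -mulrBl mulr_sumr.
  apply: eq_bigr => t _; rewrite mulmxnE !mxE -[RHS]mulr_natr !natz eqSS [j.+1 == b]eq_sym [nat_of_ord j == b]eq_sym.
  by [].
rewrite E; congr (_ - _); apply: eq_bigr => -[r s] _ /=.
rewrite mulmxnE /Lambda summxE.
have -> : \sum_(1 <= k < r.+1) (epsilon n k) 0 j = (j < r)%N%:Z.
  rewrite (eq_bigr (fun k => if k == j.+1 then 1 else 0)); last first.
    by move=> k _; rewrite mxE eq_sym; case: eqP.
  by rewrite -big_mkcond big_nat1_eq /= ltnS; case: ltnP.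
by case: ltnP => _; [rewrite -[LHS]mulr_natr natz mul1r | rewrite mul0rn].
Qed.

(** The difference of two adjacent coordinates of the weight equation: among the $\Lambda_r$ only
    $r=a$ contributes to it, as in the vacancy number at large lengths. *)
Lemma RC_pinf a N (an1 : (a.-1 < n)%N) (an : (a < n)%N) : (0 < a)%N -> bounded L rc N ->
  vac n L rc a N = (tnth lam (Ordinal an1))%:Z - (tnth lam (Ordinal an))%:Z.
Proof.
move=> a0 [bL bS]; have sup := RC_supported.
rewrite vacE ?a0 // !(@qsum_large _ N); try by move=> t /bS.
have := RC_boxes (Ordinal an); have := RC_boxes (Ordinal an1); rewrite /= prednK //.
have -> : lqsum L a N = \sum_(x <- L) (if (a <= x.1)%N then (x.2)%:Z else 0) -
                        \sum_(x <- L) (if (a < x.1)%N then (x.2)%:Z else 0).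
  rewrite -sumrB /lqsum big_mkcond /=; apply: eq_big_seq => x xL.
  case: x xL => r q xL; have /= := bL _ xL; rewrite /=; do 3 case: ifP; lia.
set A := \sum_(x <- L) (if (a <= x.1)%N then _ else _); set B := \sum_(x <- L) _.
by move: A B => A B; rewrite mulr2n; lia.
Qed.

End RCFacts.

Lemma RC_boxes_diff n L L' lam mu rc rc' x b : L = [mset (1, 1)%N] `+` L' -> (1 <= x)%N ->
  RC L lam rc -> RC L' mu rc' ->
  (forall j : 'I_n, tnth lam j = tnth mu j + (j.+1 == x))%N -> (1 <= b < n)%N ->
  boxes (strings rc b) = boxes (strings rc' b) + (b < x)%N%:Z.
Proof.
move=> eL x1 R R' lm; elim: b => [//|b IH] bn.
have bn' : (b < n)%N by lia.
have := RC_boxes R (Ordinal bn'); have := RC_boxes R' (Ordinal bn').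
rewrite lm /= eL sum_msetD sum_mset1 /=.
set A := \sum_(x <- L') _; move: A => A.
have [b0|b0] := posnP b; last first.
  by have := IH ltac:(lia); have -> : (b < 1)%N = false by [lia]; lia.
by subst b; rewrite (proj1 (RC_supported R) 0%N) // (proj1 (RC_supported R') 0%N) // /boxes !big_mset0 /=; lia.
Qed.

Section LB.
Variables (n : nat) (M L L' : {mset nat * nat}) (r : nat).
Hypotheses (eL : L = [mset (r, 1)%N] `+` M) (eL' : L' = [mset (1, 1)%N] `+` ([mset (r.-1, 1)%N] `+` M)).
Hypothesis rn : (2 <= r < n)%N.

Lemma lb_strings rc b : (1 <= b < n)%N -> strings (lb_rc n L' r rc) b =
  if (1 <= b < r)%N then strings rc b `+` [mset (1%N, vac n L' (lb_rc n L' r rc) b 1)] else strings rc b.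
Proof.
move=> bn; rewrite /lb_rc {1}/strings fsfunE in_I_set bn; case: ifP => // br.
congr (_ `+` [mset (_, _)]); apply: eq_vacancy => c cn.
rewrite /nu_of /strings fsfunE in_I_set cn; case: ifP => // _.
by rewrite lengthsD /lengths map_mset1.
Qed.

Lemma lb_out rc b : ~~ (1 <= b < n)%N -> strings (lb_rc n L' r rc) b = mset0.
Proof. by move=> bn; rewrite /lb_rc {1}/strings fsfunE in_I_set (negPf bn). Qed.

Lemma lb_supported rc : supported n rc -> supported n (lb_rc n L' r rc).
Proof.
move=> sup; split; first exact: lb_out.
move=> b [i y]; have [bn|bn] := boolP (1 <= b < n)%N; last by rewrite lb_out // in_mset mset0E.
rewrite lb_strings //; case: ifP => _; last exact: (proj2 sup).
rewrite in_msetD in_mset1E => /orP[|/eqP[-> _] //]; exact: (proj2 sup).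
Qed.

(** $\Lambda_1+\Lambda_{r-1}-\Lambda_r=\alpha_1+\cdots+\alpha_{r-1}$: the change of the multiplicity
    array is balanced by the added strings of length 1. *)
Lemma lb_vac rc b i : supported n rc -> (1 <= b < n)%N ->
  vac n L' (lb_rc n L' r rc) b i = vac n L rc b i.
Proof.
move=> sup bn; rewrite (vacE L i sup bn) (vacE L' i (lb_supported sup) bn).
have qE c : qsum (strings (lb_rc n L' r rc) c) i = qsum (strings rc c) i + (1 <= c < r)%N%:Z * (minn i 1)%:Z.
  have [cn|cn] := boolP (1 <= c < n)%N.
    by rewrite lb_strings //; case: ifP => _; [rewrite qsumD qsum1 mul1r | rewrite mul0r addr0].
  rewrite lb_out // (proj1 sup) //; have -> : (1 <= c < r)%N = false by lia.
  by rewrite mul0r addr0.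
have lE S T c : lqsum (S `+` T) c i = lqsum S c i + lqsum T c i.
  by rewrite /lqsum big_mkcond sum_msetD -!big_mkcond.
have l1 c d : lqsum [mset (d, 1%N)] c i = (d == c)%:Z * (minn i 1)%:Z.
  by rewrite /lqsum big_mkcond sum_mset1 /=; case: eqP => _; rewrite ?mul1r ?mul0r.
rewrite !qE eL eL' !lE !l1.
have h : (1 == b)%:Z + (r.-1 == b)%:Z - (r == b)%:Z - (0 < b < r)%N%:Z *+ 2 + (0 < b.-1 < r)%N%:Z + (0 < b.+1 < r)%N%:Z = 0 by lia.
transitivity (lqsum [mset (r, 1%N)] b i + lqsum M b i - qsum (strings rc b) i *+ 2 + qsum (strings rc b.-1) i + qsum (strings rc b.+1) i
 + ((1 == b)%:Z + (r.-1 == b)%:Z - (r == b)%:Z - (0 < b < r)%N%:Z *+ 2 + (0 < b.-1 < r)%N%:Z + (0 < b.+1 < r)%N%:Z) * (minn i 1)%:Z).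
  by rewrite l1; ring.
by rewrite h mul0r addr0 l1.
Qed.

Lemma lb_inj rc rc' : supported n rc -> supported n rc' -> lb_rc n L' r rc = lb_rc n L' r rc' -> rc = rc'.
Proof.
move=> sup sup' e; apply/fsfunP => b; rewrite -/(strings rc b) -/(strings rc' b).
have [bn|bn] := boolP (1 <= b < n)%N; last by rewrite (proj1 sup) // (proj1 sup').
have := lb_strings rc bn; rewrite e lb_strings //; case: ifP => // _ h.
exact: esym (msetDI h).
Qed.

Variables (a k k' : nat) (s s' : int) (rc rc1 rc1' : rconf) (N : nat).
Hypotheses (F : lowering n a k s rc rc1) (F' : lowering n a k' s' (lb_rc n L' r rc) rc1').
Hypotheses (U : upper n L rc) (an : (1 <= a < n)%N) (bN : bounded L rc N).

Let vac1 : s <= vac n L rc a 1.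
Proof.
apply: (vac1_ge (vac_shape_rc (lowering_sup F) an bN) (lowering_le0 F)) => i /cnt_gt0P[y iy].
by have [h _] := lowering_min F iy; apply: le_trans h (U iy).
Qed.

Lemma lb_low : s' = s.
Proof.
have lbE := lb_strings rc an; rewrite (lb_vac _ (lowering_sup F) an) in lbE.
have ss' : s <= s'.
  have [[O e] _ _ z] := lowering_fstring F'.
  have [k0|k0] := posnP k'; first by rewrite z //; exact: lowering_le0 F.
  have : (k', s') \in strings (lb_rc n L' r rc) a.
    by rewrite e in_msetD in_mset_string eqxx -lt0n k0 orbT.
  rewrite lbE; case: ifP => _; last by move=> /(lowering_min F)[].
  by rewrite in_msetD in_mset1E => /orP[/(lowering_min F)[]//|/eqP[_ ->]].
have [[O e] _ _ z] := lowering_fstring F.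
have [k0|k0] := posnP k; first by have := z k0; have := lowering_le0 F'; lia.
have ks : (k, s) \in strings rc a by rewrite e in_msetD in_mset_string eqxx -lt0n k0 orbT.
have : (k, s) \in strings (lb_rc n L' r rc) a.
  by rewrite lbE; case: ifP => _ //; rewrite in_msetD ks.
by move=> /(lowering_min F')[]; lia.
Qed.

Lemma lb_lowering : s < vac n L rc a N -> rc1' = lb_rc n L' r rc1.
Proof.
move=> sN; have lbE := lb_strings rc an; rewrite (lb_vac _ (lowering_sup F) an) in lbE.
have [[O e] lo s0 z] := lowering_fstring F.
have [ek es] : k' = k /\ s' = s.
  apply: (fstring_uniq (lowering_fstring F')); split=> //.
    rewrite lbE; case: ifP => _; last by exists O.
    by exists (O `+` [mset (1%N, vac n L rc a 1)]); rewrite e msetDAC.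
  (* The added string could win only in a tie with the virtual string [k = 0], but then
     [lowering_next_vac] puts its rigging above [s]. *)
  move=> i y; rewrite lbE; case: ifP => _; last exact: lo.
  rewrite in_msetD in_mset1E => /orP[/lo //|/eqP[-> ->]]; split=> // e1.
  rewrite lt0n; apply/eqP => k0.
  by have := lowering_next_vac F an U bN sN; rewrite k0; lia.
apply/fsfunP => b; rewrite -/(strings rc1' b) -/(strings (lb_rc n L' r rc1) b).
have [bn|bn] := boolP (1 <= b < n)%N; last by rewrite lb_out // (proj1 (lowering_sup1 F')).
rewrite lb_strings // lb_vac ?(lowering_sup1 F) //; last exact: lowering_sup1 F.
have [eb|ba] := eqVneq b a; last first.
  rewrite (lowering_off F') // (lowering_off F) // (lb_strings rc bn) (lb_vac _ (lowering_sup F) bn) ek; case: ifP => // _.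
  by rewrite shiftD shift1 /= (lowering_vac L F an) // mulNr.
subst b; rewrite (lowering_atE F e); case: ifP => ar; rewrite ar in lbE.
  rewrite (lowering_atE F' (O := O `+` [mset (1%N, vac n L rc a 1)])).
    by rewrite ek es shiftD shift1 /= (lowering_vac L F an) // /cartan eqxx mulNr msetDAC.
  by rewrite lbE ek es e msetDAC.
by rewrite (lowering_atE F' (O := O)) ?ek ?es // lbE.
Qed.

End LB.

(** * The bijection Phi *)

Lemma is_path_cons n r s B T b :
  is_path n ((r, s) :: B) (T :: b) = is_tableau n r s T && is_path n B b.
Proof. by []. Qed.

Lemma path_f_path n a B b c : (a < n)%N -> is_shapes n B -> is_path n B b ->
  path_f a b = Some c -> is_path n B c.
Proof.
rewrite /path_f => an; elim: b (size b) B c => [|T b IH] [|k] // [|[r s] B] // c.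
move=> /andP[/andP[_ s0] hB]; rewrite is_path_cons => /andP[hT hb] /=.
case: ifP => _.
  by case E : (tab_f a T) => [T'|] //= [<-]; apply/andP; split=> //; exact: tab_f_tableau s0 an hT E.
by case E : (tensor_f k a b) => [b'|] //= [<-]; apply/andP; split=> //; exact: IH hB hb E.
Qed.

Lemma path_e_path n a B b c : (1 <= a <= n)%N -> is_shapes n B -> is_path n B b ->
  path_e a b = Some c -> is_path n B c.
Proof.
move=> an; elim: b B c => [|T b IH] // [|[r s] B] // c.
move=> /andP[/andP[_ s0] hB]; rewrite is_path_cons => /andP[hT hb] /=.
case: ifP => _.
  by case E : (tab_e a T) => [T'|] //= [<-]; apply/andP; split=> //; exact: tab_e_tableau s0 an hT E.
by case E : (path_e a b) => [b'|] //= [<-]; apply/andP; split=> //; exact: IH hB hb E.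
Qed.

Lemma ph_count a b : (ph a b + count_mem a.+1 (letters b) = ep a b + count_mem a (letters b))%N.
Proof.
have := sg_count a (nolab (letters b)).
by rewrite (_ : [seq c.1 | c <- nolab _] = letters b) // -map_comp map_id.
Qed.

Lemma tnth_wt n b (j : 'I_n) : tnth (wt n b) j = count_mem j.+1 (letters b).
Proof. by rewrite tnth_mktuple. Qed.

Lemma mult_array_cons x B : mult_array (x :: B) = [mset x] `+` mult_array B.
Proof.
by apply/msetP => y; rewrite msetE2 msetnE !mset_seqE /= eq_sym; case: eqP.
Qed.

Lemma map_seq_mset (K K' : choiceType) (f : K -> K') (s : seq K) :
  seq_mset [seq f x | x <- seq_mset s] = seq_mset [seq f x | x <- s].
Proof. exact/eq_seq_msetP/perm_map/perm_eq_seq_mset. Qed.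

Lemma shift_opp c k S : shift c k (shift (- c) k S) = S.
Proof.
rewrite {1}/shift map_seq_mset -map_comp -[RHS]seq_mset_id; congr seq_mset.
rewrite -[RHS]map_id; apply: eq_map => -[i x] /=; congr pair; ring.
Qed.

Lemma e_string_min (S : strs) (k : nat) (s : int) : (k, s) \in S -> s < 0 ->
  (forall i x, (i, x) \in S -> s <= x /\ (x = s -> (k <= i)%N)) -> e_string S = Some (k, s).
Proof.
rewrite /e_string => ks s0 lo; set r := (fun _ _ => _).
have tot : total r by move=> [i1 x1] [i2 x2]; rewrite /r /=; lia.
have tr : transitive r by move=> [i1 x1] [i2 x2] [i3 x3]; rewrite /r /=; lia.
have ksF : (k, s) \in [seq s <- S | s.2 < 0] by rewrite mem_filter s0.
case E : (ohead _) => [[k' s']|]; last by move: ksF; rewrite (ohead_sort_None E).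
have := ohead_sort_mem E; rewrite mem_filter => /andP[_ /lo [h1 h2]].
have := sorted_head_min tot tr E ksF; rewrite /r /= => h.
have es : s' = s by lia.
have h3 := h2 es; have ek : k' = k by lia.
by rewrite es ek.
Qed.

(** After lowering, strings of length at most [k] still have riggings at least [s], and longer ones
    had at least [s + 1] and lost 2. So [(k.+1, s - 1)] has the smallest rigging, and the smallest
    length among ties. *)
Lemma rc_e_lowering n L a k s rc rc1 : (1 <= a < n)%N -> lowering n a k s rc rc1 ->
  rc_e n L a rc1 = Some rc.
Proof.
move=> an F; have [O [e e1 lo]] := lowering_at F.
have -> : rc_e n L a rc1 =
    Some (replace_strings n L a [mset (k.+1, s - 1)] (mset_string (k, s)) rc1).
  rewrite /rc_e (@e_string_min _ k.+1 (s - 1)) ?subrK //.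
  - by rewrite e1 in_msetD in_mset1E eqxx orbT.
  - by have := lowering_le0 F; lia.
  - move=> i x; rewrite e1 in_msetD mem_shift in_mset1E => /orP[/lo[h1 h2]|/eqP[-> ->] //].
    by split; have := ltnP k i; case: (ltnP k i) h1 h2 => /=; lia.
congr Some; apply/fsfunP => b; rewrite -/(strings rc b) -[LHS]/(strings _ b).
rewrite (replace_stringsE _ _ _ (lowering_sup1 F) an e1).
have shE (T : strs) : seq_mset [seq (t.1, t.2 + cartan b a * (qsum [mset (k.+1, s - 1)] t.1 - qsum (mset_string (k, s)) t.1)) | t <- T]
     = shift (cartan a b) k T.
  rewrite /shift; congr seq_mset; apply: eq_map => t; rewrite qsum_str qsum1 /= cartan_sym.
  by congr pair; have -> : (minn t.1 k.+1)%:Z - (minn t.1 k)%:Z = (k < t.1)%N%:Z by lia.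
have [bn|bn] := boolP (1 <= b < n)%N; last by rewrite /= (proj1 (lowering_sup F)).
rewrite /= !shE; case: eqP => [->|/eqP ba]; last by rewrite (lowering_off F) // shift_opp.
by rewrite /cartan eqxx -[2 in LHS]opprK shift_opp e.
Qed.

Lemma all2_take (u v : seq nat) : all2 ltn u v -> all2 ltn (take 1 u) (take 1 v).
Proof. by case: u v => [|x u] [|y v] //= /andP[->]; rewrite !take0. Qed.

Lemma all2_behead (u v : seq nat) : all2 ltn u v -> all2 ltn (behead u) (behead v).
Proof. by case: u v => [|x u] [|y v] //= /andP[]. Qed.

Lemma sorted_behead (u : seq nat) : sorted leq u -> sorted leq (behead u).
Proof. by case: u => //= x u; exact: path_sorted. Qed.

Lemma ls_tableau n r s T : (0 < s)%N -> is_tableau n r s T ->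
  is_tableau n r 1 (map (take 1) T) && is_tableau n r s.-1 (map behead T).
Proof.
move=> s0 /and3P[sz rows so]; rewrite /is_tableau !size_map sz /=.
have row R : R \in T -> [&& size R == s, sorted leq R & all (fun x => 1 <= x <= n)%N R].
  exact: (allP rows).
apply/and3P; split.
- apply/andP; split; last by apply: homo_sorted so => R R'; exact: all2_take.
  apply/allP => _ /mapP[R /row /and3P[/eqP sR soR aR] ->].
  case: R sR soR aR => [|x R] /= sR _; first by rewrite -sR in s0.
  by move=> /andP[-> _]; rewrite take0.
- apply/allP => _ /mapP[R /row /and3P[/eqP sR soR aR] ->].
  rewrite size_behead sR eqxx sorted_behead //=.
  by apply/allP => x /mem_behead; exact: (allP aR).
- by apply: homo_sorted so => R R'; exact: all2_behead.
Qed.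

Lemma lb_tableau n r T : (1 < r)%N -> is_tableau n r 1 T ->
  is_tableau n 1 1 [:: last [::] T] && is_tableau n r.-1 1 (take (size T).-1 T).
Proof.
move=> r1 /and3P[/eqP sz rows so]; rewrite /is_tableau /= andbT.
case/lastP: T sz rows so => [|T R] sz; first by rewrite -sz in r1.
rewrite last_rcons all_rcons size_rcons /= => /andP[-> rows] so.
rewrite -cats1 take_size_cat // rows /=; rewrite size_rcons in sz; rewrite -sz eqxx /=.
by move: so; rewrite -cats1 => /cat_sorted2[].
Qed.

(** * Induction over the splitting maps *)

Section Main.
Variables (n : nat) (Phi : shapes -> cpath -> rconf).
Hypothesis (hPhi : is_Phi n Phi).

Lemma Phi_RC B b : is_shapes n B -> is_path n B b -> RC (mult_array B) (wt n b) (Phi B b).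
Proof. by move=> hB hb; have [h _ _] := Phi_bij hPhi (wt n b) hB; apply: h. Qed.

Lemma is_path_all B b : is_path n B b -> all_paths n B b.
Proof. by move=> hb; exists (wt n b). Qed.

Variable a : nat.
Hypothesis an : (1 <= a < n)%N.

(** Bracketing removes equally many [a] and [a.+1], so phi minus epsilon is
    $\lambda_a-\lambda_{a+1}$, the limit found in [RC_pinf]. *)
Lemma Phi_pinf B b N : is_shapes n B -> is_path n B b -> bounded (mult_array B) (Phi B b) N ->
  vac n (mult_array B) (Phi B b) a N = (ph a b)%:Z - (ep a b)%:Z.
Proof.
move=> hB hb bN; have an1 : (a.-1 < n)%N by lia.
have an2 : (a < n)%N by lia.
rewrite (RC_pinf (Phi_RC hB hb) an1 an2 _ bN) ?tnth_wt /=; last by lia.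
rewrite prednK; last by lia.
by have := ph_count a b; move: (count_mem _ _) (count_mem _ _) => u v; lia.
Qed.

(** [rc1] is taken before any validity test. The value of [s] belongs to the induction because the
    box step compares it with the limit of the vacancy numbers to decide which case occurs. *)
Definition commutes B b := forall k s rc1, lowering n a k s (Phi B b) rc1 ->
  s = - (ep a b)%:Z /\ (forall b1, path_f a b = Some b1 -> Phi B b1 = rc1).

Lemma Phi_removal B x b : is_shapes n ((1, 1)%N :: B) -> is_path n ((1, 1)%N :: B) ([:: [:: x]] :: b) ->
  exists l, removal n (mult_array ((1, 1)%N :: B)) (mult_array B) x l
    (Phi ((1, 1)%N :: B) ([:: [:: x]] :: b)) (Phi B b).
Proof.
move=> hB hb; have hB' : is_shapes n B by case/andP: hB.
have hb' : is_path n B b by move: hb; rewrite is_path_cons => /andP[].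
have xn : (1 <= x <= n)%N by move: hb; rewrite is_path_cons /is_tableau /= => /andP[]; lia.
have e := Phi_lh hPhi hB (is_path_all hb); rewrite /= in e; rewrite -e.
have R := Phi_RC hB hb; have R' := Phi_RC hB' hb'; rewrite -e in R'.
apply: delta_removal => //; first exact: mult_array_cons.
- exact: RC_supported R.
- exact: RC_supported R'.
- move=> c cn; apply: (RC_boxes_diff (mult_array_cons _ _) _ R R') => //; first by lia.
  by move=> j; rewrite !tnth_wt letters_box /= addnC eq_sym.
Qed.

Lemma commutes_box B x b : is_shapes n ((1, 1)%N :: B) ->
  is_path n ((1, 1)%N :: B) ([:: [:: x]] :: b) -> commutes B b ->
  commutes ((1, 1)%N :: B) ([:: [:: x]] :: b).
Proof.
move=> hB hb IH k s rc1 F.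
have hB' : is_shapes n B by case/andP: hB.
have hb' : is_path n B b by move: hb; rewrite is_path_cons => /andP[].
have R := Phi_RC hB hb; have R' := Phi_RC hB' hb'.
have U := RC_upper R; have U' := RC_upper R'.
have [l D] := Phi_removal hB hb.
have [k' [s' F']] := rc_lowerP (mult_array B) (RC_supported R') an.
have [es' cm] := IH _ _ _ F'.
have [N1 bN1] := supported_bounded (mult_array ((1, 1)%N :: B)) (RC_supported R).
have [N2 bN2] := supported_bounded (mult_array B) (RC_supported R').
have bN := bounded_le (leq_addr N2 N1) bN1; have bN' := bounded_le (leq_addl N1 N2) bN2.
have pE := Phi_pinf hB hb bN; have pE' := Phi_pinf hB' hb' bN'.
have es : s = - (ep a ([:: [:: x]] :: b))%:Z.
  rewrite ep_box; case: (ltngtP x a) => xa.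
  - have [-> _] := step_lt D an F F' xa; rewrite es'.
    by have -> : (x == a.+1) = false by lia.
  - rewrite (step_gt_low D an F F' U U' bN bN' xa) pE' es'.
    case: (eqVneq x a.+1) => //= _.
    have -> : (- (ep a b)%:Z == (ph a b)%:Z - (ep a b)%:Z) = (ph a b == 0%N) by lia.
    by case: eqP; lia.
  - have [-> _] := step_eq_low D F F' xa; rewrite es'.
    by have -> : (x == a.+1) = false by lia.
split=> // b1 fb.
have sN : s < vac n (mult_array ((1, 1)%N :: B)) (Phi ((1, 1)%N :: B) ([:: [:: x]] :: b)) a (N1 + N2)%N.
  by rewrite pE es; have := isSome_path_f a ([:: [:: x]] :: b); rewrite fb /=; lia.
have an2 : (a < n)%N by lia.
have hb1 := path_f_path an2 hB hb fb.
have U1 := lowering_upper F an U bN sN; have U2 := RC_upper (Phi_RC hB hb1).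
move: fb; rewrite path_f_box; case: ifP => [/andP[/eqP xa /eqP ph0] [eb]|h1].
  (* The tail is unchanged here: with rank [a.+1], delta sends both [rc1] and the image of the new
     path to [Phi B b]. *)
  subst b1; have [l1 D1] := step_tight D an F F' U' bN' xa ltac:(rewrite pE' es' ph0; lia).
  by have [l2 D2] := Phi_removal hB hb1; exact: removal_inj D2 D1 U2 U1.
case: ifP => // h2; case E : (path_f a b) => [b1'|] //= [eb]; subst b1.
have phb : (0 < ph a b)%N by rewrite -isSome_path_f E.
have [l2 D2] := Phi_removal hB hb1; rewrite (cm _ E) in D2.
suff [l1 D1] : exists l1, removal n (mult_array ((1, 1)%N :: B)) (mult_array B) x l1 rc1 (rc_lower n (mult_array B) a (Phi B b)).
  exact: removal_inj D2 D1 U2 U1.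
case: (ltngtP x a) => xa.
- by have [] := step_lt D an F F' xa.
- exact: step_gt D an F F' U bN bN' xa sN.
- by apply: (step_eq D an F F' U' bN' xa); rewrite pE' es'; lia.
Qed.

(** With $2rs-1$ for each factor, every one of [lh], [ls] and [lb] lowers the sum by exactly one. *)
Definition shape_weight (B : shapes) := (\sum_(x <- B) (2 * x.1 * x.2).-1)%N.

Lemma commutes_all B b : is_shapes n B -> is_path n B b -> commutes B b.
Proof.
have an2 : (a < n)%N by lia.
have [m] := ubnP (shape_weight B); elim: m => // m IHm in B b *.
case: B b => [|[r s] B] [|T b] // lt hB hb.
  (* The empty configuration has no strings, so the lowered string is virtual and [s = 0]. *)
  move=> k s rc1 F; split=> //; have [[O e] _ _ z] := lowering_fstring F.
  have [k0|k0] := posnP k; first by rewrite z.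
  have : (k, s) \in strings (Phi [::] [::]) a.
    by rewrite e in_msetD in_mset_string eqxx -lt0n k0 orbT.
  by rewrite (Phi_nil hPhi) /strings fsfunE in_mset mset0E.
have /andP[/andP[/= rn s0] hB'] := hB.
move: (hb); rewrite is_path_cons => /andP[hT hb'].
rewrite /shape_weight big_cons /= -/(shape_weight B) in lt.
have [s1|s1] := ltnP 1 s.
  have e c : is_path n ((r, s) :: B) c -> Phi ((r, s) :: B) c = Phi [:: (r, 1), (r, s.-1) & B]%N (ls c).
    by move=> hc; exact: (Phi_ls hPhi s1 hB (is_path_all hc)).
  have [_ epE fE] := ls_invariant a b s0 hT.
  have IH : commutes [:: (r, 1), (r, s.-1) & B]%N (ls (T :: b)).
    apply: IHm; rewrite ?/shape_weight ?big_cons -?/(shape_weight B) /=.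
    - by move: lt; case: (s) s1 => [|[|s']] // _; nia.
    - by apply/and3P; split=> //=; lia.
    - by case/andP: (ls_tableau s0 hT) => h1 h2; apply/and3P; split.
  move=> k t rc1; rewrite e // => /IH[es cm]; split; first by rewrite es epE.
  move=> b1 fb; have hb1 := path_f_path an2 hB hb fb.
  by rewrite e // cm // fE fb.
have es1 : s = 1%N by lia.
subst s; have [r1|r1] := ltnP 1 r.
  have T0 : T != [::] by case/and3P: hT; case: (T) => //= /eqP e; lia.
  have e c : is_path n ((r, 1%N) :: B) c ->
      lb_rc n (mult_array [:: (1, 1), (r.-1, 1) & B]%N) r (Phi ((r, 1%N) :: B) c) = Phi [:: (1, 1), (r.-1, 1) & B]%N (lb c).
    by move=> hc; exact: (Phi_lb hPhi r1 hB (is_path_all hc)).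
  have [_ epE fE] := lb_invariant a b T0.
  have IH : commutes [:: (1, 1), (r.-1, 1) & B]%N (lb (T :: b)).
    apply: IHm; rewrite ?/shape_weight ?big_cons -?/(shape_weight B) /=.
    - lia.
    - by apply/and3P; split=> //=; lia.
    - by case/andP: (lb_tableau r1 hT) => h1 h2; apply/and3P; split.
  have rn' : (2 <= r < n)%N by lia.
  have eL := mult_array_cons (r, 1%N) B.
  have eL' := etrans (mult_array_cons (1, 1)%N ((r.-1, 1%N) :: B)) (congr1 (msetD _) (mult_array_cons (r.-1, 1%N) B)).
  have R := Phi_RC hB hb; have U := RC_upper R; have sup := RC_supported R.
  move=> k t rc1 F.
  have [k' [t' F']] := rc_lowerP (mult_array B) (lb_supported (mult_array [:: (1, 1), (r.-1, 1) & B]%N) r sup) an.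
  have [N bN] := supported_bounded (mult_array ((r, 1%N) :: B)) sup.
  have et := lb_low eL eL' rn' F F' U an bN.
  have F2 := F'; rewrite e // in F2; have [et' cm] := IH _ _ _ F2.
  have es : t = - (ep a (T :: b))%:Z by rewrite -et et' epE.
  split=> // b1 fb; have hb1 := path_f_path an2 hB hb fb.
  have tN : t < vac n (mult_array ((r, 1%N) :: B)) (Phi ((r, 1%N) :: B) (T :: b)) a N.
    by rewrite (Phi_pinf hB hb bN) es; have := isSome_path_f a (T :: b); rewrite fb /=; lia.
  have E := lb_lowering eL eL' rn' F F' U an bN tN.
  apply: (lb_inj (RC_supported (Phi_RC hB hb1)) (lowering_sup1 F) (L' := mult_array [:: (1, 1), (r.-1, 1) & B]%N) (r := r)).
  by rewrite -E !e //; apply: cm; rewrite fE fb.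
have er1 : r = 1%N by lia.
subst r; have [x ex] : exists x, T = [:: [:: x]].
  move: hT => /and3P[]; case: (T) => [|R [|? ?]] //= _; case: R => [|x [|? ?]] //= _; by exists x.
subst T; apply: commutes_box => //; apply: IHm => //; lia.
Qed.

End Main.

Local Close Scope mset_scope.
Local Close Scope ring_scope.

Theorem theorem4p13 (n : nat) (hn : 2 <= n)
    (Phi : shapes -> cpath -> rconf) (hPhi : is_Phi n Phi)
    (B : shapes) (hB : is_shapes n B)
    (a : nat) (ha : 1 <= a < n)
    (b : cpath) (hb : all_paths n B b) :
  omap (Phi B) (path_f a b) = rc_f n (mult_array B) a (Phi B b) /\
  omap (Phi B) (path_e a b) = rc_e n (mult_array B) a (Phi B b).
Proof.
have {}hb : is_path n B b by case: hb => lam _ [].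
have R := Phi_RC hPhi hB hb.
have [k [s F]] := rc_lowerP (mult_array B) (RC_supported R) ha.
have [es cm] := commutes_all hPhi ha hB hb F.
split.
  rewrite rc_fE; case E : (path_f a b) => [b1|] /=.
    rewrite -(cm _ E) mem_set //; exists (wt n b1) => //.
    by apply: (Phi_RC hPhi hB); apply: path_f_path hB hb E; case/andP: ha.
  case: ifPn => // /set_mem [lam _ R1].
  have [N bN] := supported_bounded (mult_array B) (RC_supported R).
  (* A valid result puts [s], which is minus epsilon, below phi minus epsilon; then phi is positive
     and $f_a$ would be defined. *)
  have := lowering_upper_lt F ha (RC_upper R) bN (RC_upper R1).
  rewrite (Phi_pinf hPhi ha hB hb bN) es; have := isSome_path_f a b; rewrite E /=; lia.
case E : (path_e a b) => [c|] /=.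
  have hc : is_path n B c by apply: path_e_path hB hb E; lia.
  (* As [b] is $f_a$ of [c], its image is the lowered image of [c], and [rc_e] undoes the
     lowering. *)
  have [k' [s' F']] := rc_lowerP (mult_array B) (RC_supported (Phi_RC hPhi hB hc)) ha.
  have [_ cm'] := commutes_all hPhi ha hB hc F'.
  by rewrite (cm' _ (path_eK E)) (rc_e_lowering _ ha F').
have ep0 : ep a b = 0%N by have := isSome_path_e a b; rewrite E /=; lia.
(* With epsilon zero, [s = 0] bounds the riggings from below, so none is negative. *)
rewrite /rc_e; case E' : (e_string _) => [[i x]|] //.
have := ohead_sort_mem E'; rewrite mem_filter => /andP[/= x0 /(lowering_min F)[]].
by rewrite es ep0; lia.
Qed.
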